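(* Let $m\geq2$ be an integer, let $(\xi_i)_{i\in\mathbb{Z}}$ be an i.i.d. sequence taking values in a measurable space $(S,\mathcal{S})$, let $(\mathbb{B},\|\cdot\|_{\mathbb{B}})$ be a separable $r$-smooth Banach space with $r\in(1,2]$, and let $h\colon S^m\to\mathbb{B}$ be a measurable symmetric function which is degenerated of order $d\in\{1,\dots,m\}$ with respect to $(\xi_i)_{i\in\mathbb{Z}}$. Let $n\geq m$, let $p_n\in[0,1]$ and let $(a_{n;\mathbf{i}})_{\mathbf{i}\in\operatorname{Inc}^m_n}$ be an i.i.d. family of Bernoulli random variables with parameter $p_n$ which is independent of $(\xi_i)_{i\in\mathbb{Z}}$. Let $$U^{\mathrm{inc}}_{m,n}(h)=\sum_{\mathbf{i}\in\operatorname{Inc}^m_n}a_{n;\mathbf{i}}\,h(\xi_{\mathbf{i}}).$$ Then for each $p\in(1,r]$ and each $q\geq p$, $$\mathbb{E}\left[\|U^{\mathrm{inc}}_{m,n}(h)\|_{\mathbb{B}}^q\right]\leq C(\mathbb{B},m,p,q)\left(n^{q(m-d)+dq/p}p_n^q+n^{mq/p}p_n^{q/p}+n^mp_n\right)\mathbb{E}\left[\|h(\xi_1,\dots,\xi_m)\|_{\mathbb{B}}^q\right],$$ where the constant $C(\mathbb{B},m,p,q)$ depends only on $\mathbb{B}$, $m$, $p$ and $q$.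
   Context: A separable Banach space $(\mathbb{B},\|\cdot\|_{\mathbb{B}})$ is $r$-smooth, $1<r\leq 2$, if there exists an equivalent norm $\|\cdot\|'_{\mathbb{B}}$ on $\mathbb{B}$ such that $\sup_{t>0}\sup_{x,y\in\mathbb{B},\|x\|'_{\mathbb{B}}=\|y\|'_{\mathbb{B}}=1}\frac{\|x+ty\|'_{\mathbb{B}}+\|x-ty\|'_{\mathbb{B}}-2}{t^r}<\infty$. $\operatorname{Inc}^m_n=\{\mathbf{i}=(i_1,\dots,i_m):1\leq i_1<\dots<i_m\leq n\}$; $\xi_{\mathbf{i}}=(\xi_{i_1},\dots,\xi_{i_m})$. A Bernoulli random variable with parameter $p_n$ takes the value $1$ with probability $p_n$ and $0$ with probability $1-p_n$. $h$ is symmetric if $h(x_{\sigma(1)},\dots,x_{\sigma(m)})=h(x_1,\dots,x_m)$ for each bijection $\sigma$ of $\{1,\dots,m\}$ and all $x_1,\dots,x_m\in S$. A symmetric kernel $h$ is degenerated of order $d\in\{1,\dots,m\}$ with respect to $(\xi_i)$ if $\mathbb{E}[h(\xi_1,\dots,\xi_m)\mid\xi_1,\dots,\xi_{d-1}]=0$ a.s. (for $d=1$: the expectation is $0$) and $\mathbb{E}\left[\left\|\mathbb{E}[h(\xi_1,\dots,\xi_m)\mid\xi_1,\dots,\xi_d]\right\|_{\mathbb{B}}\right]\neq0$. *)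

(* Defs.v *)
From HB Require Import structures.
From mathcomp Require Import all_boot all_order all_algebra perm finmap.
From mathcomp Require Import all_classical all_reals all_analysis.

Set Implicit Arguments.
Unset Strict Implicit.
Unset Printing Implicit Defensive.

Import Order.TTheory GRing.Theory Num.Theory.
Import numFieldNormedType.Exports.

Local Open Scope classical_set_scope.
Local Open Scope ring_scope.

Section banach.
Context {R : realType} (B : completeNormedModType R).

Definition separable := exists D : set B, countable D /\ dense D.

Definition is_norm (N : B -> R) :=
  [/\ forall x y, N (x + y) <= N x + N y,
      forall c x, N (c *: x) = `|c| * N x
    & forall x, N x = 0 -> x = 0].

Definition equivalent_norm (N : B -> R) :=
  is_norm N /\
  exists c1 c2 : R, [/\ 0 < c1, 0 < c2 & forall x, c1 * `|x| <= N x <= c2 * `|x|].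

Definition r_smooth (r : R) :=
  exists N : B -> R, equivalent_norm N /\
    (ereal_sup [set e | exists (t : R) (x y : B), [/\ 0 < t, N x = 1, N y = 1 &
        e = ((N (x + t *: y) + N (x - t *: y) - 2) / t `^ r)%:E]%R] < +oo)%E.

Definition borel := g_sigma_algebraType (@open B).

End banach.

Section integration.
Context {R : realType} {B : completeNormedModType R}.
Context {d : measure_display} {T : measurableType d} (P : probability T R).

Definition simple_function (s : T -> B) :=
  finite_set (range s) /\ forall y, measurable (s @^-1` [set y]).

Definition simple_integral (s : T -> B) : B :=
  \sum_(y \in range s) fine (P (s @^-1` [set y])) *: y.

(* The Bochner integral as a relation: X is Bochner integrable with integral v.
   Borel measurability is the same as strong measurability when B is
   separable, the only case in which this is used. *)
Definition is_bochner_integral (X : T -> B) (v : B) :=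
  measurable_fun setT (X : T -> borel B) /\
  exists s : nat -> T -> B,
    [/\ forall n, simple_function (s n),
        (\int[P]_w (`|X w - s n w|)%:E)%E @[n --> \oo] --> 0%E
      & simple_integral (s n) @[n --> \oo] --> v].

(* Y is a version of the conditional expectation of X given the sub-sigma-
   algebra G; taking A := setT, this includes the integrability of X and Y. *)
Definition is_cond_exp (G : set (set T)) (X Y : T -> B) :=
  (forall A : set (borel B), measurable A -> G (Y @^-1` A)) /\
  forall A, G A -> exists v,
    is_bochner_integral (fun w => \1_A w *: X w) v /\
    is_bochner_integral (fun w => \1_A w *: Y w) v.

End integration.

Section independence.
Context {R : realType} {d : measure_display} {T : measurableType d}.
Variable P : probability T R.

(* For an empty index type this is the trivial sigma-algebra. *)
Definition sigma_family (I : Type) d' (S : measurableType d')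
    (X : I -> {RV P >-> S}) : set (set T) :=
  <<s \bigcup_(i in [set: I]) g_sigma_algebra_preimage (X i) >>.

Definition mutually_independent (I : choiceType) d' (S : measurableType d')
    (X : I -> {RV P >-> S}) :=
  forall (J : {fset I}) (A : I -> set S), (forall i, measurable (A i)) ->
    P (\bigcap_(i in [set` J]) X i @^-1` A i) =
    (\prod_(i <- J) P (X i @^-1` A i))%E.

Definition identically_distributed (I : Type) d' (S : measurableType d')
    (X : I -> {RV P >-> S}) :=
  forall i j A, measurable A ->
    distribution P (X i) A = distribution P (X j) A.

Definition iid (I : choiceType) d' (S : measurableType d')
    (X : I -> {RV P >-> S}) :=
  mutually_independent X /\ identically_distributed X.

Definition independent_families (I J : Type) d1 d2 (S1 : measurableType d1)
    (S2 : measurableType d2)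
    (X : I -> {RV P >-> S1}) (Y : J -> {RV P >-> S2}) :=
  forall A A', sigma_family X A -> sigma_family Y A' ->
    P (A `&` A') = (P A * P A')%E.

Definition bernoulli_rv (p : R) (X : {RV P >-> R}) :=
  distribution P X [set 1] = p%:E /\ distribution P X [set 0] = (1 - p)%:E.

End independence.

(* Strict increase starting from 0, i.e. 0 < i_1 < ... < i_m <= n. *)
Definition Inc (m n : nat) :=
  {i : m.-tuple 'I_n.+1 | path ltn 0%N [seq nat_of_ord j | j <- i]}.

Section ustatistics.
Context {R : realType} {B : completeNormedModType R}.
Context {d : measure_display} {T : measurableType d} {P : probability T R}.
Context {d' : measure_display} {S : measurableType d'}.
Variable xi : int -> {RV P >-> S}.

Definition symmetric_kernel (m : nat) (h : m.-tuple S -> B) :=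
  forall (s : 'S_m) (x : m.-tuple S), h [tuple tnth x (s k) | k < m] = h x.

Definition xi_at (m n : nat) (i : Inc m n) (w : T) : m.-tuple S :=
  [tuple xi (tnth (val i) k)%:Z w | k < m].

Definition xi_first (m : nat) (w : T) : m.-tuple S :=
  [tuple xi k.+1%:Z w | k < m].

Definition sigma_first (k : nat) : set (set T) :=
  sigma_family (fun j : 'I_k => xi j.+1%:Z).

(* For k = 1 the sigma-algebra in the first condition is trivial, so that
   condition says that the expectation is 0. *)
Definition degenerate_of_order (m : nat) (h : m.-tuple S -> B) (k : nat) :=
  (exists Y : T -> B,
     is_cond_exp P (sigma_first k.-1) (fun w => h (xi_first m w)) Y /\
     {ae P, forall w, Y w = 0}) /\
  (exists Y : T -> B,
     is_cond_exp P (sigma_first k) (fun w => h (xi_first m w)) Y /\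
     ('E_P[fun w => `|Y w|%R] <> 0)%E).

Definition Uinc (m n : nat) (a : Inc m n -> {RV P >-> R})
    (h : m.-tuple S -> B) (w : T) : B :=
  \sum_(i : Inc m n) a i w *: h (xi_at i w).

End ustatistics.

(* Main.v *)
Require Import Defs.
From HB Require Import structures.
From mathcomp Require Import all_boot all_order all_algebra perm finmap.
From mathcomp Require Import all_classical all_reals all_analysis.
From mathcomp Require Import measurable_realfun.
From mathcomp Require Import ring lra.

Set Implicit Arguments.
Unset Strict Implicit.
Unset Printing Implicit Defensive.

Import Order.TTheory GRing.Theory Num.Theory.
Import numFieldNormedType.Exports.

Local Open Scope classical_set_scope.
Local Open Scope ring_scope.

(** Only the smoothness constant of [B] matters, through the two-point inequality
    N(x+y)^q + N(x-y)^q <= 2 N(x)^q + C (N(x)^(q-p) N(y)^p + N(y)^q) for an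
    equivalent norm N, and everything can be proved on finite probability spaces.

    Finite case. Symmetrizing with an independent copy, a centered increment Y
    satisfies E N(x+Y)^q <= (1+eps) N(x)^q + C (eps^(1-q/p) (E N(Y)^p)^(q/p) + E N(Y)^q);
    with eps = 1/n, n such steps lose only a factor e. Write a_i = pn + (a_i - pn).
    Given the sample, the centered part is a sum of independent increments, which
    yields the last two terms of the bound. For the complete U-statistic, group
    the m-tuples by one extreme index: each group is the sum of a martingale difference
    (total cost n^(1/p)) and of its compensator (total cost n, one argument of the
    kernel being integrated out). By induction on m the q-th moment is bounded by the sum over
    c <= m of n^(q(m-c) + qc/p) times the q-th moment of the conditional expectation
    of h given c arguments, for an arbitrary symmetric kernel: degeneracy is not used.

    General case. The kernel h is approximated in L^q by H(pi x_1, ..., pi x_m) with H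
    symmetric and pi finite-valued. Degeneracy of h is inherited approximately:
    for c < d the conditional moments of H are at most E |h - H(pi)|^q, which only
    involves integrals of simple functions. Then the error tends to 0. *)

(** * Real inequalities *)

(** The obstacle is vector-valued integration: sums of Borel maps into [B] and conditional
    expectations are awkward. Hence moments are estimated where expectations are finite sums, with a
    constant that depends on neither the finite space, its weights nor the kernel; this uniformity
    lets the approximation be refined with the constant fixed.

    The exponents come from [eps = 1/n]. The factor [eps^(1 - q/p)] is [n^(q/p - 1)], and n centered
    steps turn it into [n^(q/p)]; for sums without cancellation the convexity weight is of order
    [n^(q-1)] and gives [n^q]. For a symmetric kernel only the number c of frozen arguments counts.
    As [n^(q/p) <= n^q], the largest power of n among the terms with [c >= d] is at [c = d], and
    degeneracy removes those with [c < d].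

    Discretization destroys exact degeneracy, so the finite bound carries a defect [eta]. Its factor
    [n^(q m)] is harmless because n stays fixed while [eta] tends to 0.

    Two features of the statement shape the end: the constant is chosen before r, and the q-th
    moment of h may be infinite. *)

Section powR_inequalities.
Context {R : realType}.
Implicit Types a b x y u q eps : R.

Lemma ler_powR2r q x y : 0 <= q -> 0 <= x -> x <= y -> x `^ q <= y `^ q.
Proof.
move=> q0 x0 xy; apply: ge0_ler_powR => //; rewrite nnegrE//.
exact: le_trans xy.
Qed.

(** Young's inequality, read as the tangent to [t^q] at b. It is linear in [a] and [a^q], so it can
    be averaged or integrated as it stands; both Jensen inequalities of this development arise so.
    The case [q = 1] is apart because the conjugate exponent [q / (q - 1)] degenerates. *)
Lemma powR_young q a b : 1 <= q -> 0 <= a -> 0 <= b ->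
  q * b `^ (q - 1) * a <= a `^ q + (q - 1) * b `^ q.
Proof.
move=> q1 a0 b0; have q0 : 0 < q by exact: lt_le_trans q1.
move: q1; rewrite le_eqVlt => /predU1P[<-|q1].
  by rewrite subrr powRr0 !powRr1// mul0r addr0 !mul1r.
have q10 : 0 < q - 1 by rewrite subr_gt0.
have := @conjugate_powR _ a (b `^ (q - 1)) q (q / (q - 1)) a0 (powR_ge0 _ _) q0
  (divr_gt0 q0 q10).
have -> : q^-1 + (q / (q - 1))^-1 = 1 by field; rewrite !gt_eqF.
move/(_ erefl); rewrite -powRrM (_ : (q - 1) * (q / (q - 1)) = q); last first.
  by field; rewrite gt_eqF.
rewrite -(ler_pM2l q0) => /le_trans-/(_ (a `^ q + (q - 1) * b `^ q)) H.
rewrite -mulrA (mulrC _ a); apply: H.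
rewrite le_eqVlt; apply/orP; left; apply/eqP; field.
by rewrite !gt_eqF.
Qed.

Lemma powR_bernoulli q u : 1 <= q -> 0 <= u -> 1 + q * (u - 1) <= u `^ q.
Proof.
move=> q1 u0; have := powR_young q1 u0 ler01; rewrite !powR1.
by move: (u `^ q) => ?; lra.
Qed.

(* Second-order Taylor bound: the tangent of t^q at u, evaluated at 1, reduces
   it to a Lipschitz bound for t^(q-1) at 1. *)
Lemma powR_taylor q u : 1 <= q -> 0 <= u <= 2 ->
  u `^ q <= 1 + q * (u - 1) + q * (q * 2 `^ (q - 1)) * (u - 1) ^+ 2.
Proof.
move=> q1 /andP[u0 u2].
have q0 : 0 < q by exact: lt_le_trans q1.
have q10 : 0 <= q - 1 by rewrite subr_ge0.
have tangent : u `^ q <= 1 + q * u `^ (q - 1) * (u - 1).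
  have := powR_young q1 ler01 u0; rewrite powR1 mulr1.
  have : u * u `^ (q - 1) = u `^ q by rewrite mulr_powRB1.
  move: (u `^ q) (u `^ (q - 1)) => Q P <-; nra.
have L1 : 1 <= 2 `^ (q - 1) :> R.
  by rewrite -[leLHS](powRr0 2); apply: ler_powR => //; rewrite ler1n.
suff lip : (u `^ (q - 1) - 1) * (u - 1) <= q * 2 `^ (q - 1) * (u - 1) ^+ 2.
  apply: (le_trans tangent).
  rewrite -addrA lerD2l -subr_ge0.
  have -> : q * (u - 1) + q * (q * 2 `^ (q - 1)) * (u - 1) ^+ 2
      - q * u `^ (q - 1) * (u - 1) =
    q * (q * 2 `^ (q - 1) * (u - 1) ^+ 2 - (u `^ (q - 1) - 1) * (u - 1)) by ring.
  by rewrite mulr_ge0 ?(ltW q0)// subr_ge0.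
(* On either side of 1, [u^(q-1)] lies between 1 and [u^q], so the increment of [u^q] may be
   estimated instead. This treats all [q >= 1] alike, whether [u^(q-1)] is convex or concave. *)
have [u1|u1] := leP 1 u.
  rewrite expr2 mulrA ler_wpM2r ?subr_ge0//.
  apply: (@le_trans _ _ (u `^ q - 1)).
    by rewrite lerD2r; apply: ler_powR => //; rewrite gerBl.
  apply: (@le_trans _ _ (q * u `^ (q - 1) * (u - 1))); first by lra.
  by rewrite ler_wpM2r ?subr_ge0// ler_wpM2l ?(ltW q0)//; apply: ler_powR2r.
have -> : (u `^ (q - 1) - 1) * (u - 1) = (1 - u `^ (q - 1)) * (1 - u) by ring.
have -> : q * 2 `^ (q - 1) * (u - 1) ^+ 2
   = q * 2 `^ (q - 1) * (1 - u) * (1 - u) by ring.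
rewrite ler_wpM2r ?subr_ge0 ?(ltW u1)//.
have uq : u `^ q <= u `^ (q - 1).
  rewrite -(mulr_powRB1 u0 q0) ler_piMl ?powR_ge0//; exact: ltW.
have := powR_bernoulli q1 u0.
move: (u `^ q) (u `^ (q - 1)) (2 `^ (q - 1)) L1 uq => Q P L L1 uq bern.
have : 0 <= q * (1 - u) * (L - 1) by rewrite !mulr_ge0 ?subr_ge0// ltW.
by lra.
Qed.

Lemma powR_addr_le q a b : 0 <= q -> 0 <= a -> 0 <= b ->
  (a + b) `^ q <= 2 `^ q * (a `^ q + b `^ q).
Proof.
move=> q0 a0 b0.
apply: (@le_trans _ _ ((2 * Num.max a b) `^ q)).
  apply: ler_powR2r => //; first exact: addr_ge0.
  by rewrite mulr_natl mulr2n lerD// le_max lexx// orbT.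
rewrite powRM//; last by rewrite le_max a0.
rewrite ler_wpM2l ?powR_ge0// /Num.max; case: ifP => _.
  by rewrite lerDr powR_ge0.
by rewrite lerDl powR_ge0.
Qed.

(* Convexity of t^q, with weights [1/(1+eps)] and [eps/(1+eps)]. *)
Lemma powR_addr_eps q eps a b : 1 <= q -> 0 < eps -> 0 <= a -> 0 <= b ->
  (a + b) `^ q <=
  (1 + eps) `^ (q - 1) * a `^ q + ((1 + eps) / eps) `^ (q - 1) * b `^ q.
Proof.
move=> q1 e0 a0 b0.
have q0 : 0 < q by exact: lt_le_trans q1.
have e10 : 0 < 1 + eps by rewrite addr_gt0.
set s := a + b; have s0 : 0 <= s by exact: addr_ge0.
have aux k x : 0 < k -> 0 <= x ->
    q * s `^ (q - 1) * x <= k `^ (q - 1) * x `^ q + k^-1 * ((q - 1) * s `^ q).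
  move=> k0 x0.
  have := powR_young q1 (mulr_ge0 (ltW k0) x0) s0.
  rewrite (powRM _ (ltW k0) x0) -(mulr_powRB1 (ltW k0) q0) => H.
  rewrite -(ler_pM2l k0).
  have -> : k * (q * s `^ (q - 1) * x) = q * s `^ (q - 1) * (k * x) by ring.
  have -> // : k * (k `^ (q - 1) * x `^ q + k^-1 * ((q - 1) * s `^ q)) =
    k * k `^ (q - 1) * x `^ q + (q - 1) * s `^ q.
  by field; rewrite gt_eqF.
have ke : 0 < (1 + eps) / eps by rewrite divr_gt0.
have := lerD (aux _ _ e10 a0) (aux _ _ ke b0).
have sE : s * s `^ (q - 1) = s `^ q by rewrite mulr_powRB1.
have -> : q * s `^ (q - 1) * a + q * s `^ (q - 1) * b = q * s `^ q.
  by rewrite -sE /s; ring.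
set t1 := _ `^ (q - 1) * a `^ q; set t2 := _ `^ (q - 1) * b `^ q.
have -> : t1 + (1 + eps)^-1 * ((q - 1) * s `^ q) +
    (t2 + ((1 + eps) / eps)^-1 * ((q - 1) * s `^ q)) =
    t1 + t2 + (q - 1) * s `^ q by field; rewrite !gt_eqF.
by lra.
Qed.

Lemma expr1Dinvn_le n : (1 + n%:R^-1) ^+ n <= expR 1 :> R.
Proof.
case: n => [|n]; first by rewrite expr0 -expR0 ler_expR.
have := expR_ge1Dx (n.+1%:R^-1 : R).
rewrite -(@ler_pXn2r _ n.+1)// ?nnegrE ?expR_ge0 ?addr_ge0 ?invr_ge0//.
by rewrite -expRM_natl divff ?pnatr_eq0.
Qed.

(** Unrolled, the recursion sums k powers of [kappa], each at most [kappa^k] since [1 <= kappa]. It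
    is applied with [kappa] a power of [1 + 1/n], whose n-th power stays bounded in n. *)
Lemma gronwall (n : nat) (A : nat -> R) kappa beta :
  1 <= kappa -> 0 <= beta -> A 0%N <= 0 ->
  (forall k, (k < n)%N -> A k.+1 <= kappa * A k + beta) ->
  A n <= n%:R * kappa ^+ n * beta.
Proof.
move=> k1 b0 A0 H.
have k0 : 0 <= kappa by exact: le_trans k1.
suff : forall k, (k <= n)%N -> A k <= k%:R * kappa ^+ k * beta by apply.
elim=> [_|k IH kn]; first by rewrite !mul0r.
apply: (le_trans (H _ kn)).
apply: (@le_trans _ _ (kappa * (k%:R * kappa ^+ k * beta) + kappa ^+ k.+1 * beta)).
  apply: lerD; first by rewrite ler_wpM2l// IH// ltnW.
  by rewrite ler_peMl// exprn_ege1.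
by rewrite -natr1 exprS le_eqVlt; apply/orP; left; apply/eqP; ring.
Qed.

(* Either [c y <= eps x^p] or [x^p] is bounded in terms of y. *)
Lemma powR_mixed (p q eps c x y : R) : 0 < p -> p <= q -> 0 < eps ->
  0 <= c -> 0 <= x -> 0 <= y ->
  c * (x `^ (q - p) * y) <= eps * x `^ q + c `^ (q / p) * eps `^ (1 - q / p) * y `^ (q / p).
Proof.
move=> p0 pq e0 c0 x0 y0.
have s1 : 0 <= q / p - 1 by rewrite subr_ge0 ler_pdivlMr// mul1r.
have xE : x `^ (q - p) = (x `^ p) `^ (q / p - 1).
  by rewrite -powRrM; congr (_ `^ _); field; rewrite gt_eqF.
have xqE : x `^ p * x `^ (q - p) = x `^ q.
  have [->|x_neq0] := eqVneq x 0.
    rewrite powR0 ?gt_eqF// mul0r powR0// gt_eqF//; exact: lt_le_trans pq.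
  by rewrite -powRD ?x_neq0 ?implybT// subrKC.
have [le|gt] := leP (c * y) (eps * x `^ p).
  rewrite -[leLHS]addr0 lerD//; last by rewrite !mulr_ge0// powR_ge0.
  rewrite mulrCA mulrC -xqE mulrA ler_wpM2r// powR_ge0//.
rewrite -[leLHS]add0r lerD//; first by rewrite !mulr_ge0// ?powR_ge0// ltW.
apply: (@le_trans _ _ ((c * y) * (c * y / eps) `^ (q / p - 1))).
  rewrite mulrCA mulrC ler_wpM2l ?mulr_ge0// xE.
  by apply: ler_powR2r; rewrite ?powR_ge0// ler_pdivlMr// mulrC ltW.
have cy0 : 0 <= c * y by rewrite mulr_ge0.
rewrite powRM// ?invr_ge0 ?(ltW e0)// mulrA mulr_powRB1//; last first.
  by rewrite divr_gt0// (lt_le_trans p0).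
rewrite powRM// -(powR_inv1 (ltW e0)) -powRrM mulN1r opprB.
by rewrite mulrAC.
Qed.

(** [powR_young] is averaged with b the mean itself: the left side becomes [q b^q], of which
    [(q - 1) b^q] cancels. *)
Lemma jensen_powR (I : finType) (w : I -> R) (f : I -> R) q : 1 <= q ->
  (forall i, 0 <= w i) -> \sum_i w i = 1 -> (forall i, 0 <= f i) ->
  (\sum_i w i * f i) `^ q <= \sum_i w i * f i `^ q.
Proof.
move=> q1 w0 w1 f0; set b := \sum_i w i * f i.
have b0 : 0 <= b by apply: sumr_ge0 => i _; rewrite mulr_ge0.
have q0 : 0 < q by exact: lt_le_trans q1.
have : \sum_i w i * (q * b `^ (q - 1) * f i) <=
       \sum_i w i * (f i `^ q + (q - 1) * b `^ q).
  by apply: ler_sum => i _; rewrite ler_wpM2l// powR_young.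
under eq_bigr do rewrite mulrCA.
under [X in _ <= X]eq_bigr do rewrite mulrDr.
rewrite -mulr_sumr big_split/= -mulr_suml w1 mul1r -/b.
rewrite -mulrA (mulrC _ b) mulr_powRB1//.
by lra.
Qed.

End powR_inequalities.

(** * Smooth norms *)

Section norms.
Context {R : realType} {B : completeNormedModType R}.
Variable N : B -> R.
Hypothesis normN : is_norm N.

Lemma is_normD x y : N (x + y) <= N x + N y. Proof. by case: normN. Qed.

Lemma is_normZ c x : N (c *: x) = `|c| * N x. Proof. by case: normN. Qed.

Lemma is_norm_eq0 x : N x = 0 -> x = 0. Proof. by case: normN => _ _; exact. Qed.

Lemma is_norm0 : N 0 = 0.
Proof. by rewrite -(scale0r (0 : B)) is_normZ normr0 mul0r. Qed.

Lemma is_normN x : N (- x) = N x.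
Proof. by rewrite -scaleN1r is_normZ normrN1 mul1r. Qed.

(** Positivity is not listed among the axioms of [is_norm]; it comes from
    [0 = N (x - x) <= 2 N x]. *)
Lemma is_norm_ge0 x : 0 <= N x.
Proof.
have := is_normD x (- x); rewrite subrr is_norm0 is_normN -mulr2n.
by rewrite pmulrn_lge0.
Qed.

Lemma is_normB x y : N (x - y) <= N x + N y.
Proof. by rewrite -(is_normN y) is_normD. Qed.

Lemma ler_is_normD x y : N x - N y <= N (x + y).
Proof. by rewrite lerBlDr -{1}(addrK y x) is_normB. Qed.

Lemma is_norm_sum (I : Type) (s : seq I) (f : I -> B) :
  N (\sum_(i <- s) f i) <= \sum_(i <- s) N (f i).
Proof.
elim: s => [|i s IH]; first by rewrite !big_nil is_norm0.
by rewrite !big_cons (le_trans (is_normD _ _))// lerD2l.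
Qed.

End norms.
Arguments is_norm_ge0 {R B N}.

(** For [q = p] this is, up to constants, the classical inequality of p-uniform smoothness. The
    coefficient 2 of [N x ^ q] matches the two terms on the left, so that iterating over many
    increments does not inflate the past. *)
Definition two_point {R : realType} {B : completeNormedModType R} (N : B -> R)
    (p q C : R) :=
  forall x y, N (x + y) `^ q + N (x - y) `^ q <=
    2 * N x `^ q + C * (N x `^ (q - p) * N y `^ p + N y `^ q).

Section smoothness.
Context {R : realType} {B : completeNormedModType R}.
Variable N : B -> R.
Hypothesis normN : is_norm N.
Let N_ge0 := is_norm_ge0 normN.

(** Let [t = N y]. If [t <= 1], the second-order bounds for both q-th powers at 1 are added: the
    linear terms form the quantity bounded by [K t^r], and [t^r] and [t^2] are at most [t^p] because
    [p <= r <= 2]. If [t > 1], the triangle inequality suffices. The summands [q K], [2 c] and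
    [2 * 2^q] of the constant come from the linear terms, the remainders and the case [t > 1]. *)
Lemma smooth_two_point_unit (r p q K : R) :
  1 < p -> p <= r -> r <= 2 -> p <= q -> 0 <= K ->
  (forall t x y, 0 < t -> N x = 1 -> N y = 1 ->
     N (x + t *: y) + N (x - t *: y) - 2 <= K * t `^ r) ->
  exists2 C, 2 <= C & forall x y, N x = 1 ->
    N (x + y) `^ q + N (x - y) `^ q <= 2 + C * (N y `^ p + N y `^ q).
Proof.
move=> p1 pr r2 pq K0 smooth.
have q1 : 1 <= q by exact/ltW/(lt_le_trans p1).
have q0 : 0 < q by exact: lt_le_trans q1.
pose c := q * (q * 2 `^ (q - 1)).
have c0 : 0 <= c by rewrite !mulr_ge0 ?powR_ge0// ltW.
have t2q : 1 <= 2 `^ q :> R.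
  by rewrite -[leLHS](powRr0 2); apply: ler_powR; rewrite ?ler1n// ltW.
exists (q * K + 2 * c + 2 * 2 `^ q).
  have : 0 <= q * K by rewrite mulr_ge0// ltW.
  by lra.
move=> x y x1; set t := N y.
have t0 : 0 <= t by exact: N_ge0.
have D0 : 0 <= q * K + 2 * c by rewrite !addr_ge0 ?mulr_ge0// ltW.
have [t1|t1] := leP t 1; last first.
  have bnd z : N z <= 1 + t -> N z `^ q <= 2 `^ q * t `^ q.
    move=> zt; rewrite -powRM//; apply: ler_powR2r => //; first exact: ltW.
    by apply: (le_trans zt); lra.
  have b1 : N (x + y) <= 1 + t by rewrite -x1 is_normD.
  have b2 : N (x - y) <= 1 + t by rewrite -x1 is_normB.
  apply: (le_trans (lerD (bnd _ b1) (bnd _ b2))).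
  have := powR_ge0 t p; have := powR_ge0 t q.
  move: D0 t2q; move: (_ + 2 * c) (2 `^ q) (t `^ q) (t `^ p) => a b e f; nra.
have [y0|y_neq0] := eqVneq y 0.
  rewrite y0 subr0 addr0 x1 powR1 lerDl mulr_ge0//.
    by rewrite addr_ge0 ?mulr_ge0 ?powR_ge0.
  by rewrite addr_ge0 ?powR_ge0.
have {}t0 : 0 < t.
  rewrite lt0r t0 andbT; apply: contra_neq y_neq0; exact: is_norm_eq0.
have tp : t `^ r <= t `^ p.
  by apply: ger_powR => //; rewrite t0.
have tp2 : t ^+ 2 <= t `^ p.
  rewrite -powR_mulrn ?(ltW t0)//; apply: ger_powR; rewrite ?t0//.
  exact: le_trans r2.
have N1 : N (t^-1 *: y) = 1.
  by rewrite is_normZ// gtr0_norm ?invr_gt0// mulVf// gt_eqF.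
have := smooth t x (t^-1 *: y) t0 x1 N1.
rewrite scalerA divff ?gt_eqF// scale1r => sm.
have bnd z : 1 - t <= N z <= 1 + t ->
    N z `^ q <= 1 + q * (N z - 1) + c * t `^ p.
  move=> /andP[z1 z2]; apply: (le_trans (powR_taylor q1 _)).
    by rewrite N_ge0/= (le_trans z2)//; lra.
  rewrite lerD2l ler_wpM2l//; apply: le_trans tp2.
  by rewrite -subr_ge0 subr_sqr mulr_ge0//; lra.
have xy1 : 1 - t <= N (x + y) <= 1 + t.
  by rewrite -x1 is_normD// andbT ler_is_normD.
have xy2 : 1 - t <= N (x - y) <= 1 + t.
  by rewrite -x1 is_normB// andbT /t -(is_normN normN y) ler_is_normD.
apply: (le_trans (lerD (bnd _ xy1) (bnd _ xy2))).
have : q * (N (x + y) + N (x - y) - 2) <= q * (K * t `^ p).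
  by rewrite ler_wpM2l ?(ltW q0)// (le_trans sm)// ler_wpM2l.
have : 0 <= 2 `^ q * (t `^ p + t `^ q) by rewrite mulr_ge0 ?addr_ge0 ?powR_ge0.
have : 0 <= (q * K + 2 * c) * t `^ q by rewrite mulr_ge0 ?powR_ge0.
by move: (2 `^ q) (t `^ q) (t `^ p) => b e f; lra.
Qed.

(** Division by [N x] reduces to the unit case. At [x = 0] there is nothing to normalize and the
    left side is [2 N(y)^q], which is where [2 <= C] enters. *)
Lemma two_point_homogeneous (p q C : R) : 1 < p -> p <= q -> 2 <= C ->
  (forall x y, N x = 1 ->
    N (x + y) `^ q + N (x - y) `^ q <= 2 + C * (N y `^ p + N y `^ q)) ->
  two_point N p q C.
Proof.
move=> p1 pq C2 unit_ x y.
have q0 : 0 < q by rewrite (lt_le_trans _ pq)// (lt_trans _ p1).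
have [->|x_neq0] := eqVneq x 0.
  rewrite add0r sub0r is_normN// is_norm0// [0 `^ q]powR0 ?gt_eqF// mulr0 add0r.
  have : 0 <= 0 `^ (q - p) * N y `^ p by rewrite mulr_ge0 ?powR_ge0.
  by have := powR_ge0 (N y) q; nra.
have x0 : 0 < N x.
  rewrite lt0r N_ge0 andbT; apply: contra_neq x_neq0; exact: is_norm_eq0.
set nu := N x in x0 *; have nuE (z : B) : z = nu *: (nu^-1 *: z).
  by rewrite scalerA divff ?gt_eqF// scale1r.
have Nnu z : N z = nu * N (nu^-1 *: z).
  by rewrite {1}(nuE z) is_normZ// gtr0_norm.
have N1 : N (nu^-1 *: x) = 1.
  by rewrite is_normZ// gtr0_norm ?invr_gt0// mulVf// gt_eqF.
rewrite (Nnu (x + y)) (Nnu (x - y)) (Nnu y) scalerDr scalerBr.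
rewrite !(powRM _ (ltW x0)) ?N_ge0// -mulrDr.
apply: (@le_trans _ _ (nu `^ q * (2 + C * (N (nu^-1 *: y) `^ p + N (nu^-1 *: y) `^ q)))).
  by rewrite ler_wpM2l ?powR_ge0// unit_.
rewrite (mulrA (nu `^ (q - p))) -powRD ?gt_eqF ?implybT// ?subrK//.
by rewrite le_eqVlt; apply/orP; left; apply/eqP; ring.
Qed.

End smoothness.

Lemma r_smooth_two_point {R : realType} {B : completeNormedModType R}
    (r p q : R) : 1 < p -> p <= r -> r <= 2 -> p <= q -> r_smooth B r ->
  exists N : B -> R, equivalent_norm N /\ exists2 C, 0 <= C & two_point N p q C.
Proof.
move=> p1 pr r2 pq [N [Neq]].
have [normN _] := Neq.
set A := (X in ereal_sup X); move=> Afin.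
exists N; split=> //.
have [C C2 HC] : exists2 C, 2 <= C & forall x y, N x = 1 ->
    N (x + y) `^ q + N (x - y) `^ q <= 2 + C * (N y `^ p + N y `^ q).
  (* [Num.max 0] gives the sign required of [K] without examining the supremum, which is [-oo] in
     the zero space. *)
  apply: (smooth_two_point_unit normN (K := Num.max 0 (fine (ereal_sup A))) p1 pr) => //.
    by rewrite le_max lexx.
  move=> t x y t0 x1 y1.
  set e := (N (x + t *: y) + N (x - t *: y) - 2).
  have tr0 : 0 < t `^ r by rewrite powR_gt0.
  rewrite -ler_pdivrMr// le_max; apply/orP; right.
  have : ((e / t `^ r)%:E <= ereal_sup A)%E.
    by apply: ereal_sup_ubound; exists t, x, y.
  case: (ereal_sup A) Afin => //= s _; by rewrite lee_fin.
exists C; first exact: le_trans C2.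
exact: two_point_homogeneous.
Qed.

(** * Moments on finite product spaces *)

Definition weights {R : realType} (K : finType) (w : K -> R) :=
  (forall x, 0 <= w x) /\ \sum_x w x = 1.

Section expectation.
Context {R : realType} {B : lmodType R} {K : finType}.
Variable w : K -> R.
Hypothesis weights_w : weights w.

(** Integrands live on lists of any length rather than on tuples, so that peeling off a draw needs
    no cast. *)
Definition expect n (F : seq K -> R) : R :=
  \sum_(t : n.-tuple K) (\prod_(x <- t) w x) * F t.

Definition mean n (F : seq K -> B) : B :=
  \sum_(t : n.-tuple K) (\prod_(x <- t) w x) *: F t.

Let w_ge0 x : 0 <= w x. Proof. by case: weights_w. Qed.

Let prod_ge0 (t : seq K) : 0 <= \prod_(x <- t) w x.
Proof. exact: prodr_ge0. Qed.

Lemma sum_tupleS (V : nmodType) n (F : n.+1.-tuple K -> V) :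
  \sum_t F t = \sum_x \sum_(t : n.-tuple K) F [tuple of x :: t].
Proof.
rewrite pair_big/=.
rewrite (reindex (fun p : K * n.-tuple K => [tuple of p.1 :: p.2])) //=.
exists (fun t => (thead t, [tuple of behead t])) => [[x t] _|t _] /=.
  by congr (_, _); apply: val_inj.
by rewrite [RHS]tuple_eta; apply: val_inj.
Qed.

Lemma sum_tuple0 (V : nmodType) (F : 0.-tuple K -> V) : \sum_t F t = F [tuple].
Proof.
rewrite (bigD1 [tuple])//= big1 ?addr0// => t.
by rewrite (tuple0 t) => /eqP[]; exact: val_inj.
Qed.

Lemma expect0 F : expect 0 F = F [::].
Proof. by rewrite /expect sum_tuple0 big_nil mul1r. Qed.

Lemma expectS n F :
  expect n.+1 F = \sum_x w x * expect n (fun s => F (x :: s)).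
Proof.
rewrite /expect sum_tupleS; apply: eq_bigr => x _; rewrite mulr_sumr.
by apply: eq_bigr => t _; rewrite /= big_cons mulrA.
Qed.

Lemma mean0 F : mean 0 F = F [::].
Proof. by rewrite /mean sum_tuple0 big_nil scale1r. Qed.

Lemma meanS n F : mean n.+1 F = \sum_x w x *: mean n (fun s => F (x :: s)).
Proof.
rewrite /mean sum_tupleS; apply: eq_bigr => x _; rewrite scaler_sumr.
by apply: eq_bigr => t _; rewrite /= big_cons scalerA.
Qed.

Lemma ler_expect n F G : (forall s, size s = n -> F s <= G s) ->
  expect n F <= expect n G.
Proof.
by move=> FG; apply: ler_sum => t _; rewrite ler_wpM2l// FG// size_tuple.
Qed.

Lemma eq_expect n F G : (forall s, size s = n -> F s = G s) ->
  expect n F = expect n G.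
Proof. by move=> FG; apply: eq_bigr => t _; rewrite FG// size_tuple. Qed.

Lemma expectD n F G : expect n (fun s => F s + G s) = expect n F + expect n G.
Proof. by rewrite -big_split/=; apply: eq_bigr => t _; rewrite mulrDr. Qed.

Lemma expectZ n c F : expect n (fun s => c * F s) = c * expect n F.
Proof. by rewrite mulr_sumr; apply: eq_bigr => t _; rewrite mulrCA. Qed.

Lemma expect_sum n (I : finType) (F : I -> seq K -> R) :
  expect n (fun s => \sum_i F i s) = \sum_i expect n (F i).
Proof. by rewrite exchange_big; apply: eq_bigr => t _; rewrite mulr_sumr. Qed.

Lemma expect_ge0 n F : (forall s, 0 <= F s) -> 0 <= expect n F.
Proof. by move=> F0; apply: sumr_ge0 => t _; rewrite mulr_ge0. Qed.

Lemma expect_cst n c : expect n (fun=> c) = c.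
Proof.
elim: n => [|n IH]; first by rewrite expect0.
rewrite expectS; under eq_bigr do rewrite IH.
by rewrite -mulr_suml (proj2 weights_w) mul1r.
Qed.

Lemma weights_tuple n : weights (fun t : n.-tuple K => \prod_(x <- t) w x).
Proof.
split=> [t|]; first exact: prod_ge0.
have := expect_cst n 1; rewrite /expect => {2}<-.
by apply: eq_bigr => t _; rewrite mulr1.
Qed.

End expectation.

(** Separating the combinations without the head from those with it is the grouping by an extreme
    index: it makes [ustat_cons] the increment of the U-statistic when one observation is added. *)
Fixpoint combs (T : Type) (m : nat) (s : seq T) : seq (seq T) :=
  match m, s with
  | 0, _ => [:: [::]]
  | _.+1, [::] => [::]
  | m'.+1, x :: s' => combs m s' ++ [seq x :: t | t <- combs m' s']
  end.

Lemma combs_map (T U : Type) (f : T -> U) m s :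
  combs m (map f s) = map (map f) (combs m s).
Proof.
elim: s m => [|x s IH] [|m] //=.
by rewrite !IH map_cat -!map_comp; congr cat; apply: eq_map.
Qed.

Lemma size_combs_le (T : Type) m (s : seq T) : (size (combs m s) <= size s ^ m)%N.
Proof.
elim: s m => [|x s IH] [|m] //=.
rewrite size_cat size_map (leq_trans (leq_add (IH _) (IH _)))//.
have leE : (size s ^ m <= (size s).+1 ^ m)%N by case: m => // m; rewrite leq_exp2r.
by rewrite !expnS mulSn addnC leq_add// leq_mul.
Qed.

Section ustat.
Context {R : realType} {B : lmodType R} {K : Type}.
Implicit Type h : seq K -> B.

Definition ustat m h (s : seq K) : B := \sum_(t <- combs m s) h t.

Lemma ustat0 h s : ustat 0 h s = h [::].
Proof. by case: s => [|x s]; rewrite /ustat/= big_seq1. Qed.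

Lemma ustat_nil m h : ustat m.+1 h [::] = 0.
Proof. by rewrite /ustat big_nil. Qed.

Lemma ustat_cons m h x s :
  ustat m.+1 h (x :: s) = ustat m.+1 h s + ustat m (fun t => h (x :: t)) s.
Proof. by rewrite /ustat big_cat big_map. Qed.

Lemma ustat_lincomb m (I : finType) (c : I -> R) (h : I -> seq K -> B) s :
  ustat m (fun t => \sum_i c i *: h i t) s = \sum_i c i *: ustat m (h i) s.
Proof.
by rewrite /ustat exchange_big; apply: eq_bigr => i _; rewrite scaler_sumr.
Qed.

End ustat.

(** * One centered increment in a smooth norm *)

Section one_step.
Context {R : realType} {B : completeNormedModType R}.
Variables (N : B -> R) (p q C : R).
Hypothesis normN : is_norm N.
Hypotheses (p_gt1 : 1 < p) (le_pq : p <= q) (C_ge0 : 0 <= C).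
Hypothesis twoN : two_point N p q C.

Let N_ge0 := is_norm_ge0 normN.
Let p0 : 0 < p. Proof. exact: lt_trans p_gt1. Qed.
Let q_ge1 : 1 <= q. Proof. exact/ltW/(lt_le_trans p_gt1). Qed.
Let q0 : 0 < q. Proof. exact: lt_le_trans q_ge1. Qed.

Lemma norm_mean_powR (I : finType) (w : I -> R) (Y : I -> B) (u : R) :
  1 <= u -> weights w ->
  N (\sum_i w i *: Y i) `^ u <= \sum_i w i * N (Y i) `^ u.
Proof.
move=> u1 [w0 w1].
apply: le_trans (jensen_powR u1 w0 w1 (fun i => N_ge0 (Y i))).
apply: ler_powR2r => //; first exact: le_trans u1.
apply: (le_trans (is_norm_sum normN _ _)).
by apply: ler_sum => i _; rewrite is_normZ// ger0_norm.
Qed.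

(* Centering is replaced by symmetrization: subtracting an independent copy of
   [Y] only increases the moment, and makes the increment symmetric, so that
   the two-point inequality applies. *)
Lemma centered_step (I : finType) (w : I -> R) (Y : I -> B) (x : B) :
  weights w -> \sum_i w i *: Y i = 0 ->
  \sum_i w i * N (x + Y i) `^ q <= N x `^ q +
    C * (2 `^ p * (N x `^ (q - p) * \sum_i w i * N (Y i) `^ p) +
         2 `^ q * \sum_i w i * N (Y i) `^ q).
Proof.
move=> ww EY; have [w0 w1] := ww.
pose S F := \sum_i w i * \sum_j w j * F i j : R.
have SD F G : S (fun i j => F i j + G i j) = S F + S G.
  rewrite /S -big_split/=; apply: eq_bigr => i _; rewrite -mulrDr; congr *%R.
  by rewrite -big_split/=; apply: eq_bigr => j _; rewrite mulrDr.
have SZ c F : S (fun i j => c * F i j) = c * S F.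
  rewrite /S mulr_sumr; apply: eq_bigr => i _; rewrite mulrCA; congr *%R.
  by rewrite mulr_sumr; apply: eq_bigr => j _; rewrite mulrCA.
have Sle F G : (forall i j, F i j <= G i j) -> S F <= S G.
  move=> FG; apply: ler_sum => i _; rewrite ler_wpM2l//.
  by apply: ler_sum => j _; rewrite ler_wpM2l.
have SC F : S (fun i j => F j i) = S F.
  rewrite /S; under eq_bigr do rewrite mulr_sumr.
  rewrite exchange_big; apply: eq_bigr => i _; rewrite mulr_sumr.
  by apply: eq_bigr => j _; rewrite mulrCA.
have Sl f : S (fun i _ => f i) = \sum_i w i * f i.
  by apply: eq_bigr => i _; rewrite -mulr_suml w1 mul1r.
have Scst c : S (fun _ _ => c) = c.
  by rewrite Sl -mulr_suml w1 mul1r.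
set L := (X in X <= _).
have symm : L <= S (fun i j => N (x + (Y i - Y j)) `^ q).
  apply: ler_sum => i _; rewrite ler_wpM2l//.
  have -> : x + Y i = \sum_j w j *: (x + (Y i - Y j)).
    under eq_bigr do rewrite addrA scalerBr.
    by rewrite sumrB EY subr0 -scaler_suml w1 scale1r.
  exact: norm_mean_powR.
have dbl : 2 * L <= S (fun i j => N (x + (Y i - Y j)) `^ q + N (x - (Y i - Y j)) `^ q).
  (* Exchanging i and j leaves [S] unchanged and replaces [Y i - Y j] by its opposite. *)
  rewrite SD -[X in _ <= _ + X]SC.
  rewrite [X in _ <= _ + X](_ : _ = S (fun i j => N (x + (Y i - Y j)) `^ q)).
    by rewrite mulr_natl mulr2n lerD.
  by apply: eq_bigr => i _; congr *%R; apply: eq_bigr => j _; rewrite opprB.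
have pw u : 0 <= u -> S (fun i j => N (Y i - Y j) `^ u) <=
    2 * (2 `^ u * \sum_i w i * N (Y i) `^ u).
  move=> u0; apply: (@le_trans _ _ (S (fun i j => 2 `^ u * (N (Y i) `^ u + N (Y j) `^ u)))).
    apply: Sle => i j; apply: le_trans (powR_addr_le u0 (N_ge0 _) (N_ge0 _)).
    by apply: ler_powR2r; rewrite ?N_ge0 ?is_normB.
  rewrite SZ SD (SC (fun i _ => N (Y i) `^ u)) (Sl (fun i => N (Y i) `^ u)).
  by rewrite le_eqVlt; apply/orP; left; apply/eqP; ring.
have two : S (fun i j => N (x + (Y i - Y j)) `^ q + N (x - (Y i - Y j)) `^ q) <=
   2 * N x `^ q + C * (N x `^ (q - p) * S (fun i j => N (Y i - Y j) `^ p) +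
                       S (fun i j => N (Y i - Y j) `^ q)).
  rewrite -SZ -SD -SZ -[X in _ <= X + _](Scst (2 * N x `^ q)) -SD; apply: Sle => i j.
  exact: twoN.
have := le_trans dbl two.
have b1 := pw _ (ltW p0); have b2 := pw _ (ltW q0).
have b3 := ler_wpM2l (powR_ge0 (N x) (q - p)) b1.
have := ler_wpM2l C_ge0 (lerD b3 b2).
move: (S _) (S _) (\sum_i _) (\sum_i _) (N x `^ (q - p)) => s1 s2 s3 s4 s5.
by lra.
Qed.

(** The first summand is what [powR_mixed] makes of the coefficient [C * 2^p] of the mixed term, the
    second is the coefficient of the q-th moment in [centered_step]; the sum dominates both. *)
Definition step_cst := (C * 2 `^ p) `^ (q / p) + C * 2 `^ q.

Lemma step_cst_ge0 : 0 <= step_cst.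
Proof. by rewrite addr_ge0 ?mulr_ge0 ?powR_ge0. Qed.

Lemma centered_step_eps (I : finType) (w : I -> R) (Y : I -> B) (x : B) eps :
  0 < eps -> weights w -> \sum_i w i *: Y i = 0 ->
  \sum_i w i * N (x + Y i) `^ q <= (1 + eps) * N x `^ q +
    step_cst * (eps `^ (1 - q / p) * (\sum_i w i * N (Y i) `^ p) `^ (q / p) +
         \sum_i w i * N (Y i) `^ q).
Proof.
move=> e0 ww EY; apply: (le_trans (centered_step x ww EY)).
set P := \sum_i w i * N (Y i) `^ p; set Q := \sum_i w i * N (Y i) `^ q.
have w0 := proj1 ww.
have P0 : 0 <= P by apply: sumr_ge0 => i _; rewrite mulr_ge0 ?powR_ge0.
have Q0 : 0 <= Q by apply: sumr_ge0 => i _; rewrite mulr_ge0 ?powR_ge0.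
have C2 : 0 <= C * 2 `^ p by rewrite mulr_ge0 ?powR_ge0.
have := powR_mixed p0 le_pq e0 C2 (N_ge0 x) P0.
rewrite /step_cst.
have : 0 <= C * 2 `^ q * (eps `^ (1 - q / p) * P `^ (q / p)).
  by rewrite !mulr_ge0 ?powR_ge0.
have : 0 <= (C * 2 `^ p) `^ (q / p) * Q by rewrite mulr_ge0 ?powR_ge0.
by lra.
Qed.

End one_step.

(** * Moments of complete U-statistics on a finite space *)

Section ustat_moment.
Context {R : realType} {B : completeNormedModType R}.
Variables (N : B -> R) (p q C : R).
Hypothesis normN : is_norm N.
Hypotheses (p_gt1 : 1 < p) (le_pq : p <= q) (C_ge0 : 0 <= C).
Hypothesis twoN : two_point N p q C.

Let N_ge0 := is_norm_ge0 normN.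
Let p0 : 0 < p. Proof. exact: lt_trans p_gt1. Qed.
Let q_ge1 : 1 <= q. Proof. exact/ltW/(lt_le_trans p_gt1). Qed.
Let q0 : 0 < q. Proof. exact: lt_le_trans q_ge1. Qed.
Let s_ge1 : 1 <= q / p. Proof. by rewrite ler_pdivlMr// mul1r. Qed.

(* [n^q] is paid for integrating out an argument of the kernel, [n^(q/p)] for
   freezing it. *)
Fixpoint ustat_bound (K : finType) (w : K -> R) (n m : nat) (h : seq K -> B) : R :=
  if m is m'.+1 then
    n%:R `^ q * ustat_bound w n m' (fun t => \sum_x w x *: h (x :: t)) +
    n%:R `^ (q / p) * \sum_x w x * ustat_bound w n m' (fun t => h (x :: t))
  else N (h [::]) `^ q.

Lemma ustat_bound_ge0 (K : finType) (w : K -> R) n m h : weights w ->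
  0 <= ustat_bound w n m h.
Proof.
move=> [w0 _]; elim: m h => [|m IH] h /=; first exact: powR_ge0.
rewrite addr_ge0 ?mulr_ge0 ?powR_ge0//.
by apply: sumr_ge0 => x _; rewrite mulr_ge0.
Qed.

(* The compensator of [ustat m.+1 h], the filtration being generated by the tails
   of the list: the head of the list is the newest observation. *)
Fixpoint drift {K : finType} (w : K -> R) m (h : seq K -> B) (s : seq K) : B :=
  if s is x :: s' then
    drift w m h s' + ustat m (fun t => \sum_x w x *: h (x :: t)) s'
  else 0.

Let kappa (n : nat) : R := 1 + n%:R^-1.

Let kappa_ge1 n : 1 <= kappa n.
Proof. by rewrite lerDl invr_ge0. Qed.

(** At each of at most n steps the drift gains a term of q-th moment at most [c]. The convex
    splitting with [eps = 1/n] multiplies the past by [(1 + 1/n)^(q-1)] and the new term by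
    [(n + 1)^(q-1) <= (2 n)^(q-1)]; n such terms make up the order [n^q]. *)
Lemma drift_moment (K : finType) (w : K -> R) n k m h c : weights w ->
  (0 < n)%N -> (k <= n)%N -> 0 <= c ->
  let g t := \sum_x w x *: h (x :: t) in
  (forall j, (j <= n)%N -> expect w j (fun s => N (ustat m g s) `^ q) <= c) ->
  expect w k (fun s => N (drift w m h s) `^ q) <=
  expR 1 `^ (q - 1) * 2 `^ (q - 1) * n%:R `^ q * c.
Proof.
move=> ww n0 kn c0 g Hg.
have nR : 0 < n%:R :> R by rewrite ltr0n.
have q10 : 0 <= q - 1 by rewrite subr_ge0.
pose A k := expect w k (fun s => N (drift w m h s) `^ q).
pose bet : R := (2 * n%:R) `^ (q - 1) * c.
have b0 : 0 <= bet by rewrite mulr_ge0 ?powR_ge0.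
have k1 : 1 <= kappa n `^ (q - 1).
  by rewrite -[leLHS](powRr0 (kappa n)); apply: ler_powR.
have AS j : (j < n)%N -> A j.+1 <= kappa n `^ (q - 1) * A j + bet.
  move=> jn; rewrite /A expectS/= -mulr_suml (proj2 ww) mul1r.
  apply: (@le_trans _ _ (kappa n `^ (q - 1) * A j +
     ((2 * n%:R) `^ (q - 1)) * expect w j (fun s => N (ustat m g s) `^ q))).
    rewrite -!expectZ -expectD; apply: ler_expect => // s _ /=.
    apply: (@le_trans _ _ ((N (drift w m h s) + N (ustat m g s)) `^ q)).
      by apply: ler_powR2r; rewrite ?N_ge0 ?is_normD// ltW.
    apply: (le_trans (powR_addr_eps q_ge1 (_ : 0 < n%:R^-1) (N_ge0 _) (N_ge0 _))).
      by rewrite invr_gt0.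
    rewrite lerD2l ler_wpM2r ?powR_ge0//; apply: ler_powR2r => //.
    rewrite invrK mulrDl mul1r mulVf ?gt_eqF// mulr_natl mulr2n lerD2l.
    by rewrite ler1n.
  by rewrite lerD2l ler_wpM2l ?powR_ge0// Hg// ltnW.
have A0 : A 0%N <= 0 by rewrite /A expect0/= is_norm0// powR0 ?gt_eqF.
have := gronwall k1 b0 A0 (fun j jk => AS j (leq_trans jk kn)).
rewrite -/(A k) => /le_trans; apply.
apply: (@le_trans _ _ (n%:R * expR 1 `^ (q - 1) * bet)).
  rewrite ler_wpM2r// ler_pM ?ler_nat// ?exprn_ge0 ?powR_ge0//.
  rewrite -powR_mulrn ?powR_ge0// powRAC; apply: ler_powR2r => //.
    exact: powR_ge0.
  rewrite powR_mulrn; last exact: le_trans (kappa_ge1 n).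
  apply: le_trans (expr1Dinvn_le n).
  exact: ler_weXn2l.
rewrite /bet powRM// -(mulr_powRB1 (ltW nR) q0).
by rewrite le_eqVlt; apply/orP; left; apply/eqP; ring.
Qed.

(** With the past s fixed, [V x s - Vm s] is centered in the newest observation x, so the one-step
    bound applies with [eps = 1/n]; its p-th moment, raised to [q/p], is absorbed in the q-th by
    Jensen's inequality. In the constant, the first 2 merges the two terms, as [1 <= n^(q/p - 1)],
    and [2^q * 2] pays for removing the centering. *)
Lemma martingale_moment (K : finType) (w : K -> R) n k m h c : weights w ->
  (0 < n)%N -> (k <= n)%N -> 0 <= c ->
  (forall j, (j <= n)%N -> expect w j (fun s =>
     \sum_x w x * N (ustat m (fun t => h (x :: t)) s) `^ q) <= c) ->
  expect w k (fun s => N (ustat m.+1 h s - drift w m h s) `^ q) <=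
  expR 1 * (step_cst p q C * 2 * (2 `^ q * 2)) * n%:R `^ (q / p) * c.
Proof.
move=> ww n0 kn c0 Hh.
have nR : 0 < n%:R :> R by rewrite ltr0n.
have S0 := step_cst_ge0 p q C_ge0.
pose D s := ustat m.+1 h s - drift w m h s.
pose V x s := ustat m (fun t => h (x :: t)) s.
pose Vm s := \sum_x w x *: V x s.
have DS x s : D (x :: s) = D s + (V x s - Vm s).
  by rewrite /D ustat_cons/= ustat_lincomb opprD -!addrA; congr +%R; rewrite addrCA.
pose A k := expect w k (fun s => N (D s) `^ q).
pose cst := step_cst p q C * (2 * n%:R `^ (q / p - 1)) * (2 `^ q * 2).
have cst0 : 0 <= cst by rewrite !mulr_ge0 ?powR_ge0.
have AS j : (j < n)%N -> A j.+1 <= kappa n * A j + cst * c.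
  move=> jn; rewrite /A expectS.
  under eq_bigr do rewrite -expectZ.
  rewrite -expect_sum.
  apply: (@le_trans _ _ (kappa n * A j + cst * expect w j (fun s =>
     \sum_x w x * N (V x s) `^ q))); last first.
    by rewrite lerD2l ler_wpM2l// Hh// ltnW.
  rewrite -!expectZ -expectD; apply: ler_expect => // s _.
  have EY : \sum_x w x *: (V x s - Vm s) = 0.
    under eq_bigr do rewrite scalerBr.
    by rewrite sumrB -scaler_suml (proj2 ww) scale1r subrr.
  under eq_bigr do rewrite DS.
  apply: (le_trans (centered_step_eps normN p_gt1 le_pq C_ge0 twoN (D s)
    (_ : 0 < n%:R^-1) ww EY)); first by rewrite invr_gt0.
  rewrite lerD2l.
  set P := (\sum_x w x * N _ `^ p); set Q := (\sum_x w x * N (V x s - _) `^ q).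
  have PQ : P `^ (q / p) <= Q.
    apply: le_trans (jensen_powR s_ge1 (proj1 ww) (proj2 ww) _) _.
      by move=> x; exact: powR_ge0.
    apply: ler_sum => x _; rewrite ler_wpM2l ?(proj1 ww)//.
    by rewrite -powRrM mulrC divfK// gt_eqF.
  have Q0 : 0 <= Q.
    by apply: sumr_ge0 => x _; rewrite mulr_ge0 ?powR_ge0// (proj1 ww).
  have nE : n%:R^-1 `^ (1 - q / p) = n%:R `^ (q / p - 1).
    by rewrite -powR_inv1 ?(ltW nR)// -powRrM mulN1r opprB.
  have n1 : 1 <= n%:R `^ (q / p - 1).
    by rewrite -[leLHS](powRr0 n%:R); apply: ler_powR; rewrite ?ler1n// subr_ge0.
  rewrite /cst -!mulrA ler_wpM2l// nE.
  apply: (@le_trans _ _ (2 * (n%:R `^ (q / p - 1) * Q))).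
    have := ler_wpM2l (powR_ge0 n%:R (q / p - 1)) PQ.
    have := ler_wpM2r Q0 n1; rewrite mul1r.
    by move: (n%:R `^ _ * Q) (n%:R `^ _ * _) => a b; lra.
  rewrite ler_wpM2l// ler_wpM2l ?powR_ge0//.
  apply: (@le_trans _ _ (2 `^ q * \sum_x w x * (N (V x s) `^ q + N (Vm s) `^ q))).
    rewrite mulr_sumr; apply: ler_sum => x _; rewrite mulrCA.
    rewrite ler_wpM2l ?(proj1 ww)//.
    apply: le_trans (powR_addr_le (ltW q0) (N_ge0 _) (N_ge0 _)).
    by apply: ler_powR2r; rewrite ?N_ge0 ?is_normB// ltW.
  rewrite ler_wpM2l ?powR_ge0//.
  under eq_bigr do rewrite mulrDr.
  rewrite big_split/= -mulr_suml (proj2 ww) mul1r mulr_natl mulr2n lerD2l.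
  exact: norm_mean_powR.
have A0 : A 0%N <= 0.
  by rewrite /A expect0 /D/= ustat_nil subr0 is_norm0// powR0 ?gt_eqF.
have cc0 : 0 <= cst * c by rewrite mulr_ge0.
have := gronwall (kappa_ge1 n) cc0 A0 (fun j jk => AS j (leq_trans jk kn)).
rewrite -/(A k) => /le_trans; apply.
apply: (@le_trans _ _ (n%:R * expR 1 * (cst * c))).
  rewrite ler_wpM2r// ler_pM ?ler_nat// ?exprn_ge0//.
    exact: le_trans (kappa_ge1 n).
  apply: le_trans (expr1Dinvn_le n).
  exact: ler_weXn2l.
rewrite /cst -(mulr_powRB1 (ltW nR) (_ : 0 < q / p)) ?divr_gt0//.
by rewrite le_eqVlt; apply/orP; left; apply/eqP; ring.
Qed.

Fixpoint ustat_cst (m : nat) : R :=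
  if m is m'.+1 then
    2 `^ q * (expR 1 `^ (q - 1) * 2 `^ (q - 1) +
      expR 1 * (step_cst p q C * 2 * (2 `^ q * 2))) * ustat_cst m'
  else 1.

Lemma ustat_cst_ge0 m : 0 <= ustat_cst m.
Proof.
have S0 := step_cst_ge0 p q C_ge0.
elim: m => //= m IH.
by rewrite mulr_ge0// mulr_ge0 ?powR_ge0// addr_ge0// !mulr_ge0 ?powR_ge0 ?expR_ge0.
Qed.

(** Length k and scale n are separate because the recursion in m evaluates statistics of lower order
    on tails of every length [j <= n], at the price of the same powers of n. The kernel is
    generalized too: it is replaced by kernels with one argument integrated out or frozen. *)
Lemma ustat_moment (K : finType) (w : K -> R) n k m h : weights w ->
  (0 < n)%N -> (k <= n)%N ->
  expect w k (fun s => N (ustat m h s) `^ q) <= ustat_cst m * ustat_bound w n m h.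
Proof.
move=> ww n0; elim: m k h => [|m IH] k h kn.
  rewrite /= mul1r -[leRHS](expect_cst ww k).
  by apply: ler_expect => // s _; rewrite ustat0.
set g := fun t => \sum_x w x *: h (x :: t).
pose X := ustat_cst m * ustat_bound w n m g.
pose Y := ustat_cst m * \sum_x w x * ustat_bound w n m (fun t => h (x :: t)).
have X0 : 0 <= X by rewrite mulr_ge0 ?ustat_cst_ge0 ?ustat_bound_ge0.
have Y0 : 0 <= Y.
  rewrite mulr_ge0 ?ustat_cst_ge0//; apply: sumr_ge0 => x _.
  by rewrite mulr_ge0 ?ustat_bound_ge0// (proj1 ww).
have HX := drift_moment ww n0 kn X0 (fun j jn => IH j g jn).
have HY : forall j, (j <= n)%N -> expect w j (fun s =>
     \sum_x w x * N (ustat m (fun t => h (x :: t)) s) `^ q) <= Y.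
  move=> j jn; rewrite expect_sum /Y mulr_sumr; apply: ler_sum => x _.
  by rewrite expectZ mulrCA ler_wpM2l ?(proj1 ww)// IH.
have {}HY := martingale_moment ww n0 kn Y0 HY.
apply: (@le_trans _ _ (2 `^ q *
   (expect w k (fun s => N (ustat m.+1 h s - drift w m h s) `^ q) +
    expect w k (fun s => N (drift w m h s) `^ q)))).
  rewrite -expectD -expectZ; apply: ler_expect => // s _.
  apply: le_trans (powR_addr_le (ltW q0) (N_ge0 _) (N_ge0 _)).
  apply: ler_powR2r; rewrite ?N_ge0 ?(ltW q0)//.
  by rewrite -{1}(subrK (drift w m h s) (ustat m.+1 h s)) is_normD.
rewrite /= -/g -2!(mulrA (2 `^ q)) ler_wpM2l ?powR_ge0//.
apply: le_trans (lerD HY HX) _.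
rewrite /X /Y; set a := expR 1 `^ _ * _; set b := expR 1 * _.
have a0 : 0 <= a by rewrite mulr_ge0 ?powR_ge0.
have b0 : 0 <= b by rewrite !mulr_ge0 ?powR_ge0 ?expR_ge0 ?step_cst_ge0.
have X1 := mulr_ge0 (powR_ge0 n%:R q) X0.
have Y1 := mulr_ge0 (powR_ge0 n%:R (q / p)) Y0.
have := mulr_ge0 a0 Y1; have := mulr_ge0 b0 X1; rewrite /X /Y.
by lra.
Qed.

End ustat_moment.

(** * Symmetric and degenerate kernels on a finite space *)

Section symmetric_bound.
Context {R : realType} {B : completeNormedModType R}.
Variables (N : B -> R) (p q : R).
Hypothesis normN : is_norm N.
Hypotheses (p_gt1 : 1 < p) (le_pq : p <= q).
Context {K : finType}.
Variable w : K -> R.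
Hypothesis weights_w : weights w.

Let N_ge0 := is_norm_ge0 normN.
Let p0 : 0 < p. Proof. exact: lt_trans p_gt1. Qed.
Let q_ge1 : 1 <= q. Proof. exact/ltW/(lt_le_trans p_gt1). Qed.
Let s_ge1 : 1 <= q / p. Proof. by rewrite ler_pdivlMr// mul1r. Qed.

Definition perm_invariant (h : seq K -> B) :=
  forall s t, perm_eq s t -> h s = h t.

(* The [q]-th moment of the conditional expectation of [h] given its first [c]
   arguments. *)
Definition cond_moment (m c : nat) (h : seq K -> B) : R :=
  expect w c (fun s => N (mean w (m - c) (fun t => h (s ++ t))) `^ q).

Lemma cond_moment_ge0 m c h : 0 <= cond_moment m c h.
Proof. by apply: expect_ge0 => // s; exact: powR_ge0. Qed.

Lemma expect_cat c k (F : seq K -> R) :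
  expect w c (fun s => expect w k (fun t => F (s ++ t))) = expect w (c + k) F.
Proof.
elim: c F => [|c IH] F; first by rewrite expect0.
by rewrite addSn !expectS; apply: eq_bigr => x _; rewrite -IH.
Qed.

Lemma cond_moment_le m c h : (c <= m)%N ->
  cond_moment m c h <= expect w m (fun s => N (h s) `^ q).
Proof.
move=> cm; rewrite -[X in expect w X _](subnKC cm) -expect_cat.
apply: ler_expect => // s _; rewrite /mean.
exact: norm_mean_powR (weights_tuple weights_w _).
Qed.

Lemma perm_invariant_cons h x : perm_invariant h ->
  perm_invariant (fun t => h (x :: t)).
Proof. by move=> hs s t st; apply: hs; rewrite perm_cons. Qed.

(** Unfolding [ustat_bound] gives one term for each choice of frozen arguments. By symmetry the term
    depends only on their number c, and [2^m] dominates the number of choices with c frozen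
    arguments. *)
Lemma ustat_bound_symmetric (n m : nat) (h : seq K -> B) : perm_invariant h ->
  ustat_bound N p q w n m h <= 2 ^+ m * \sum_(c < m.+1)
    (n%:R `^ q) ^+ (m - c) * (n%:R `^ (q / p)) ^+ c * cond_moment m c h.
Proof.
set a := n%:R `^ q; set b := n%:R `^ (q / p).
have a0 : 0 <= a by exact: powR_ge0.
have b0 : 0 <= b by exact: powR_ge0.
elim: m h => [|m IH] h hs /=.
  by rewrite big_ord1 /cond_moment expect0 mean0/= !mul1r.
set g := fun t => \sum_x w x *: h (x :: t).
have gs : perm_invariant g.
  by move=> s t st; apply: eq_bigr => x _; rewrite (perm_invariant_cons x hs st).
have gE c : (c <= m)%N -> cond_moment m c g = cond_moment m.+1 c h.
  move=> cm; apply: eq_bigr => s _; rewrite subSn// meanS.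
  congr (_ * (N _ `^ _)); rewrite /mean.
  under [RHS]eq_bigr do rewrite scaler_sumr.
  rewrite exchange_big; apply: eq_bigr => t _; rewrite /g scaler_sumr.
  apply: eq_bigr => x _; rewrite !scalerA mulrC; congr (_ *: _).
  by apply: hs; rewrite -cat1s -[in X in perm_eq _ X]cat1s perm_catCA.
have hE c : \sum_x w x * cond_moment m c (fun t => h (x :: t)) =
    cond_moment m.+1 c.+1 h by rewrite /cond_moment expectS subSS.
pose S := \sum_(c < m.+2) a ^+ (m.+1 - c) * b ^+ c * cond_moment m.+1 c h.
have term0 c : 0 <= a ^+ (m.+1 - c) * b ^+ c * cond_moment m.+1 c h.
  by rewrite !mulr_ge0 ?exprn_ge0 ?cond_moment_ge0.
have S1 : a * ustat_bound N p q w n m g <= 2 ^+ m * S.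
  apply: (le_trans (ler_wpM2l a0 (IH g gs))).
  rewrite mulrCA ler_wpM2l ?exprn_ge0// /S [in leRHS]big_ord_recr/=.
  rewrite mulr_sumr -[leLHS]addr0 lerD//.
    apply: ler_sum => c _; have cm : (c <= m)%N by rewrite -ltnS.
    by rewrite gE// subSn// exprS !mulrA.
have S2 : b * \sum_x w x * ustat_bound N p q w n m (fun t => h (x :: t)) <= 2 ^+ m * S.
  apply: (@le_trans _ _ (b * \sum_x w x * (2 ^+ m * \sum_(c < m.+1)
      a ^+ (m - c) * b ^+ c * cond_moment m c (fun t => h (x :: t))))).
    rewrite ler_wpM2l//; apply: ler_sum => x _.
    rewrite ler_wpM2l ?(proj1 weights_w)// IH//; exact: perm_invariant_cons.
  under eq_bigr do rewrite mulrCA mulr_sumr.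
  rewrite -mulr_sumr exchange_big/= mulrCA ler_wpM2l ?exprn_ge0//.
  rewrite /S [in leRHS]big_ord_recl/= -[leLHS]add0r lerD//.
  rewrite mulr_sumr; apply: ler_sum => c _.
  under eq_bigr do rewrite mulrCA.
  rewrite -mulr_sumr hE /bump/= add1n subSS exprS.
  by rewrite le_eqVlt; apply/orP; left; apply/eqP; ring.
by rewrite exprS -mulrA mulr_natl mulr2n lerD.
Qed.

(** For [c >= d] the power of n is largest at [c = d], and conditioning does not increase the q-th
    moment. For [c < d] the crude power [n^(q m)] is enough in front of the small [eta]. The factor
    [m.+1] counts the values of c. *)
Lemma ustat_bound_degenerate (n m d : nat) (h : seq K -> B) (eta : R) :
  (0 < n)%N -> (d <= m)%N -> perm_invariant h -> 0 <= eta ->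
  (forall c, (c < d)%N -> cond_moment m c h <= eta) ->
  ustat_bound N p q w n m h <= 2 ^+ m * m.+1%:R *
    ((n%:R `^ q) ^+ (m - d) * (n%:R `^ (q / p)) ^+ d *
       expect w m (fun s => N (h s) `^ q) + (n%:R `^ q) ^+ m * eta).
Proof.
move=> n0 dm hs eta0 Heta; apply: (le_trans (ustat_bound_symmetric n m hs)).
rewrite -mulrA ler_wpM2l ?exprn_ge0//.
set a := n%:R `^ q; set b := n%:R `^ (q / p).
have n1 : 1 <= n%:R :> R by rewrite ler1n.
have b1 : 1 <= b.
  by rewrite -[leLHS](powRr0 n%:R); apply: ler_powR => //; rewrite divr_ge0// ltW// (lt_le_trans _ q_ge1).
have ba : b <= a.
  apply: ler_powR => //; rewrite ler_pdivrMr// ler_peMr//; last exact: ltW.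
  exact: le_trans q_ge1.
have a1 : 1 <= a by exact: le_trans ba.
have a0 : 0 <= a by exact: le_trans a1.
have b0 : 0 <= b by exact: le_trans b1.
set H := expect _ _ _; have H0 : 0 <= H by apply: expect_ge0 => // s; exact: powR_ge0.
rewrite [leRHS]mulr_natl -[X in _ *+ X]card_ord -sumr_const.
apply: ler_sum => c _; have cm : (c <= m)%N by rewrite -ltnS.
have [dc|cd] := leqP d c.
  rewrite -[leLHS]addr0 lerD ?mulr_ge0 ?exprn_ge0//.
  apply: ler_pM; rewrite ?mulr_ge0 ?exprn_ge0 ?cond_moment_ge0 ?cond_moment_le//.
  have -> : (m - d = (m - c) + (c - d))%N by rewrite addnBA// subnK.
  rewrite exprD -mulrA ler_wpM2l ?exprn_ge0//.
  rewrite -[X in b ^+ X <= _](subnK dc) exprD ler_wpM2r ?exprn_ge0//.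
  by rewrite lerXn2r.
rewrite -[leLHS]add0r lerD ?mulr_ge0 ?exprn_ge0//.
apply: ler_pM; rewrite ?mulr_ge0 ?exprn_ge0 ?cond_moment_ge0 ?Heta//.
rewrite -[X in _ <= a ^+ X](subnK cm) exprD ler_wpM2l ?exprn_ge0//.
by rewrite lerXn2r.
Qed.

End symmetric_bound.

Lemma size_combs (T : Type) m (s : seq T) : size (combs m s) = 'C(size s, m).
Proof.
elim: s m => [|x s IH] [|m] //=.
by rewrite size_cat size_map !IH binS.
Qed.

(** Any m entries of an i.i.d. list are distributed as m draws; the induction is Pascal's rule,
    according to whether the head is chosen. *)
Lemma expect_sum_combs {R : realType} {K : finType} (w : K -> R) m n
    (F : seq K -> R) : weights w ->
  expect w n (fun s => \sum_(t <- combs m s) F t) = 'C(n, m)%:R * expect w m F.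
Proof.
move=> ww; elim: n m F => [|n IH] [|m] F; rewrite ?bin0 ?mul1r ?expect0/=.
- by rewrite big_seq1.
- by rewrite big_nil mul0r.
- rewrite -[RHS](expect_cst ww n.+1).
  by apply: eq_expect => // -[|x s] _; rewrite /= big_seq1.
rewrite expectS.
under eq_bigr => x _.
  under eq_expect => s _ do rewrite /= big_cat/= big_map.
  rewrite expectD IH IH mulrDr.
  over.
rewrite big_split/= -mulr_suml (proj2 ww) mul1r binS natrD mulrDl; congr +%R.
rewrite expectS mulr_sumr; apply: eq_bigr => x _; exact: mulrCA.
Qed.

(** * Bernoulli selection with the sample fixed *)

Definition bern {R : realType} (pi : R) (b : bool) : R := if b then pi else 1 - pi.

Lemma weights_bern {R : realType} (pi : R) : 0 <= pi <= 1 -> weights (bern pi).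
Proof.
move=> /andP[p0 p1]; split; first by case; rewrite /bern ?subr_ge0.
by rewrite big_bool /= subrKC.
Qed.

(** One form covers the selected sum, with [b%:R], and its centered version, with [b%:R - pi]; they
    differ by [pi] times the complete sum. *)
Definition weighted_sum {R : realType} {B : lmodType R} (f : bool -> R)
  (bs : seq bool) (xs : seq B) : B := \sum_(z <- zip bs xs) f z.1 *: z.2.

Section bernoulli_moment.
Context {R : realType} {B : completeNormedModType R}.
Variables (N : B -> R) (p q C : R).
Hypothesis normN : is_norm N.
Hypotheses (p_gt1 : 1 < p) (le_pq : p <= q) (C_ge0 : 0 <= C).
Hypothesis twoN : two_point N p q C.

Let N_ge0 := is_norm_ge0 normN.
Let p0 : 0 < p. Proof. exact: lt_trans p_gt1. Qed.
Let q_ge1 : 1 <= q. Proof. exact/ltW/(lt_le_trans p_gt1). Qed.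
Let q0 : 0 < q. Proof. exact: lt_le_trans q_ge1. Qed.
Let s_ge1 : 1 <= q / p. Proof. by rewrite ler_pdivlMr// mul1r. Qed.

(** A success contributes at most [pi], and a failure at most [pi^u <= pi]. The bound is linear in
    [pi] for every u; with [u = q] it yields the factor [pi], and with [u = p], raised to [q/p], the
    factor [pi^(q/p)]. *)
Lemma bernoulli_increment (pi u : R) (x : B) : 0 <= pi <= 1 -> 1 <= u ->
  \sum_b bern pi b * N ((b%:R - pi) *: x) `^ u <= 2 * pi * N x `^ u.
Proof.
move=> /andP[pi0 pi1] u1; have u0 : 0 <= u by exact: le_trans u1.
rewrite big_bool /= !(is_normZ normN) sub0r normrN (ger0_norm pi0).
rewrite ger0_norm ?subr_ge0// !powRM ?subr_ge0//.
have b1 : (1 - pi) `^ u <= 1.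
  apply: (@le_trans _ _ (1 `^ u)); last by rewrite powR1.
  by apply: ler_powR2r; rewrite ?subr_ge0// gerBl.
have b2 : pi `^ u <= pi.
  have [->|pi_neq0] := eqVneq pi 0.
    by rewrite powR0// gt_eqF// (lt_le_trans _ u1).
  by apply: ge1r_powR => //; rewrite lt0r pi_neq0 pi0.
rewrite !mulrA -mulrDl ler_wpM2r ?powR_ge0//.
have := ler_wpM2l pi0 b1; have := powR_ge0 pi u.
have : (1 - pi) * pi `^ u <= 1 * pi by apply: ler_pM; rewrite ?powR_ge0 ?subr_ge0// gerBl.
by lra.
Qed.

(** The vectors in [xs] are deterministic, so the sum has independent centered increments, of
    unequal sizes. The scale [M] fixes [eps = 1/M] while the list shrinks in the induction. *)
Lemma bernoulli_moment (pi : R) (M : nat) (xs : seq B) :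
  0 <= pi <= 1 -> (0 < M)%N -> (size xs <= M)%N ->
  expect (bern pi) (size xs)
    (fun bs => N (weighted_sum (fun b => b%:R - pi) bs xs) `^ q) <=
  expR 1 * step_cst p q C * 2 `^ (q / p) *
   (M%:R `^ (q / p - 1) * pi `^ (q / p) + pi) * \sum_(x <- xs) N x `^ q.
Proof.
move=> pi01 M0 xsM; have [pi0 pi1] := andP pi01.
have S0 := step_cst_ge0 p q C_ge0.
have wb := weights_bern pi01.
have MR : 0 < M%:R :> R by rewrite ltr0n.
pose bet : R := step_cst p q C * 2 `^ (q / p) *
   (M%:R `^ (q / p - 1) * pi `^ (q / p) + pi).
have b0 : 0 <= bet by rewrite !mulr_ge0 ?addr_ge0 ?mulr_ge0 ?powR_ge0.
pose k : R := 1 + M%:R^-1.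
have k1 : 1 <= k by rewrite lerDl invr_ge0.
have k0 : 0 <= k by exact: le_trans k1.
have sum0 (ys : seq B) : 0 <= \sum_(x <- ys) N x `^ q.
  by apply: sumr_ge0 => y _; exact: powR_ge0.
apply: (@le_trans _ _ (k ^+ size xs * bet * \sum_(x <- xs) N x `^ q)); last first.
  rewrite ler_wpM2r//.
  have -> : expR 1 * step_cst p q C * 2 `^ (q / p) *
   (M%:R `^ (q / p - 1) * pi `^ (q / p) + pi) = expR 1 * bet by rewrite !mulrA.
  rewrite ler_wpM2r//; apply: le_trans (expr1Dinvn_le M); exact: ler_weXn2l.
elim: xs xsM => [_|x xs IH xsM].
  by rewrite expect0 /weighted_sum !big_nil is_norm0// powR0 ?gt_eqF// mulr0.
rewrite /= expectS.
under [leLHS]eq_bigr do rewrite -expectZ.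
rewrite -expect_sum.
set A := expect _ _ (fun bs => N _ `^ q) in IH.
pose W bs := weighted_sum (fun b : bool => b%:R - pi) bs xs.
apply: (@le_trans _ _ (k * A + bet * N x `^ q)); last first.
  rewrite big_cons mulrDr addrC lerD//.
    rewrite -mulrA; apply: ler_peMl; last exact: exprn_ege1.
    by rewrite mulr_ge0 ?powR_ge0.
  rewrite exprS -2!(mulrA k) ler_wpM2l//; exact: IH (ltnW xsM).
rewrite -[X in _ + X](expect_cst wb (size xs)) -expectZ -expectD.
apply: ler_expect => // bs _.
have EY : \sum_b bern pi b *: ((b%:R - pi) *: x) = 0.
  rewrite big_bool /= !scalerA -scalerDl.
  by rewrite (_ : pi * (1 - pi) + (1 - pi) * (0 - pi) = 0) ?scale0r//; ring.
under eq_bigr => b _.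
  rewrite {1}/weighted_sum/= big_cons addrC -/(weighted_sum (fun b : bool => b%:R - pi) bs xs) -/(W bs).
  over.
apply: (le_trans (centered_step_eps normN p_gt1 le_pq C_ge0 twoN (W bs)
  (_ : 0 < M%:R^-1) wb EY)); first by rewrite invr_gt0.
rewrite lerD2l.
have ME : M%:R^-1 `^ (1 - q / p) = M%:R `^ (q / p - 1).
  by rewrite -powR_inv1 ?(ltW MR)// -powRrM mulN1r opprB.
rewrite ME /bet -!mulrA ler_wpM2l//.
have P1 := bernoulli_increment x pi01 (ltW p_gt1).
have Q1 := bernoulli_increment x pi01 q_ge1.
have PP : (\sum_b bern pi b * N ((b%:R - pi) *: x) `^ p) `^ (q / p) <=
    2 `^ (q / p) * (pi `^ (q / p) * N x `^ q).
  have -> : N x `^ q = (N x `^ p) `^ (q / p).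
    by rewrite -powRrM mulrC divfK// gt_eqF.
  rewrite -!powRM ?mulr_ge0 ?powR_ge0// mulrA; apply: ler_powR2r => //.
    by rewrite divr_ge0// ltW.
  by apply: sumr_ge0 => b _; rewrite mulr_ge0 ?powR_ge0// (proj1 wb).
have two1 : 2 <= 2 `^ (q / p) :> R by apply: le1r_powR; rewrite ?ler1n.
have QQ : \sum_b bern pi b * N ((b%:R - pi) *: x) `^ q <= 2 `^ (q / p) * (pi * N x `^ q).
  by apply: (le_trans Q1); rewrite -mulrA ler_wpM2r// mulr_ge0 ?powR_ge0.
rewrite mulrDl mulrDr lerD//.
by rewrite -mulrA mulrCA ler_wpM2l ?powR_ge0.
Qed.

End bernoulli_moment.

(** * The moment bound for incomplete U-statistics on a finite space *)

Section finite_moment.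
Context {R : realType} {B : completeNormedModType R}.
Variables (N : B -> R) (p q C : R).
Hypothesis normN : is_norm N.
Hypotheses (p_gt1 : 1 < p) (le_pq : p <= q) (C_ge0 : 0 <= C).
Hypothesis twoN : two_point N p q C.

Let N_ge0 := is_norm_ge0 normN.
Let p0 : 0 < p. Proof. exact: lt_trans p_gt1. Qed.
Let q_ge1 : 1 <= q. Proof. exact/ltW/(lt_le_trans p_gt1). Qed.
Let q0 : 0 < q. Proof. exact: lt_le_trans q_ge1. Qed.
Let s_ge1 : 1 <= q / p. Proof. by rewrite ler_pdivlMr// mul1r. Qed.

Definition finite_cst (m : nat) : R := 2 `^ q *
  (expR 1 * step_cst p q C * 2 `^ (q / p) + ustat_cst p q C m * (2 ^+ m * m.+1%:R)).

Lemma finite_cst_ge0 m : 0 <= finite_cst m.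
Proof.
by rewrite !(mulr_ge0, addr_ge0) ?powR_ge0 ?expR_ge0 ?step_cst_ge0 ?ustat_cst_ge0// exprn_ge0.
Qed.

(** The centered selection is used with [M = 'C(n, m)], which is also the factor gained when the
    q-th moments of all summands are added. Thus [M * M^(q/p - 1) = M^(q/p)], and [M <= n^m] gives
    the last two terms; [pi] times the complete U-statistic gives the first one and the defect. *)
Lemma finite_moment (K : finType) (w : K -> R) (h : seq K -> B) (n m d : nat)
    (pi eta : R) :
  weights w -> perm_invariant h -> (0 < m <= n)%N -> (d <= m)%N ->
  0 <= pi <= 1 -> 0 <= eta ->
  (forall c, (c < d)%N -> cond_moment N q w m c h <= eta) ->
  expect w n (fun s => expect (bern pi) 'C(n, m) (fun bs =>
    N (weighted_sum (fun b => b%:R) bs [seq h t | t <- combs m s]) `^ q)) <=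
  finite_cst m *
    ((n%:R `^ (q * (m%:R - d%:R) + d%:R * q / p) * pi `^ q
      + n%:R `^ (m%:R * q / p) * pi `^ (q / p) + n%:R ^+ m * pi) *
      expect w m (fun s => N (h s) `^ q) + n%:R `^ (q * m%:R) * eta).
Proof.
move=> ww hs /andP[m0 mn] dm pi01 eta0 Heta.
have [pi0 pi1] := andP pi01.
have n0 : (0 < n)%N by exact: leq_trans mn.
have nR : 0 < n%:R :> R by rewrite ltr0n.
set L := 'C(n, m).
have L0 : (0 < L)%N by rewrite bin_gt0.
have Ln : L%:R <= n%:R ^+ m :> R.
  by rewrite -natrX ler_nat /L -[X in 'C(X, _)](size_nseq n tt) -size_combs
    (leq_trans (size_combs_le _ _))// size_nseq.
set H := expect w m _.
have H0 : 0 <= H by apply: expect_ge0 => // s; exact: powR_ge0.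
have S0 := step_cst_ge0 p q C_ge0.
pose c1 := expR 1 * step_cst p q C * 2 `^ (q / p).
have c10 : 0 <= c1 by rewrite !mulr_ge0 ?powR_ge0 ?expR_ge0.
pose beta := L%:R `^ (q / p - 1) * pi `^ (q / p) + pi.
apply: (@le_trans _ _ (expect w n (fun s => 2 `^ q *
   (c1 * beta * (\sum_(t <- combs m s) N (h t) `^ q) +
    pi `^ q * N (ustat m h s) `^ q)))).
  apply: ler_expect => // s sn.
  set xs := map h _.
  have szxs : size xs = L by rewrite size_map size_combs sn.
  apply: (@le_trans _ _ (expect (bern pi) L (fun bs =>
     2 `^ q * (N (weighted_sum (fun b => b%:R - pi) bs xs) `^ q +
      pi `^ q * N (ustat m h s) `^ q)))).
    apply: ler_expect => [|bs szbs]; first exact: weights_bern.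
    have -> : weighted_sum (fun b : bool => b%:R) bs xs =
        weighted_sum (fun b : bool => b%:R - pi) bs xs + pi *: ustat m h s.
      have -> : ustat m h s = \sum_(z <- zip bs xs) z.2.
        by rewrite -(big_map snd xpredT id)/= -/(unzip2 _) unzip2_zip ?szxs ?szbs// /xs big_map.
      rewrite /weighted_sum scaler_sumr -big_split/=; apply: eq_bigr => z _.
      by rewrite -scalerDl subrK.
    have -> : pi `^ q * N (ustat m h s) `^ q = N (pi *: ustat m h s) `^ q.
      by rewrite is_normZ// ger0_norm// powRM.
    apply: le_trans (powR_addr_le (ltW q0) (N_ge0 _) (N_ge0 _)).
    by apply: ler_powR2r; rewrite ?N_ge0 ?is_normD// ltW.
  rewrite expectZ expectD expect_cst; last exact: weights_bern.
  rewrite ler_wpM2l ?powR_ge0// lerD2r.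
  have := bernoulli_moment normN p_gt1 le_pq C_ge0 twoN pi01 L0 (xs := xs).
  by rewrite szxs => /(_ (leqnn _)); rewrite /xs big_map.
rewrite expectZ /finite_cst -[leRHS]mulrA ler_wpM2l ?powR_ge0//.
rewrite expectD !expectZ expect_sum_combs// -/H -/L.
have U1 := ustat_moment normN p_gt1 le_pq C_ge0 twoN m h ww n0 (leqnn n).
have U2 := ustat_bound_degenerate normN p_gt1 le_pq ww n0 dm hs eta0 Heta.
have U0 := ustat_cst_ge0 p q C_ge0 m.
have U := ler_wpM2l (powR_ge0 pi q) (le_trans U1 (ler_wpM2l U0 U2)).
rewrite -/H (mulrA (ustat_cst _ _ _ _)) in U.
rewrite -/c1; set c2 := ustat_cst _ _ _ _ * _ in U *.
have c20 : 0 <= c2 by rewrite !mulr_ge0 ?exprn_ge0.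
have aE : (n%:R `^ q) ^+ (m - d) * (n%:R `^ (q / p)) ^+ d =
    n%:R `^ (q * (m%:R - d%:R) + d%:R * q / p).
  rewrite -!powR_mulrn ?powR_ge0// -!powRrM -powRD; last by rewrite (gt_eqF nR) implybT.
  by congr (_ `^ _); rewrite natrB//; ring.
have aE' : (n%:R `^ q) ^+ m = n%:R `^ (q * m%:R).
  by rewrite -!powR_mulrn ?powR_ge0// -!powRrM.
rewrite aE aE' in U.
set T1 := n%:R `^ _ in U *; set T0 := n%:R `^ _ in U *.
have E2 : L%:R * beta <= n%:R `^ (m%:R * q / p) * pi `^ (q / p) + n%:R ^+ m * pi.
  rewrite mulrDr mulrA mulr_powRB1 ?divr_gt0//.
  apply: lerD; last by rewrite ler_wpM2r.
  rewrite ler_wpM2r ?powR_ge0//.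
  have -> : n%:R `^ (m%:R * q / p) = (n%:R ^+ m) `^ (q / p).
    by rewrite -powR_mulrn ?(ltW nR)// -powRrM mulrA.
  by apply: ler_powR2r => //; rewrite divr_ge0// ltW.
(* The factor [pi^q] of the defect is dropped, as only its convergence to 0 with [eta] will
   matter. *)
have p1q : pi `^ q <= 1.
  apply: (@le_trans _ _ (1 `^ q)); last by rewrite powR1.
  by apply: ler_powR2r => //; exact: ltW.
have T00 : 0 <= T0 by exact: powR_ge0.
have T10 : 0 <= T1 by exact: powR_ge0.
apply: le_trans (lerD (_ : _ <= c1 * ((n%:R `^ (m%:R * q / p) * pi `^ (q / p) + n%:R ^+ m * pi) * H)) U) _.
  by rewrite -mulrA ler_wpM2l// mulrA [beta * _]mulrC ler_wpM2r.
set T2 := n%:R `^ _ * _; set T3 := n%:R ^+ m * _.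
have T20 : 0 <= T2 by rewrite mulr_ge0 ?powR_ge0.
have T30 : 0 <= T3 by rewrite mulr_ge0 ?exprn_ge0.
have P0 := powR_ge0 pi q.
have G1 : 0 <= c1 * (T1 * pi `^ q * H + T0 * eta).
  by rewrite mulr_ge0// addr_ge0 ?mulr_ge0.
have G2 : 0 <= c2 * ((T2 + T3) * H) by rewrite !mulr_ge0// addr_ge0.
have G3 : c2 * (T0 * eta) * pi `^ q <= c2 * (T0 * eta) * 1.
  by rewrite ler_wpM2l// !mulr_ge0.
move: (pi `^ q) P0 G1 G2 G3 {p1q U} => P *.
by lra.
Qed.

End finite_moment.

(** Returning from the smooth norm to the given one costs [c1^(-q) * c2^q]. The constant precedes
    the finite space, the kernel, n and the defect, so it survives the limit. *)
Lemma r_smooth_finite_moment {R : realType} {B : completeNormedModType R}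
    (r p q : R) (m : nat) :
  1 < p -> p <= r -> r <= 2 -> p <= q -> r_smooth B r ->
  exists2 C : R, 0 <= C &
  forall (K : finType) (w : K -> R) (h : seq K -> B) (n d : nat) (pi eta : R),
  weights w -> perm_invariant h -> (0 < m <= n)%N -> (d <= m)%N ->
  0 <= pi <= 1 -> 0 <= eta ->
  (forall c, (c < d)%N -> cond_moment Num.norm q w m c h <= eta) ->
  expect w n (fun s => expect (bern pi) 'C(n, m) (fun bs =>
    `|weighted_sum (fun b => b%:R) bs [seq h t | t <- combs m s]| `^ q)) <=
  C * ((n%:R `^ (q * (m%:R - d%:R) + d%:R * q / p) * pi `^ q
      + n%:R `^ (m%:R * q / p) * pi `^ (q / p) + n%:R ^+ m * pi) *
      expect w m (fun s => `|h s| `^ q) + n%:R `^ (q * m%:R) * eta).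
Proof.
move=> p1 pr r2 pq /(r_smooth_two_point p1 pr r2 pq).
move=> [N [[normN [c1 [c2 [c10 c20 Nc]]]] [C C0 twoN]]].
have q0 : 0 <= q by rewrite (le_trans _ pq)// ltW// (lt_trans _ p1).
have N0 := is_norm_ge0 normN.
have NL x : `|x| `^ q <= c1 `^ (- q) * N x `^ q.
  rewrite powRN ler_pdivlMl ?powR_gt0// -powRM ?(ltW c10)//.
  by apply: ler_powR2r => //; [rewrite mulr_ge0// ltW|case/andP: (Nc x)].
have NU x : N x `^ q <= c2 `^ q * `|x| `^ q.
  rewrite -powRM ?(ltW c20)//.
  by apply: ler_powR2r => //; case/andP: (Nc x).
have FC0 : 0 <= finite_cst p q C m.
  exact: finite_cst_ge0.
exists (c1 `^ (- q) * finite_cst p q C m * c2 `^ q).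
  exact: mulr_ge0 (mulr_ge0 (powR_ge0 _ _) FC0) (powR_ge0 _ _).
move=> K w h n d pi eta ww hs mn dm pi01 eta0 Heta.
have eta'0 : 0 <= c2 `^ q * eta by rewrite mulr_ge0 ?powR_ge0.
have Heta' c : (c < d)%N -> cond_moment N q w m c h <= c2 `^ q * eta.
  move=> cd; apply: le_trans (ler_wpM2l (powR_ge0 c2 q) (Heta c cd)).
  by rewrite /cond_moment -expectZ; apply: ler_expect.
have := finite_moment normN p1 pq C0 twoN ww hs mn dm pi01 eta'0 Heta'.
move=> /(ler_wpM2l (powR_ge0 c1 (- q))) H.
apply: le_trans (le_trans _ H) _.
  rewrite -expectZ; apply: ler_expect => // s _.
  rewrite -expectZ; apply: ler_expect => [|bs _ //]; exact: weights_bern.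
set cf := (_ + _ + n%:R ^+ m * pi); set T := n%:R `^ (q * m%:R).
have cf0 : 0 <= cf.
  by have /andP[pi0 _] := pi01; rewrite !addr_ge0 ?mulr_ge0 ?powR_ge0 ?exprn_ge0.
rewrite -2!(mulrA (c1 `^ (- q))) ler_wpM2l ?powR_ge0// -mulrA ler_wpM2l//.
rewrite (mulrCA T) mulrDr lerD2r mulrCA ler_wpM2l//.
by rewrite -expectZ; apply: ler_expect.
Qed.

(** * Enumeration of increasing index tuples *)

Section combinations.

Lemma mem_combs (T : eqType) m (s t : seq T) :
  (t \in combs m s) = subseq t s && (size t == m).
Proof.
elim: s m t => [|x s IH] [|m] [|y t] //; rewrite ?inE ?eqxx ?andbF ?sub0seq//=.
  by rewrite mem_cat IH andbF; apply/negbTE/negP => /mapP[].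
have consE : (y :: t \in [seq x :: u | u <- combs m s]) = (y == x) && (t \in combs m s).
  apply/mapP/andP => [[u us [-> ->]]|[/eqP-> ts]]; first by rewrite eqxx.
  by exists t.
rewrite mem_cat consE !IH /= eqSS; case: (eqVneq y x) => /= [->|_]; last by rewrite orbF.
case: (size t == m); rewrite ?andbF// !andbT.
by apply/orP/idP => [[/cons_subseq|]//|]; right.
Qed.

Lemma uniq_combs (T : eqType) m (s : seq T) : uniq s -> uniq (combs m s).
Proof.
elim: s m => [|x s IH] [|m] //= /andP[xs us].
rewrite cat_uniq IH//= map_inj_uniq ?IH ?andbT//; last by move=> ? ? [].
apply/hasPn => t /mapP[u _ ->]; rewrite mem_combs negb_and.
apply/orP; left; apply: contra xs => /mem_subseq -> //; exact: mem_head.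
Qed.

Definition Inc_seq (m n : nat) (i : Inc m n) : seq nat :=
  [seq nat_of_ord j | j <- val i].

Lemma Inc_seq_inj m n : injective (@Inc_seq m n).
Proof. by move=> i j /(inj_map val_inj)/val_inj/val_inj. Qed.

Lemma path_ltn_iota m n : path ltn m (iota m.+1 n).
Proof. by elim: n m => //= n IH m; rewrite ltnSn IH. Qed.

(** A strictly increasing list is determined by its elements, so it equals the filter of [iota 1 n]
    by its own members, which is visibly a subsequence. *)
Lemma Inc_seq_combs m n (i : Inc m n) : Inc_seq i \in combs m (iota 1 n).
Proof.
rewrite mem_combs size_map size_tuple eqxx andbT.
have pi : path ltn 0 (Inc_seq i) by exact: (valP i).
suff -> : Inc_seq i = [seq j <- iota 1 n | j \in Inc_seq i] by exact: filter_subseq.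
apply: (irr_sorted_eq ltn_trans ltnn); first exact: path_sorted pi.
  by apply: sorted_filter; [exact: ltn_trans|exact: iota_ltn_sorted].
move=> j; rewrite mem_filter mem_iota add1n andb_idr// => ji.
have /allP -> // := order_path_min ltn_trans pi.
by case/mapP: ji => k _ ->; rewrite ltn_ord.
Qed.

Lemma combs_Inc_seq m n t : t \in combs m (iota 1 n) -> exists i : Inc m n, Inc_seq i = t.
Proof.
rewrite mem_combs => /andP[st /eqP szt].
have tn k : k \in t -> (k < n.+1)%N.
  by move=> /(mem_subseq st); rewrite mem_iota add1n => /andP[].
have tE : [seq nat_of_ord j | j <- map (@inord n) t] = t.
  rewrite -map_comp map_id_in// => k kt /=; rewrite inordK//; exact: tn.
have szi : size (map (@inord n) t) == m by rewrite size_map szt.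
have pt : path ltn 0 [seq nat_of_ord j | j <- Tuple szi].
  by rewrite tE; apply: subseq_path st (path_ltn_iota 0 n); exact: ltn_trans.
by exists (exist _ (Tuple szi) pt).
Qed.

(** The indices are listed in the order of [combs], so that the selectors [a i] line up with the
    summands paired by [zip] in [weighted_sum]. *)
Lemma Inc_enum m n : exists es : seq (Inc m n),
  [/\ map (@Inc_seq m n) es = combs m (iota 1 n), uniq es & forall i, i \in es].
Proof.
have [es esE] : exists es : seq (Inc m n), map (@Inc_seq m n) es = combs m (iota 1 n).
  have : {subset combs m (iota 1 n) <= combs m (iota 1 n)} by [].
  elim: {1 3}(combs _ _) => [|t ts IH] sub; first by exists [::].
  have [i <-] := combs_Inc_seq (sub _ (mem_head _ _)).
  have [es <-] := IH (fun u uts => sub u (mem_behead (s := t :: ts) uts)).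
  by exists (i :: es).
exists es; split => // [|i].
  by rewrite -(map_inj_uniq (@Inc_seq_inj m n)) esE uniq_combs// iota_uniq.
by rewrite -(mem_map (@Inc_seq_inj m n)) esE Inc_seq_combs.
Qed.

Lemma size_Inc_enum m n (es : seq (Inc m n)) :
  map (@Inc_seq m n) es = combs m (iota 1 n) -> size es = 'C(n, m).
Proof. by move=> esE; rewrite -(size_map (@Inc_seq m n)) esE size_combs size_iota. Qed.

Lemma sum_Inc (V : nmodType) m n (es : seq (Inc m n)) (F : Inc m n -> V) :
  uniq es -> (forall i, i \in es) -> \sum_i F i = \sum_(i <- es) F i.
Proof.
move=> ues es_all; rewrite [RHS]big_uniq//=; apply: eq_bigl => i; by rewrite es_all.
Qed.

End combinations.

(** * Integration and laws of finite-valued variables *)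

Section integral_monotone.
Context d (T : measurableType d) (R : realType) (P : {measure set T -> \bar R}).
Local Open Scope ereal_scope.

(* [ge0_le_integral] of the library requires measurability; here the integrand
   may be the norm of a sum in [B]. *)
Lemma ge0_le_integral_nomeas (f g : T -> \bar R) :
  (forall x, 0 <= f x) -> (forall x, f x <= g x) ->
  \int[P]_x f x <= \int[P]_x g x.
Proof.
move=> f0 fg; have g0 x : 0 <= g x by exact: le_trans (f0 x) (fg x).
rewrite !ge0_integralTE//; apply: le_ereal_sup => _ [h hf <-].
by exists h => // x; exact: le_trans (hf x) (fg x).
Qed.

(** Raising g to [+oo] on [Z] makes the inequality hold everywhere without changing the integral of
    g. No measurability is asked of f, which will be a power of the norm of the U-statistic. *)
Lemma ge0_le_integral_off (Z : set T) (f g : T -> \bar R) :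
  measurable Z -> P Z = 0 -> measurable_fun setT g ->
  (forall x, 0 <= f x) -> (forall x, 0 <= g x) -> (forall x, ~ Z x -> f x <= g x) ->
  \int[P]_x f x <= \int[P]_x g x.
Proof.
move=> mZ PZ mg f0 g0 fg.
pose g' x := g x + (\1_Z x)%:E * +oo.
have ind0 x : 0 <= (\1_Z x : R)%:E by rewrite lee_fin.
have g'0 x : 0 <= g' x by rewrite adde_ge0// mule_ge0.
apply: (@le_trans _ _ (\int[P]_x g' x)).
  apply: ge0_le_integral_nomeas => // x; rewrite /g' indicE.
  have [xZ|xZ] := boolP (x \in Z).
    by rewrite mul1e addey ?leey// gt_eqF// (lt_le_trans _ (g0 x)).
  by rewrite mul0e adde0 fg// => /mem_set; exact/negP.
have mg' : measurable_fun setT g'.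
  apply: emeasurable_funD => //; apply: emeasurable_funM => //.
  exact/measurable_EFinP/measurable_indic.
rewrite (ge0_ae_eq_integral measurableT mg' mg)//.
exists Z; split => // x; apply: contra_notP => nZ _.
by rewrite /g' indicE memNset// mul0e adde0.
Qed.

End integral_monotone.

Section finite_range.
Context d (T : measurableType d) (R : realType).

(** Measurability is stated by fibres, so that the label set carries no sigma-algebra. *)
Definition finite_rv (K : Type) (X : T -> K) :=
  forall k, measurable (X @^-1` [set k]).

Lemma finite_rv_preimage (K : finType) (X : T -> K) (A : set K) :
  finite_rv X -> measurable (X @^-1` A).
Proof.
move=> mX; rewrite (_ : _ @^-1` _ = \big[setU/set0]_(k : K | k \in A) (X @^-1` [set k])).
  by apply: bigsetU_measurable => k _; exact: mX.
apply/seteqP; split=> [w Aw|w].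
  rewrite -bigcup_seq_cond; exists (X w) => //=.
  by rewrite mem_index_enum mem_set.
by rewrite -bigcup_seq_cond => -[k /= /andP[_ /set_mem Ak] Xk]; rewrite /preimage/= Xk.
Qed.

Lemma finite_rv_comp (K L : finType) (X : T -> K) (f : K -> L) :
  finite_rv X -> finite_rv (f \o X).
Proof. by move=> mX l; exact: (finite_rv_preimage (f @^-1` [set l])). Qed.

Lemma finite_rv_pair (K L : finType) (X : T -> K) (Y : T -> L) :
  finite_rv X -> finite_rv Y -> finite_rv (fun w => (X w, Y w)).
Proof.
move=> mX mY [k l].
rewrite (_ : _ @^-1` _ = X @^-1` [set k] `&` Y @^-1` [set l]).
  exact: measurableI.
by apply/seteqP; split=> w; rewrite /preimage /= => -[-> ->].
Qed.

Lemma finite_rv_sum (K : finType) (X : T -> K) (V : nmodType) (F : K -> T -> V) w :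
  F (X w) w = \sum_k (if X w == k then F k w else 0).
Proof.
rewrite (bigD1 (X w))//= eqxx big1 ?addr0// => k.
by rewrite eq_sym => /negbTE ->.
Qed.

Lemma measurable_finite_rv (K : finType) (X : T -> K) (F : K -> T -> R) :
  finite_rv X -> (forall k, measurable_fun setT (F k)) ->
  measurable_fun setT (fun w => F (X w) w).
Proof.
move=> mX mF.
rewrite (_ : (fun w => F (X w) w) =
  fun w => \sum_k (\1_(X @^-1` [set k]) w * F k w)).
  apply: measurable_sum => k; apply: measurable_funM => //.
apply/funext => w; rewrite (@finite_rv_sum _ X); apply: eq_bigr => k _.
rewrite indicE; case: eqP => [Xk|Xk]; first by rewrite mem_set// mul1r.
by rewrite memNset// mul0r.
Qed.

Lemma integral_finite_rv (P : probability T R) (K : finType) (X : T -> K)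
    (F : K -> R) : finite_rv X -> (forall k, 0 <= F k) ->
  (\int[P]_w (F (X w))%:E = (\sum_k fine (P (X @^-1` [set k])) * F k)%:E)%E.
Proof.
move=> mX F0.
have Pfin k : P (X @^-1` [set k]) \is a fin_num by exact: fin_num_measure.
rewrite (_ : (fun w => (F (X w))%:E) =
  fun w => (\sum_k (F k)%:E * (\1_(X @^-1` [set k]) w)%:E)%E); last first.
  apply/funext => w; under [RHS]eq_bigr do rewrite -EFinM.
  rewrite sumEFin (@finite_rv_sum _ X _ (fun k _ => F k)); congr EFin.
  apply: eq_bigr => k _; rewrite indicE.
  case: eqP => [Xk|Xk]; first by rewrite mem_set// mulr1.
  by rewrite memNset// mulr0.
rewrite ge0_integral_sum//.
- rewrite -sumEFin; apply: eq_bigr => k _.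
  rewrite ge0_integralZl_EFin//.
  + by rewrite integral_indic// setIT EFinM fineK// muleC.
  + by apply/measurable_EFinP; exact: measurable_indic.
- move=> k; apply: emeasurable_funM; first exact: measurable_cst.
  by apply/measurable_EFinP; exact: measurable_indic.
- by move=> k w _; rewrite -EFinM lee_fin mulr_ge0.
Qed.

(** The sublevel sets are preimages of balls centered at b, so measurability of the subtraction in
    [B] never comes into question. *)
Lemma measurable_normB (B : completeNormedModType R) (f : T -> B) (b : B) :
  measurable_fun setT (f : T -> borel B) ->
  measurable_fun setT (fun w => `|f w - b|).
Proof.
move=> mf.
apply: (measurability _ (RGenInftyO.measurableE R)) => _ [_ [r ->] <-].
rewrite setTI.
have mb : measurable (ball b r : set (borel B)).
  by apply: sub_sigma_algebra; exact: ball_open.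
have := mf measurableT _ mb; rewrite setTI.
rewrite (_ : f @^-1` ball b r = (fun w => `|f w - b|) @^-1` `]-oo, r[)//.
by apply/seteqP; split=> w; rewrite /= -ball_normE /= in_itv/= distrC.
Qed.

Lemma measurable_dist_finite_rv (B : completeNormedModType R) (K : finType)
    (f : T -> B) (X : T -> K) (H : K -> B) :
  measurable_fun setT (f : T -> borel B) -> finite_rv X ->
  measurable_fun setT (fun w => `|f w - H (X w)|).
Proof.
move=> mf mX; apply: (measurable_finite_rv (F := fun k w => `|f w - H k|) mX) => k.
exact: measurable_normB.
Qed.

Lemma measurable_powR_norm q (f : T -> R) : measurable_fun setT f ->
  measurable_fun setT (fun w => (f w `^ q)%:E).
Proof.
move=> mf; apply/measurable_EFinP.
exact: (measurableT_comp (measurable_powR q) mf).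
Qed.

End finite_range.

(** * Laws of i.i.d. samples *)

Section iid_laws.
Context {R : realType} {dT : measure_display} {T : measurableType dT}.
Variable P : probability T R.
Context {I : choiceType} {dS : measure_display} {S : measurableType dS}.
Variable X : I -> {RV P >-> S}.
Hypothesis iidX : iid X.

Lemma independent_seq (es : seq I) (A : I -> set S) : uniq es ->
  (forall i, measurable (A i)) ->
  P [set w | forall i, i \in es -> A i (X i w)] =
  (\prod_(i <- es) P (X i @^-1` A i))%E.
Proof.
move=> ues mA.
have -> : [set w | forall i, i \in es -> A i (X i w)] =
    \bigcap_(i in [set` [fset i in es]%fset]) X i @^-1` A i.
  apply/seteqP; split=> w /= H i; first by rewrite /= in_fset => /H.
  by move=> ies; apply: H; rewrite /= in_fset.
rewrite (proj1 iidX)//; apply: perm_big.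
by apply: uniq_perm; rewrite ?fset_uniq// => i; rewrite in_fset.
Qed.

Definition law_weight (K : Type) (pi : S -> K) (i0 : I) (k : K) : R :=
  fine (P (X i0 @^-1` (pi @^-1` [set k]))).

Section finite_partition.
Context {K : finType}.
Variable pi : S -> K.
Hypothesis mpi : finite_rv pi.

Lemma measurable_comp_RV i : finite_rv (pi \o X i).
Proof.
move=> k; rewrite comp_preimage -[X in measurable X]setTI.
exact: measurable_funPT (mpi k).
Qed.

Lemma law_weightE i0 i k :
  P (X i @^-1` (pi @^-1` [set k])) = (law_weight pi i0 k)%:E.
Proof.
rewrite /law_weight fineK; first exact: (proj2 iidX) (mpi k).
apply: fin_num_measure; exact: measurable_comp_RV.
Qed.

Lemma weights_law i0 : weights (law_weight pi i0).
Proof.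
split=> [k|]; first exact: fine_ge0.
have := integral_finite_rv P (measurable_comp_RV i0) (F := fun=> 1%R) (fun=> ler01).
rewrite integral_cst//= probability_setT mule1 => -[->].
by apply: eq_bigr => k _; rewrite mulr1.
Qed.

Lemma joint_law i0 (es : seq I) (t : seq K) : uniq es -> size t = size es ->
  P [set w | [seq pi (X i w) | i <- es] = t] =
  (\prod_(k <- t) law_weight pi i0 k)%:E.
Proof.
case: t => [|k0 t'] ues.
  move=> /esym/size0nil ->; rewrite big_nil.
  by rewrite (_ : [set w | _] = setT) ?probability_setT//; apply/seteqP; split.
set t := k0 :: t' => szt.
(* As [es] has no repetition, the word t can be read as a function of the index, and the event
   becomes an intersection of events on single variables. *)
pose u i := nth k0 t (index i es).
have ut : [seq u i | i <- es] = t.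
  apply: (@eq_from_nth _ k0); rewrite size_map// => j jes.
  have i1 : I by case: (es) jes => [|i1 _ _]//.
  by rewrite (nth_map i1)// /u index_uniq.
transitivity (P [set w | forall i, i \in es -> (pi @^-1` [set u i]) (X i w)]).
  congr (P _); apply/seteqP; split=> w /=; rewrite -{1}ut.
    by move=> /eq_in_map.
  by move=> H; apply/eq_in_map.
rewrite (independent_seq ues (A := fun i => pi @^-1` [set u i])); last first.
  by move=> i; exact: mpi.
rewrite -ut big_map -prodEFin; apply: eq_bigr => i _; exact: law_weightE.
Qed.

Lemma measurable_joint (es : seq I) (t : seq K) :
  measurable [set w | [seq pi (X i w) | i <- es] = t].
Proof.
elim: es t => [|i es IH] [|k t] /=.
- by rewrite (_ : [set w | _] = setT)//; apply/seteqP; split.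
- by rewrite (_ : [set w | _] = set0)//; apply/seteqP; split.
- by rewrite (_ : [set w | _] = set0)//; apply/seteqP; split.
rewrite (_ : [set w | _] = (pi \o X i) @^-1` [set k] `&`
   [set w | [seq pi (X i w) | i <- es] = t]).
  by apply: measurableI => //; exact: measurable_comp_RV.
by apply/seteqP; split=> w /= => [[-> ->]|[-> ->]].
Qed.

Lemma sigma_family_joint (es : seq I) (t : seq K) :
  sigma_family X [set w | [seq pi (X i w) | i <- es] = t].
Proof.
(* The generated sigma-algebra is viewed as a measurable space, so that the closure lemmas for
   [measurable] apply to it. *)
pose U := g_sigma_algebraType (\bigcup_(i in [set: I]) g_sigma_algebra_preimage (X i)).
suff : @measurable _ U [set w | [seq pi (X i w) | i <- es] = t] by [].
elim: es t => [|i es IH] [|k t] /=.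
- by rewrite (_ : [set w | _] = setT)//; apply/seteqP; split.
- by rewrite (_ : [set w | _] = set0)//; apply/seteqP; split.
- by rewrite (_ : [set w | _] = set0)//; apply/seteqP; split.
rewrite (_ : [set w | _] = (pi \o X i) @^-1` [set k] `&`
   [set w | [seq pi (X i w) | i <- es] = t]).
  apply: measurableI => //; apply: sub_sigma_algebra; exists i => //.
  by exists (pi @^-1` [set k]); [exact: mpi|rewrite setTI].
by apply/seteqP; split=> w /= => [[-> ->]|[-> ->]].
Qed.

End finite_partition.

Section tuple_law.
Variable m : nat.

Definition tupleX (u : m.-tuple I) (w : T) : m.-tuple S :=
  [tuple X (tnth u k) w | k < m].

Lemma measurable_tupleX u : measurable_fun setT (tupleX u).
Proof.
apply/measurable_fun_tnthP => k.
rewrite (_ : _ \o _ = X (tnth u k)); first exact: measurable_funPT.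
by apply/funext => w; rewrite /= tnth_mktuple.
Qed.

Definition tupleRV (u : m.-tuple I) : {RV P >-> m.-tuple S} :=
  mfun_Sub (mem_set (measurable_tupleX u)).

Lemma tupleRVE u : tupleRV u = tupleX u :> (T -> m.-tuple S).
Proof. by []. Qed.

Definition rectangles : set (set (m.-tuple S)) :=
  [set E | exists2 A : 'I_m -> set S, (forall k, measurable (A k)) &
     E = [set x | forall k, A k (tnth x k)]].

Lemma law_rectangle (u : m.-tuple I) (A : 'I_m -> set S) i0 : uniq u ->
  (forall k, measurable (A k)) ->
  distribution P (tupleRV u) [set x | forall k, A k (tnth x k)] =
  (\prod_(k < m) distribution P (X i0) (A k))%E.
Proof.
move=> uu mA.
have [m0|m0] := posnP m.
  rewrite /distribution /pushforward (_ : _ @^-1` _ = setT); last first.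
    by apply/seteqP; split => // w _ [k km]; exfalso; rewrite m0 in km.
  by rewrite probability_setT big1// => -[k km]; exfalso; rewrite m0 in km.
pose A' i : set S := if insub (index i u) is Some k then A k else setT.
have A'E k : A' (tnth u k) = A k.
  by rewrite /A' (tnth_nth (tnth u k)) index_uniq ?size_tuple// valK.
have mA' i : measurable (A' i) by rewrite /A'; case: insub.
transitivity (P [set w | forall i, i \in tval u -> A' i (X i w)]).
  rewrite /distribution /pushforward; congr (P _); apply/seteqP; split=> w /= H.
    move=> _ /tnthP[k ->]; rewrite A'E.
    by have := H k; rewrite tnth_mktuple.
  by move=> k; rewrite tnth_mktuple -A'E; apply: H; exact: mem_tnth.
rewrite independent_seq// big_tuple; apply: eq_bigr => k _.
rewrite A'E; exact: (proj2 iidX).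
Qed.

(** Rectangles are stable under intersection and generate the product sigma-algebra, so the
    agreement of the two laws on them is enough. The case [m = 0] is apart because it offers no
    reference index. *)
Lemma law_tupleRV (u v : m.-tuple I) (E : set (m.-tuple S)) : uniq u -> uniq v ->
  measurable E -> distribution P (tupleRV u) E = distribution P (tupleRV v) E.
Proof.
move=> uu uv mE.
have [m0|m0] := posnP m.
  congr (P _); apply/seteqP.
  have uvE w : tupleX u w = tupleX v w.
    by apply: eq_from_tnth => -[k km]; exfalso; rewrite m0 in km.
  by split => w; rewrite /preimage /= -!tupleRVE ?tupleRVE uvE.
pose i0 := tnth u (Ordinal m0).
have rectT : rectangles setT.
  by exists (fun=> setT) => //; apply/seteqP; split.
apply: (measure_unique rectangles (fun=> setT)) => //.
- apply/seteqP; split; last first.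
    apply: smallest_sub; first exact: sigma_algebra_measurable.
    move=> _ [A mA ->].
    rewrite (_ : [set x | _] = \big[setI/setT]_(k < m) ((fun x => tnth x k) @^-1` A k)).
      apply: bigsetI_measurable => k _; rewrite -[X in measurable X]setTI.
      exact: measurable_tnth.
    apply/seteqP; split=> x; rewrite -bigcap_seq /=.
      by move=> H k _; exact: H.
    by move=> H k; apply: H; rewrite /= mem_index_enum.
  apply: smallest_sub; first exact: smallest_sigma_algebra.
  rewrite -bigcup_seq => A [k _ [C mC <-]]; rewrite setTI.
  apply: sub_sigma_algebra; exists (fun j => if j == k then C else setT).
    by move=> j; case: ifP.
  apply/seteqP; split => x /=; last by move=> /(_ k); rewrite eqxx.
  by move=> Cx j; case: eqP => [->|].
- move=> _ _ [A mA ->] [C mC ->]; exists (fun k => A k `&` C k).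
    by move=> k; exact: measurableI.
  apply/seteqP; split=> x /=; first by move=> [H1 H2] k; split.
  by move=> H; split=> k; have [] := H k.
- by apply/seteqP; split => // x _; exists 0%N.
- by move=> _ [A mA ->]; exact: etrans (@law_rectangle u A i0 uu mA) (esym (@law_rectangle v A i0 uv mA)).
- by move=> k; rewrite (le_lt_trans (probability_le1 (distribution P (tupleRV u)) measurableT))// ltry.
Qed.

(** It serves twice: to permute the coordinates of the sample, and to replace any increasing index
    tuple by the first m indices. *)
Lemma integral_tupleX (u v : m.-tuple I) (f : m.-tuple S -> \bar R) :
  uniq u -> uniq v -> measurable_fun setT f -> (forall x, 0 <= f x)%E ->
  (\int[P]_w f (tupleX u w) = \int[P]_w f (tupleX v w))%E.
Proof.
move=> uu uv mf f0.
have -> : (\int[P]_w f (tupleX u w) = \int[distribution P (tupleRV u)]_x f x)%E.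
  by rewrite ge0_integral_distribution.
have -> : (\int[P]_w f (tupleX v w) = \int[distribution P (tupleRV v)]_x f x)%E.
  by rewrite ge0_integral_distribution.
apply: eq_measure_integral => A mA _; exact: law_tupleRV.
Qed.

End tuple_law.

End iid_laws.

Lemma cvge0_lt (R : realType) (u : nat -> \bar R) (eps : R) :
  u n @[n --> \oo] --> 0%E -> 0 < eps -> \forall n \near \oo, (u n < eps%:E)%E.
Proof.
move=> u0 e0; suff /u0 : nbhs (0 : \bar R)%E [set y | (y < eps%:E)%E] by [].
by apply: open_nbhs_nbhs; split; [exact: open_ereal_lt_ereal|rewrite /= lte_fin].
Qed.

Section finite_rv_constructions.
Context d (T : measurableType d).

Lemma finite_rv_mem (E : set T) : measurable E -> finite_rv (fun x => x \in E).
Proof.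
move=> mE [].
  rewrite (_ : _ @^-1` _ = E)//.
  by apply/seteqP; split=> x /=; [exact: set_mem|exact: mem_set].
rewrite (_ : _ @^-1` _ = ~` E); first exact: measurableC.
apply/seteqP; split=> x; rewrite /preimage /=; last by move=> nE; rewrite memNset.
by move=> /negbT/negP + Ex; apply; exact: mem_set.
Qed.

Lemma finite_rv_mktuple (L : eqType) n (X : 'I_n -> T -> L) :
  (forall k, finite_rv (X k)) -> finite_rv (fun w => [tuple X k w | k < n]).
Proof.
move=> mX t.
rewrite (_ : _ @^-1` _ = \big[setI/setT]_(k < n) (X k @^-1` [set tnth t k])).
  by apply: bigsetI_measurable => k _; exact: mX.
apply/seteqP; split=> w; rewrite -bigcap_seq /preimage /=.
  by move=> <- k _; rewrite /= tnth_mktuple.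
move=> H; apply: eq_from_tnth => k; rewrite tnth_mktuple; apply: H.
by rewrite /= mem_index_enum.
Qed.

Lemma measurable_fun_finite_rv (R : realType) (B : completeNormedModType R)
    (K : finType) (X : T -> K) (c : K -> B) : finite_rv X ->
  measurable_fun setT ((fun w => c (X w)) : T -> borel B).
Proof.
move=> mX _ A _; rewrite setTI.
exact: (finite_rv_preimage (c @^-1` A) mX).
Qed.

End finite_rv_constructions.

Lemma finite_rv_map_tuple {d} {S : measurableType d} (K : finType) (pi : S -> K) m :
  finite_rv pi -> finite_rv (fun x : m.-tuple S => map_tuple pi x).
Proof.
move=> mpi.
rewrite (_ : (fun x => _) = fun x : m.-tuple S => [tuple pi (tnth x k) | k < m]).
  apply: finite_rv_mktuple => k l.
  rewrite (_ : _ @^-1` _ = (@tnth m S ^~ k) @^-1` (pi @^-1` [set l]))//.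
  rewrite -[X in measurable X]setTI; exact: measurable_tnth.
apply/funext => x; apply: eq_from_tnth => k.
by rewrite tnth_map tnth_mktuple.
Qed.

(** * Approximation of kernels *)

Section approximation.
Context {R : realType} {B : completeNormedModType R}.
Context {d : measure_display} {S : measurableType d} {m : nat}.
Variable Q : probability (m.-tuple S) R.

Definition symdiff (T : Type) (E F : set T) := (E `\` F) `|` (F `\` E).

(** One labelling [pi] serves all coordinates, so that the labelled sample is again i.i.d. and
    permuting coordinates stays within the same labels. *)
Definition cylinder (K : finType) (pi : S -> K) (G : pred (seq K)) :
  set (m.-tuple S) := [set x | G (map pi x)].

Lemma measurable_cylinder (K : finType) (pi : S -> K) (G : pred (seq K)) :
  finite_rv pi -> measurable (cylinder pi G).
Proof.
move=> /(@finite_rv_map_tuple _ _ _ _ m) mpi.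
exact: (finite_rv_preimage [set t : m.-tuple K | G t] mpi).
Qed.

Lemma measurable_symdiff (E F : set (m.-tuple S)) : measurable E ->
  measurable F -> measurable (symdiff E F).
Proof. by move=> mE mF; apply: measurableU; exact: measurableD. Qed.

Definition approx_set (E : set (m.-tuple S)) := measurable E /\
  forall eps : R, 0 < eps -> exists (K : finType) (pi : S -> K) (G : pred (seq K)),
    finite_rv pi /\ (Q (symdiff E (cylinder pi G)) <= eps%:E)%E.

Lemma approx_setC E : approx_set E -> approx_set (~` E).
Proof.
move=> [mE aE]; split; first exact: measurableC.
move=> eps /aE[K [pi [G [mpi QG]]]]; exists K, pi, (fun s => ~~ G s); split => //.
rewrite (_ : symdiff _ _ = symdiff E (cylinder pi G))//.
apply/seteqP; split=> x; rewrite /symdiff /cylinder /=.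
  move=> [[nE /negP]|[nG nnE]]; first by rewrite negbK; right.
  by left; split; [exact: contrapT|exact/negP].
move=> [[Ex nG]|[Gx nE]]; last by left; split => //; rewrite Gx.
by right; split; [exact/negP|exact].
Qed.

(** Pairing the two labellings gives a common refinement, on which both cylinders can be read
    off. *)
Lemma approx_setU E F : approx_set E -> approx_set F -> approx_set (E `|` F).
Proof.
move=> [mE aE] [mF aF]; split; first exact: measurableU.
move=> eps e0; have e20 : 0 < eps / 2 by rewrite divr_gt0.
have [K [pi [G [mpi QG]]]] := aE _ e20.
have [K' [pi' [G' [mpi' QG']]]] := aF _ e20.
pose G2 (s : seq (K * K')) := G (unzip1 s) || G' (unzip2 s).
exists (K * K')%type, (fun x => (pi x, pi' x)), G2; split.
  exact: finite_rv_pair.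
have m1 := measurable_symdiff mE (measurable_cylinder G mpi).
have m2 := measurable_symdiff mF (measurable_cylinder G' mpi').
apply: (@le_trans _ _ (Q (symdiff E (cylinder pi G) `|` symdiff F (cylinder pi' G')))).
  apply: le_measure; rewrite ?inE.
  - apply: measurable_symdiff; first exact: measurableU.
    apply: measurable_cylinder; exact: finite_rv_pair.
  - exact: measurableU.
  move=> x; rewrite /symdiff /cylinder /G2 /= /unzip1 /unzip2 -!map_comp.
  rewrite (_ : map (fst \o _) _ = map pi x)// (_ : map (snd \o _) _ = map pi' x)//.
  have tt : true by []. have ff : ~ false by [].
  case: (G _); case: (G' _) => /=;
    have [Ex|Ex] := pselect (E x); have [Fx|Fx] := pselect (F x); tauto.
apply: (le_trans (measureU2 Q m1 m2)).
by rewrite (splitr eps) EFinD leeD.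
Qed.

(** The union minus its finite part [V n] decreases to the empty set, so half of [eps] pays for the
    remainder and half for approximating [V n]. *)
Lemma approx_set_bigcup (F : (set (m.-tuple S))^nat) :
  (forall i, approx_set (F i)) -> approx_set (\bigcup_i F i).
Proof.
move=> aF.
have mF i : measurable (F i) by have [] := aF i.
have mU : measurable (\bigcup_i F i) by exact: bigcupT_measurable.
split=> // eps e0; have e20 : 0 < eps / 2 by rewrite divr_gt0.
pose V n := \big[setU/set0]_(i < n) F i.
have aV n : approx_set (V n).
  rewrite /V; elim: n => [|n IH]; last by rewrite big_ord_recr; exact: approx_setU.
  rewrite big_ord0; split => // e /ltW e0'; exists unit, (fun=> tt), pred0; split.
    move=> []; rewrite (_ : _ @^-1` _ = setT)//; by apply/seteqP; split.
  rewrite (_ : symdiff _ _ = set0) ?measure0//.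
  by apply/seteqP; split => // x [[]|[]].
have mV n : measurable (V n) by have [] := aV n.
have cvgD : Q ((\bigcup_i F i) `\` V n) @[n --> \oo] --> 0%E.
  rewrite -(measure0 Q).
  have -> : set0 = \bigcap_n ((\bigcup_i F i) `\` V n).
    apply/seteqP; split=> // x H.
    have [[i _ Fx] _] := H 0%N I.
    have [_] := H i.+1 I; apply; rewrite /V -bigcup_mkord; exists i => //=.
  apply: nonincreasing_cvg_mu.
  - by rewrite (le_lt_trans (probability_le1 Q (measurableD mU (mV 0%N))))// ltry.
  - by move=> n; exact: measurableD.
  - by apply: bigcapT_measurable => n; exact: measurableD.
  move=> n n' nn'; apply/subsetPset; apply: setDS.
  rewrite /V -!bigcup_mkord; apply: bigcup_sub => i /= ni x Fx.
  by exists i => //=; exact: leq_trans nn'.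
have [n Qn] : exists n, (Q ((\bigcup_i F i) `\` V n) <= (eps / 2)%:E)%E.
  by have [n _ /(_ n (leqnn n)) /ltW H] := cvge0_lt cvgD e20; exists n.
have [K [pi [G [mpi QG]]]] := (proj2 (aV n)) _ e20.
exists K, pi, G; split => //.
have m1 : measurable ((\bigcup_i F i) `\` V n) by exact: measurableD.
have m2 := measurable_symdiff (mV n) (measurable_cylinder G mpi).
apply: (@le_trans _ _ (Q (((\bigcup_i F i) `\` V n) `|` symdiff (V n) (cylinder pi G)))).
  apply: le_measure; rewrite ?inE.
  - apply: measurable_symdiff => //; exact: measurable_cylinder.
  - exact: measurableU.
  have VU : V n `<=` \bigcup_i F i.
    by rewrite /V -bigcup_mkord; apply: bigcup_sub => i _ x Fx; exists i.
  move=> x [[Ux nG]|[Gx nU]].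
    by have [Vx|Vx] := pselect (V n x); [right; left|left].
  by right; right; split => // /VU.
apply: (le_trans (measureU2 Q m1 m2)).
by rewrite (splitr eps) EFinD leeD.
Qed.

(** The approximable sets form a sigma-algebra. A generator, which constrains one coordinate to lie
    in [C], is itself a cylinder for the labelling by membership in [C]. *)
Lemma approx_set_measurable E : measurable E -> approx_set E.
Proof.
suff : <<s \big[setU/set0]_(i < m) preimage_set_system setT (@tnth m S ^~ i) measurable >>
    `<=` approx_set by apply.
apply: smallest_sub.
  split.
  - have := @approx_set_bigcup (fun=> set0).
    rewrite (_ : \bigcup_i _ = set0); last by apply/seteqP; split => // x [].
    apply=> _; split => // e /ltW e0; exists unit, (fun=> tt), pred0; split.
      move=> []; rewrite (_ : _ @^-1` _ = setT)//; by apply/seteqP; split.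
    rewrite (_ : symdiff _ _ = set0) ?measure0//.
    by apply/seteqP; split => // x [[]|[]].
  - by move=> A aA; rewrite setTD; exact: approx_setC.
  - exact: approx_set_bigcup.
rewrite -bigcup_seq => _ [k _ [C mC <-]]; rewrite setTI.
split; first by rewrite -[X in measurable X]setTI; exact: measurable_tnth.
move=> eps /ltW e0; exists bool, (fun x => x \in C), (fun s => nth false s k); split.
  exact: finite_rv_mem.
rewrite (_ : symdiff _ _ = set0) ?measure0//.
apply/seteqP; split => // x.
have xk : (k < size x)%N by rewrite size_tuple.
rewrite /symdiff /cylinder /=; rewrite (nth_map (tnth x k))// -tnth_nth.
case=> -[H1 H2]; first by apply: H2; exact: mem_set.
by apply: H2; exact: set_mem.
Qed.

Variable q : R.
Hypothesis q_gt0 : 0 < q.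

Definition approx_fun (f : m.-tuple S -> B) :=
  forall eps : R, 0 < eps -> exists (K : finType) (pi : S -> K) (H : seq K -> B),
    finite_rv pi /\ (\int[Q]_x (`|f x - H (map pi x)| `^ q)%:E <= eps%:E)%E.

Lemma measurable_approx_error (f : m.-tuple S -> B) (K : finType) (pi : S -> K)
    (H : seq K -> B) : finite_rv pi ->
  measurable_fun setT (f : m.-tuple S -> borel B) ->
  measurable_fun setT (fun x => (`|f x - H (map pi x)| `^ q)%:E).
Proof.
move=> mpi mf; apply: (@measurable_powR_norm _ _ _ q (fun x => `|f x - H (map pi x)|)).
exact: (measurable_dist_finite_rv (fun t : m.-tuple K => H t) mf (finite_rv_map_tuple mpi)).
Qed.

Lemma approx_fun_indic E (b : B) : measurable E ->
  approx_fun (fun x => if x \in E then b else 0).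
Proof.
move=> mE eps e0.
(* The [+ 1] keeps the division by this number legitimate when [b = 0]. *)
have bq0 : 0 < `|b| `^ q + 1 by rewrite ltr_wpDl ?powR_ge0.
have [_ /(_ (eps / (`|b| `^ q + 1)) (divr_gt0 e0 bq0))] := approx_set_measurable mE.
move=> [K [pi [G [mpi QG]]]].
exists K, pi, (fun s => if G s then b else 0); split => //.
have mD := measurable_symdiff mE (measurable_cylinder G mpi).
rewrite (_ : (fun x => _) = fun x =>
    ((`|b| `^ q)%:E * (\1_(symdiff E (cylinder pi G)) x)%:E)%E); last first.
  apply/funext => x; rewrite -EFinM indicE; congr EFin.
  have [xE|xE] := boolP (x \in E); have [Gx|Gx] := boolP (G (map pi x)).
  - rewrite subrr normr0 powR0 ?gt_eqF// memNset ?mulr0//.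
    by rewrite /symdiff /cylinder /=; move/set_mem in xE; tauto.
  - rewrite subr0 mem_set ?mulr1//.
    by left; split; [exact: set_mem|exact/negP].
  - rewrite sub0r normrN mem_set ?mulr1//.
    by right; split => // /mem_set; exact/negP.
  - rewrite subrr normr0 powR0 ?gt_eqF// memNset ?mulr0//.
    move=> [[/mem_set Ex _]|[Gx' _]]; [exact: (negP xE)|exact: (negP Gx)].
rewrite ge0_integralZl_EFin ?powR_ge0//; last first.
  by apply/measurable_EFinP; exact: measurable_indic.
rewrite integral_indic// setIT.
apply: (@le_trans _ _ ((`|b| `^ q)%:E * (eps / (`|b| `^ q + 1))%:E)%E).
  by rewrite lee_wpmul2l// lee_fin powR_ge0.
rewrite -EFinM lee_fin mulrCA ger_pMr// ler_pdivrMr// mul1r.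
by rewrite lerDl.
Qed.

Lemma approx_funD f g :
  measurable_fun setT (f : m.-tuple S -> borel B) ->
  measurable_fun setT (g : m.-tuple S -> borel B) ->
  approx_fun f -> approx_fun g -> approx_fun (f \+ g).
Proof.
move=> mf mg af ag eps e0.
have t0 : 0 < 2 `^ q :> R by rewrite powR_gt0.
have e'0 : 0 < eps / 2 / 2 `^ q by rewrite !divr_gt0.
have [K [pi [H [mpi HH]]]] := af _ e'0.
have [K' [pi' [H' [mpi' HH']]]] := ag _ e'0.
exists (K * K')%type, (fun x => (pi x, pi' x)), (fun s => H (unzip1 s) + H' (unzip2 s)).
split; first exact: finite_rv_pair.
have m1 := measurable_approx_error H mpi mf.
have m2 := measurable_approx_error H' mpi' mg.
apply: (@le_trans _ _ (\int[Q]_x ((2 `^ q)%:E *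
   ((`|f x - H (map pi x)| `^ q)%:E + (`|g x - H' (map pi' x)| `^ q)%:E)))%E).
  apply: ge0_le_integral_nomeas => x; first by rewrite lee_fin powR_ge0.
  rewrite -EFinD -EFinM lee_fin.
  apply: le_trans (powR_addr_le (ltW q_gt0) (normr_ge0 _) (normr_ge0 _)).
  apply: ler_powR2r => //; first exact: ltW.
  rewrite /unzip1 /unzip2 -!map_comp.
  rewrite (_ : map (fst \o _) _ = map pi x)// (_ : map (snd \o _) _ = map pi' x)//.
  by rewrite /= opprD addrACA ler_normD.
rewrite ge0_integralZl_EFin ?powR_ge0//; last 2 first.
- by move=> x _; rewrite adde_ge0// lee_fin powR_ge0.
- exact: emeasurable_funD.
rewrite ge0_integralD//.
apply: (@le_trans _ _ ((2 `^ q)%:E * ((eps / 2 / 2 `^ q)%:E + (eps / 2 / 2 `^ q)%:E))%E).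
  by apply: lee_wpmul2l; [rewrite lee_fin powR_ge0|exact: (leeD HH HH')].
rewrite -EFinD -EFinM lee_fin le_eqVlt; apply/orP; left; apply/eqP.
by field; rewrite gt_eqF.
Qed.

End approximation.

Section approximation_limit.
Context {R : realType} {B : completeNormedModType R}.
Hypothesis B_separable : separable B.
Context {d : measure_display} {S : measurableType d} {m : nat}.
Variable Q : probability (m.-tuple S) R.
Variable q : R.
Hypothesis q_gt0 : 0 < q.

(** [e] inverts an injection of the dense set into the integers and takes the value 0 off its image,
    so a finite dense set is no special case. *)
Lemma separable_seq : exists e : nat -> B, forall x (r : R), 0 < r ->
  exists n, `|x - e n| < r.
Proof.
have [D [/countable_injP[f f_inj] dD]] := B_separable.
pose e n := xget 0 [set y | D y /\ f y = n].
have eK y : D y -> e (f y) = y.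
  move=> Dy; have [De fe] := xgetPex 0 (ex_intro (fun z => D z /\ f z = f y) y (conj Dy erefl)).
  by apply: f_inj fe; rewrite inE.
exists e => x r r0.
have [y [By Dy]] := dD (ball x r) (ex_intro _ x (ballxx x r0)) (ball_open x r).
by exists (f y); rewrite eK//; move: By; rewrite -ball_normE.
Qed.

Lemma measurable_step_sum (F : nat -> set (m.-tuple S)) (e : nat -> B) J :
  (forall j, measurable (F j)) ->
  measurable_fun setT ((fun x => \sum_(j < J) (if x \in F j then e j else 0))
    : m.-tuple S -> borel B).
Proof.
move=> mF; pose Y (x : m.-tuple S) := [tuple x \in F k | k < J].
have mY : finite_rv Y by apply: finite_rv_mktuple => k; exact: finite_rv_mem.
have := measurable_fun_finite_rv (fun t : J.-tuple bool =>
  \sum_(j < J) (if tnth t j then e j else 0)) mY.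
congr (measurable_fun _ _); apply/funext => x.
by apply: eq_bigr => j _; rewrite tnth_mktuple.
Qed.

Lemma approx_fun_sum (F : nat -> set (m.-tuple S)) (e : nat -> B) J :
  (forall j, measurable (F j)) ->
  approx_fun Q q (fun x => \sum_(j < J) (if x \in F j then e j else 0)).
Proof.
move=> mF; elim: J => [|J IH].
  have := approx_fun_indic Q q_gt0 (0 : B) measurable0.
  rewrite (_ : (fun x => _) = fun=> 0); last by apply/funext => x; case: ifP.
  rewrite (_ : (fun x => _) = fun=> 0)//.
  by apply/funext => x; rewrite big_ord0.
rewrite (_ : (fun x => _) = (fun x => \sum_(j < J) (if x \in F j then e j else 0)) \+
    (fun x => if x \in F J then e J else 0)); last first.
  by apply/funext => x; rewrite big_ord_recr.
have mI : measurable_fun setT ((fun x => if x \in F J then e J else 0) : m.-tuple S -> borel B).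
  exact: (measurable_fun_finite_rv (fun b : bool => if b then e J else 0)
    (finite_rv_mem (mF J))).
apply: (approx_funD q_gt0 _ mI IH (approx_fun_indic Q q_gt0 (e J) (mF J))).
exact: measurable_step_sum.
Qed.

(** The space is cut into the cells where [e j] is the first point of the dense sequence within
    [delta] of [h x]. Keeping J cells gives a step function s, equal to 0 elsewhere; the mass of h
    left outside tends to 0 by dominated convergence, and s is approximable as a finite sum of
    indicators. *)
Lemma approx_fun_integrable (h : m.-tuple S -> B) :
  measurable_fun setT (h : m.-tuple S -> borel B) ->
  (\int[Q]_x (`|h x| `^ q)%:E < +oo)%E -> approx_fun Q q h.
Proof.
move=> mh hfin eps e0.
have [e edense] := separable_seq.
have t0 : 0 < 2 `^ q :> R by rewrite powR_gt0.
(* Three errors of size [eps'] occur, from the cells, the tail and the approximation of s;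
   multiplied by [2^q] they add up to [3/4] of [eps]. *)
pose eps' := eps / 2 `^ q / 4.
have e'0 : 0 < eps' by rewrite !divr_gt0.
pose delta := eps' `^ q^-1.
have d0 : 0 < delta by rewrite powR_gt0.
have dq : delta `^ q = eps'.
  by rewrite -powRrM mulVf ?gt_eqF// powRr1// ltW.
pose E j := [set x | `|h x - e j| < delta].
have mE j : measurable (E j).
  have := @measurable_normB _ _ _ _ h (e j) mh measurableT _ (measurable_itv `]-oo, delta[).
  rewrite setTI (_ : _ @^-1` _ = E j)//.
pose F := seqDU E.
have mF j : measurable (F j).
  apply: measurableD => //; exact: bigsetU_measurable.
have trivF : trivIset setT F by exact: trivIset_seqDU.
have UF : \bigcup_j F j = setT.
  rewrite -seqDU_bigcup_eq; apply/seteqP; split=> // x _.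
  by have [n hn] := edense (h x) _ d0; exists n.
pose V J := \big[setU/set0]_(j < J) F j.
have mV J : measurable (V J) by exact: bigsetU_measurable.
have mhq : measurable_fun setT (fun x => (`|h x| `^ q)%:E).
  apply: (@measurable_powR_norm _ _ _ q (fun x => `|h x|)).
  have := @measurable_normB _ _ _ _ h 0 mh.
  by congr measurable_fun; apply/funext => x; rewrite subr0.
have ihq : Q.-integrable setT (fun x => (`|h x| `^ q)%:E).
  apply/integrableP; split => //.
  apply: le_lt_trans hfin; apply: ge0_le_integral_nomeas => // x.
  by rewrite gee0_abs// lee_fin powR_ge0.
pose tail J x := ((`|h x| `^ q)%:E * (\1_(~` V J) x)%:E)%E.
have mtail J : measurable_fun setT (tail J).
  apply: emeasurable_funM => //; apply/measurable_EFinP.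
  by apply: measurable_indic; exact: measurableC.
have tail0 J x : (0 <= tail J x)%E.
  by rewrite /tail -EFinM lee_fin mulr_ge0 ?powR_ge0.
have cvg_tail : (\int[Q]_x tail J x)%E @[J --> \oo] --> 0%E.
  have -> : 0%E = (\int[Q]_x (cst 0%E x))%E by rewrite integral0.
  apply: (@dominated_cvg _ _ _ Q setT measurableT tail (cst 0%E)
    (fun x => (`|h x| `^ q)%:E)) => //.
    move=> x _; have [j _ Fx] : (\bigcup_j F j) x by rewrite UF.
    apply: cvg_near_cst; exists j.+1 => // J /= jJ.
    rewrite /tail indicE memNset ?mule0// => /=; apply.
    by rewrite /V -bigcup_mkord; exists j.
  move=> J x _; rewrite gee0_abs// /tail -EFinM lee_fin ler_piMr ?powR_ge0//.
have [J HJ] : exists J, (\int[Q]_x (tail J x) <= eps'%:E)%E.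
  by have [J _ /(_ J (leqnn J)) /ltW H] := cvge0_lt cvg_tail e'0; exists J.
pose s x := \sum_(j < J) (if x \in F j then e j else 0).
have [K [pi [H [mpi HH]]]] := approx_fun_sum e J mF e'0.
have ms : measurable_fun setT (s : m.-tuple S -> borel B).
  exact: measurable_step_sum.
have hs x : `|h x - s x| `^ q <= eps' + fine (tail J x).
  have [Vx|Vx] := pselect (V J x).
    have [j /= jJ Fjx] : (\bigcup_(j < J) F j) x by rewrite bigcup_mkord.
    have -> : s x = e j.
      rewrite /s (bigD1 (Ordinal jJ))//= mem_set// big1 ?addr0// => i ij.
      case: ifPn => // /set_mem Fix; case/eqP: ij; apply: val_inj => /=.
      by apply: (trivF i j I I); exists x.
    rewrite -[leLHS]addr0 lerD ?fine_ge0// -dq.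
    apply: ler_powR2r => //; first exact: ltW.
    by case: Fjx => /ltW.
  have -> : s x = 0.
    rewrite /s big1// => j _; case: ifPn => // /set_mem Fjx.
    by exfalso; apply: Vx; rewrite /V -bigcup_mkord; exists j => /=.
  rewrite subr0 /tail indicE mem_set// mule1 /=.
  by rewrite lerDr ltW.
exists K, pi, H; split => //.
have mHs := measurable_approx_error q H mpi ms.
apply: (@le_trans _ _ (\int[Q]_x ((2 `^ q)%:E *
   ((eps'%:E + tail J x) + (`|s x - H (map pi x)| `^ q)%:E)))%E).
  apply: ge0_le_integral_nomeas => x; first by rewrite lee_fin powR_ge0.
  have tfin : tail J x \is a fin_num by [].
  rewrite -(fineK tfin) -!EFinD -EFinM lee_fin.
  apply: (@le_trans _ _ (2 `^ q * (`|h x - s x| `^ q + `|s x - H (map pi x)| `^ q))).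
    apply: le_trans (powR_addr_le (ltW q_gt0) (normr_ge0 _) (normr_ge0 _)).
    apply: ler_powR2r => //; first exact: ltW.
    by rewrite -[X in `|X| <= _](subrKA (s x)) ler_normD.
  by rewrite ler_wpM2l ?powR_ge0// lerD2r.
rewrite ge0_integralZl_EFin ?powR_ge0//; last 2 first.
- by move=> x _; rewrite !adde_ge0// lee_fin ltW.
- apply: emeasurable_funD => //; exact: emeasurable_funD.
rewrite ge0_integralD//; last 2 first.
- by move=> x _; rewrite adde_ge0// lee_fin ltW.
- exact: emeasurable_funD.
rewrite ge0_integralD//; last by move=> x _; rewrite lee_fin ltW.
rewrite integral_cst//= probability_setT mule1.
apply: (@le_trans _ _ ((2 `^ q)%:E * ((eps'%:E + eps'%:E) + eps'%:E))%E).
  by apply: lee_wpmul2l; [rewrite lee_fin powR_ge0|rewrite !leeD].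
rewrite -!EFinD -EFinM lee_fin /eps'.
rewrite [leLHS](_ : _ = eps * (3 / 4)); last by field; rewrite gt_eqF.
by rewrite ger_pMr//; lra.
Qed.

End approximation_limit.

(** * Degenerate kernels *)

Section bochner.
Context {R : realType} {B : completeNormedModType R}.
Context {d : measure_display} {T : measurableType d} (P : probability T R).

Definition finite_mean (K : finType) (X : T -> K) (F : K -> B) : B :=
  \sum_k fine (P (X @^-1` [set k])) *: F k.

Lemma finite_law_comp (K L : finType) (X : T -> K) (g : K -> L) l : finite_rv X ->
  fine (P ((g \o X) @^-1` [set l])) =
  \sum_k fine (P (X @^-1` [set k])) * (g k == l)%:R.
Proof.
move=> mX; have mgX := finite_rv_comp g mX.
have /= := integral_finite_rv P mX (F := fun k => (g k == l)%:R) (fun=> ler0n _ _).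
rewrite (integral_finite_rv P mgX (F := fun k => (k == l)%:R) (fun=> ler0n _ _)).
move=> -[<-]; rewrite (bigD1 l)//= eqxx mulr1 big1 ?addr0// => k /negbTE ->.
by rewrite mulr0.
Qed.

Lemma finite_mean_comp (K L : finType) (X : T -> K) (g : K -> L) (F : L -> B) :
  finite_rv X -> finite_mean (g \o X) F = finite_mean X (F \o g).
Proof.
move=> mX; rewrite /finite_mean.
under eq_bigr do rewrite (finite_law_comp _ _ mX) scaler_suml.
rewrite exchange_big; apply: eq_bigr => k _.
rewrite (bigD1 (g k))//= eqxx mulr1 big1 ?addr0// => l.
by rewrite eq_sym => /negbTE ->; rewrite mulr0 scale0r.
Qed.

Lemma simple_function_finite_rv (s : T -> B) : simple_function s ->
  exists (n : nat) (X : T -> 'I_n) (c : 'I_n -> B),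
    [/\ finite_rv X, s = c \o X & simple_integral P s = finite_mean X c].
Proof.
move=> [fs ms]; pose r := enum_fset (fset_set (range s)).
have sr w : s w \in r by rewrite /r in_fset_set// mem_set//; exists w.
have ir w : (index (s w) r < size r)%N by rewrite index_mem.
exists (size r), (fun w => Ordinal (ir w)), (fun i => r`_i).
have XE i : (fun w => Ordinal (ir w)) @^-1` [set i] = s @^-1` [set r`_i].
  apply/seteqP; split=> w; rewrite /preimage /=; first by move=> <-; rewrite nth_index.
  by move=> swi; apply: val_inj => /=; rewrite swi index_uniq// fset_uniq.
split.
- by move=> i; rewrite XE.
- by apply/funext => w /=; rewrite nth_index.
rewrite /simple_integral fsbig_finite//= -/r (big_nth 0) big_mkord.
by apply: eq_bigr => i _; rewrite XE.
Qed.

(** Both means are rewritten over the joint variable [W], where the difference can be estimated term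
    by term. *)
Lemma finite_mean_simple_integral (K : finType) (Z : T -> K) (b : K -> B) (s : T -> B) :
  finite_rv Z -> simple_function s ->
  (`|finite_mean Z b - simple_integral P s|%:E <= \int[P]_w (`|b (Z w) - s w|)%:E)%E.
Proof.
move=> mZ /simple_function_finite_rv[n [X [c [mX -> ->]]]].
have mW := finite_rv_pair mZ mX; set W := (fun w => (Z w, X w)) in mW.
have -> : finite_mean Z b = finite_mean W (b \o fst) by rewrite -(finite_mean_comp fst b mW).
have -> : finite_mean X c = finite_mean W (c \o snd) by rewrite -(finite_mean_comp snd c mW).
rewrite (integral_finite_rv P mW (F := fun k => `|b k.1 - c k.2|))//.
rewrite lee_fin /finite_mean -sumrB (le_trans (ler_norm_sum _ _ _))//.
apply: ler_sum => k _; rewrite -scalerBr normrZ ger0_norm//.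
exact: fine_ge0.
Qed.

Lemma measurable_dist_simple (X : T -> B) (s : T -> B) :
  measurable_fun setT (X : T -> borel B) -> simple_function s ->
  measurable_fun setT (fun w => (`|X w - s w|)%:E).
Proof.
move=> mX /simple_function_finite_rv[n [Y [c [mY -> _]]]].
apply/measurable_EFinP; exact: (measurable_dist_finite_rv c mX mY).
Qed.

(** All that is used of the Bochner integral passes through this comparison, so neither its
    linearity nor its uniqueness has to be developed. It is the previous lemma in the limit along
    the simple functions. *)
Lemma bochner_integral_dist (K : finType) (Z : T -> K) (b : K -> B) (X : T -> B) v :
  finite_rv Z -> is_bochner_integral P X v ->
  (`|finite_mean Z b - v|%:E <= \int[P]_w (`|b (Z w) - X w|)%:E)%E.
Proof.
move=> mZ [mX [s [simple_s cvg_s cvg_v]]].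
apply/lee_addgt0Pr => e e0; have e20 : 0 < e / 2 by rewrite divr_gt0.
have H1 := cvge0_lt cvg_s e20.
have H2 : \forall n \near \oo, `|simple_integral P (s n) - v| < e / 2.
  by move/cvgrPdist_lt : cvg_v => /(_ _ e20); apply: filterS => n; rewrite distrC.
have [n [/ltW Hn1 /ltW Hn2]] := filter_ex (filterI H1 H2).
have mXs := measurable_dist_simple mX (simple_s n).
have mZX : measurable_fun setT (fun w => (`|b (Z w) - X w|)%:E).
  apply/measurable_EFinP; under eq_fun do rewrite distrC.
  exact: (measurable_dist_finite_rv b mX mZ).
have tri : (\int[P]_w (`|b (Z w) - s n w|)%:E <=
    \int[P]_w (`|b (Z w) - X w|)%:E + \int[P]_w (`|X w - s n w|)%:E)%E.
  rewrite -ge0_integralD//.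
  apply: ge0_le_integral_nomeas => // w.
  by rewrite -EFinD lee_fin -[X in `|X| <= _](subrKA (X w)) ler_normD.
have := finite_mean_simple_integral b mZ (simple_s n).
move=> /le_trans/(_ tri)/le_trans/(_ (leeD (lexx _) Hn1)) main.
apply: (@le_trans _ _ (`|finite_mean Z b - simple_integral P (s n)|%:E + (e / 2)%:E)%E).
  rewrite -EFinD lee_fin.
  rewrite -[X in `|X| <= _](subrKA (simple_integral P (s n))).
  by rewrite (le_trans (ler_normD _ _))// lerD2l.
by apply: (le_trans (leeD main (lexx _))); rewrite -addeA -EFinD -splitr.
Qed.

(** Comparison with the constant variable 0, from which [X] is at distance 0 in the mean. *)
Lemma bochner_integral_ae0 (X : T -> B) v : is_bochner_integral P X v ->
  {ae P, forall w, X w = 0} -> v = 0.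
Proof.
move=> bX X0.
have mZ : finite_rv (fun _ : T => tt).
  by move=> []; rewrite (_ : _ @^-1` _ = setT)//; apply/seteqP; split.
have := bochner_integral_dist (fun=> 0) mZ bX.
rewrite /finite_mean big1 ?sub0r ?normrN; last by move=> k _; rewrite scaler0.
under eq_integral do rewrite sub0r normrN.
rewrite (ge0_ae_eq_integral (g := cst 0%E) measurableT)//.
- by rewrite integral0 lee_fin normr_le0 => /eqP.
- apply/measurable_EFinP; have := @measurable_normB _ _ _ _ X 0 (proj1 bX).
  by under eq_fun do rewrite subr0.
- by apply: filterS X0 => w -> _; rewrite normr0.
Qed.

End bochner.

Lemma mean_cat {R : realType} {B : lmodType R} {K : finType} (w : K -> R) c k
    (F : seq K -> B) :
  mean w c (fun s => mean w k (fun t => F (s ++ t))) = mean w (c + k) F.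
Proof.
elim: c F => [|c IH] F; first by rewrite mean0.
by rewrite addSn !meanS; apply: eq_bigr => x _; rewrite -IH.
Qed.

(* Conditional Jensen inequality on the event [A] of probability [a], proved by
   integrating Young's inequality so that no integrability is required. *)
Lemma conditional_jensen d (T : measurableType d) (R : realType) (P : probability T R)
    (A : set T) (f : T -> R) (q a b : R) : 1 <= q -> measurable A ->
  measurable_fun setT f -> (forall w, 0 <= f w) -> P A = a%:E -> 0 <= b ->
  ((a * b)%:E <= \int[P]_w (\1_A w * f w)%:E)%E ->
  ((a * b `^ q)%:E <= \int[P]_w (\1_A w * f w `^ q)%:E)%E.
Proof.
move=> q1 mA mf f0 PA b0 ab.
have q0 : 0 < q by exact: lt_le_trans q1.
have m1 : measurable_fun setT (\1_A : T -> R) by exact: measurable_indic.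
have mAf : measurable_fun setT (fun w => (\1_A w * f w)%:E).
  by apply/measurable_EFinP; exact: measurable_funM.
have mAfq : measurable_fun setT (fun w => (\1_A w * f w `^ q)%:E).
  apply/measurable_EFinP; apply: measurable_funM => //.
  exact: (measurableT_comp (measurable_powR q) mf).
have i0 w : 0 <= \1_A w :> R by [].
have ca0 : 0 <= q * b `^ (q - 1) by rewrite mulr_ge0 ?powR_ge0// ltW.
have cb0 : 0 <= (q - 1) * b `^ q by rewrite mulr_ge0 ?powR_ge0// subr_ge0.
have H : ((q * b `^ (q - 1))%:E * \int[P]_w (\1_A w * f w)%:E <=
    \int[P]_w (\1_A w * f w `^ q)%:E + ((q - 1) * b `^ q)%:E * a%:E)%E.
  rewrite -ge0_integralZl_EFin//; last by move=> w _; rewrite lee_fin mulr_ge0.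
  have -> : (((q - 1) * b `^ q)%:E * a%:E =
      \int[P]_w (((q - 1) * b `^ q)%:E * (\1_A w)%:E))%E.
    rewrite ge0_integralZl_EFin//; last by apply/measurable_EFinP.
    by rewrite integral_indic// setIT -PA.
  rewrite -ge0_integralD//.
  - apply: ge0_le_integral_nomeas => w.
      by rewrite -EFinM lee_fin; exact: mulr_ge0 ca0 (mulr_ge0 (i0 w) (f0 w)).
    rewrite -!EFinM -EFinD lee_fin.
    have := ler_wpM2l (i0 w) (powR_young q1 (f0 w) b0).
    by move: (b `^ (q - 1)) (b `^ q) (f w `^ q) => *; lra.
  - by move=> w _; rewrite lee_fin mulr_ge0 ?powR_ge0.
  - by move=> w _; rewrite -EFinM lee_fin; exact: mulr_ge0 cb0 (i0 w).
  - by apply: emeasurable_funM => //; apply/measurable_EFinP.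
have := le_trans (lee_wpmul2l (_ : 0 <= (q * b `^ (q - 1))%:E)%E ab) H.
move=> /(_ ca0); case: (\int[P]_w (\1_A w * f w `^ q)%:E)%E => [x| |] //.
  rewrite -!EFinM -EFinD !lee_fin => K.
  have bE : b * b `^ (q - 1) = b `^ q by rewrite mulr_powRB1.
  have : q * b `^ (q - 1) * (a * b) = q * (a * b `^ q) by rewrite -bE; ring.
  by lra.
by move=> _; rewrite leey.
Qed.

Section degenerate_bound.
Context {R : realType} {B : completeNormedModType R}.
Context {dT : measure_display} {T : measurableType dT} {P : probability T R}.
Context {dS : measure_display} {S : measurableType dS}.
Variable xi : int -> {RV P >-> S}.
Hypothesis iid_xi : iid xi.
Variables (m : nat) (q : R).
Hypothesis q_ge1 : 1 <= q.

Let q_gt0 : 0 < q. Proof. exact: lt_le_trans q_ge1. Qed.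

Definition first_ints : seq int := [seq j.+1%:Z | j <- iota 0 m].

Lemma map_xi_first (K : Type) (pi : S -> K) w :
  map pi (xi_first xi m w) = [seq pi (xi j w) | j <- first_ints].
Proof.
rewrite /first_ints -map_comp -val_enum_ord -map_comp /= -map_comp.
by apply: eq_map => k.
Qed.

Lemma first_ints_uniq : uniq first_ints.
Proof. by rewrite map_inj_uniq ?iota_uniq// => i j []. Qed.

Definition first_tuple : m.-tuple int := [tuple (k : nat).+1%:Z | k < m].

Lemma val_first_tuple : val first_tuple = first_ints.
Proof. by rewrite /= /first_ints -val_enum_ord -map_comp. Qed.

Lemma xi_first_tupleX w : xi_first xi m w = tupleX xi first_tuple w.
Proof. by apply: eq_from_tnth => k; rewrite !tnth_mktuple. Qed.

Lemma measurable_h_xi_first (h : m.-tuple S -> B) :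
  measurable_fun setT (h : m.-tuple S -> borel B) ->
  measurable_fun setT ((fun w => h (xi_first xi m w)) : T -> borel B).
Proof.
move=> mh; have := measurableT_comp mh (measurable_tupleX xi first_tuple).
by congr measurable_fun; apply/funext => w /=; rewrite xi_first_tupleX.
Qed.

Section fixed_partition.
Context {K : finType}.
Variables (pi : S -> K) (h : m.-tuple S -> B) (H : seq K -> B).
Hypothesis mpi : finite_rv pi.
Hypothesis mh : measurable_fun setT (h : m.-tuple S -> borel B).

Definition first_rv w : m.-tuple K := map_tuple pi (xi_first xi m w).

Lemma finite_first_rv : finite_rv first_rv.
Proof.
move=> t; rewrite (_ : _ @^-1` _ = [set w | [seq pi (xi j w) | j <- first_ints] = t]).
  exact: measurable_joint.
apply/seteqP; split=> w; rewrite /preimage /= -map_xi_first.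
  by move=> <-.
by move=> e; apply: val_inj.
Qed.

Lemma law_first_rv t : P (first_rv @^-1` [set t]) =
  (\prod_(x <- t) law_weight xi pi 0 x)%:E.
Proof.
rewrite -(joint_law iid_xi mpi 0 first_ints_uniq); last first.
  by rewrite size_tuple size_map size_iota.
congr (P _); apply/seteqP; split=> w; rewrite /preimage /= -map_xi_first.
  by move=> <-.
by move=> e; apply: val_inj.
Qed.

Lemma expect_first_rv (F : seq K -> R) : (forall t, 0 <= F t) ->
  (\int[P]_w (F (map pi (xi_first xi m w)))%:E =
   (expect (law_weight xi pi 0) m F)%:E)%E.
Proof.
move=> F0; rewrite (integral_finite_rv P finite_first_rv (F := F \o val) (fun t => F0 t)).
by congr EFin; apply: eq_bigr => t _; rewrite law_first_rv.
Qed.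

Lemma mean_first_rv (F : seq K -> B) :
  finite_mean P first_rv (F \o val) = mean (law_weight xi pi 0) m F.
Proof. by apply: eq_bigr => t _; rewrite law_first_rv. Qed.

Let err w := `|h (xi_first xi m w) - H (map pi (xi_first xi m w))|.

Lemma measurable_err : measurable_fun setT err.
Proof.
exact: (measurable_dist_finite_rv (fun t : m.-tuple K => H t)
  (measurable_h_xi_first mh) finite_first_rv).
Qed.

Let cell c (s : seq K) := [set w | [seq pi (xi j.+1%:Z w) | j <- iota 0 c] = s].

(** From [c < d] follows [c <= d.-1]: fixing the labels of c observations is an event of the
    sigma-algebra given which h has conditional expectation 0. *)
Lemma sigma_first_cell c d s : (c < d)%N -> sigma_first xi d.-1 (cell c s).
Proof.
move=> cd; have cd' : (c <= d.-1)%N by case: d cd.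
have := sigma_family_joint (X := fun j : 'I_d.-1 => xi j.+1%:Z) mpi (take c (enum 'I_d.-1)) s.
congr (sigma_family _ _); apply/seteqP; rewrite /cell.
suff E w : [seq pi (xi j.+1%:Z w) | j <- iota 0 c] =
    [seq pi (xi (nat_of_ord i).+1%:Z w) | i <- take c (enum 'I_d.-1)].
  by split=> w /=; rewrite E.
have -> : iota 0 c = map val (take c (enum 'I_d.-1)).
  by rewrite map_take val_enum_ord take_iota (minn_idPl cd').
by rewrite -map_comp.
Qed.

Lemma measurable_cell c s : measurable (cell c s).
Proof.
have := measurable_joint xi mpi [seq j.+1%:Z | j <- iota 0 c] s.
by congr measurable; apply/seteqP; split=> w; rewrite /cell /= -map_comp.
Qed.

Lemma law_cell c (s : seq K) : size s = c ->
  P (cell c s) = (\prod_(x <- s) law_weight xi pi 0 x)%:E.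
Proof.
move=> sc; rewrite -(joint_law iid_xi mpi 0 (es := [seq j.+1%:Z | j <- iota 0 c])).
- by congr (P _); apply/seteqP; split=> w; rewrite /cell /= -map_comp.
- by rewrite map_inj_uniq ?iota_uniq// => i j [].
- by rewrite size_map size_iota.
Qed.

Lemma cell_first_rv c s w : (c <= m)%N ->
  (take c (map pi (xi_first xi m w)) == s) = (w \in cell c s).
Proof.
move=> cm; have -> : take c (map pi (xi_first xi m w)) =
    [seq pi (xi j.+1%:Z w) | j <- iota 0 c].
  by rewrite map_xi_first /first_ints -map_comp -map_take take_iota (minn_idPl cm).
apply/eqP/idP => [e|]; first by rewrite mem_set.
by move/set_mem.
Qed.

Lemma mean_cell c (s : c.-tuple K) : (c <= m)%N ->
  mean (law_weight xi pi 0) m (fun t => if take c t == s then H t else 0) =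
  (\prod_(x <- s) law_weight xi pi 0 x) *:
    mean (law_weight xi pi 0) (m - c) (fun t => H (s ++ t)).
Proof.
move=> cm; rewrite -[X in mean _ X _ = _](subnKC cm) -mean_cat {1}/mean.
rewrite (bigD1 s)//= [X in _ + X]big1 ?addr0 => [|s' s's].
  congr (_ *: _); apply: eq_bigr => t _.
  by rewrite take_cat size_tuple ltnn subnn take0 cats0 eqxx.
rewrite (_ : mean _ _ _ = 0) ?scaler0// /mean big1// => t _.
rewrite take_cat size_tuple ltnn subnn take0 cats0.
by rewrite ifN ?scaler0//; apply: contra s's => /eqP /val_inj ->.
Qed.

(** On a cell that fixes the first c labels, h integrates to 0, so the norm of the integral of [H]
    is at most the integral of [err] over the cell. Conditional Jensen raises this to the power q,
    and the cells are disjoint. *)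
Lemma cond_moment_degenerate d c : degenerate_of_order xi h d ->
  (c < d)%N -> (c <= m)%N ->
  ((cond_moment Num.norm q (law_weight xi pi 0) m c H)%:E <=
   \int[P]_w (`|h (xi_first xi m w) - H (map pi (xi_first xi m w))| `^ q)%:E)%E.
Proof.
move=> [[Y [[_ condY] Y0]] _] cd cm; set wt := law_weight xi pi 0.
have merr := measurable_err.
pose A (s : c.-tuple K) := cell c s.
have mA s : measurable (A s) by exact: measurable_cell.
have step (s : c.-tuple K) :
    (((\prod_(x <- s) wt x) * `|mean wt (m - c) (fun t => H (s ++ t))| `^ q)%:E <=
     \int[P]_w (\1_(A s) w * err w `^ q)%:E)%E.
  apply: conditional_jensen => //; first by move=> w; exact: normr_ge0.
    by rewrite law_cell// size_tuple.
  (* Over the cell, h and the version [Y] share the integral [v], which vanishes as [Y] is 0 almost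
     everywhere. *)
  have [v [bv bY]] := condY _ (sigma_first_cell s cd).
  have {bY} v0 : v = 0.
    apply: (bochner_integral_ae0 bY).
    by apply: filterS Y0 => w ->; rewrite scaler0.
  rewrite v0 in bv.
  (* [H] cut off outside the cell; its finite mean is the weight of s times the mean of [H] given
     s. *)
  pose b (t : m.-tuple K) := if take c t == s then H t else 0.
  have := bochner_integral_dist b finite_first_rv bv.
  rewrite subr0 (mean_first_rv (fun t => if take c t == s then H t else 0)) mean_cell//.
  rewrite normrZ ger0_norm; last first.
    by apply: prodr_ge0 => x _; exact: fine_ge0.
  move=> /le_trans; apply; apply: ge0_le_integral_nomeas => // w.
  rewrite lee_fin /b /first_rv /= cell_first_rv// indicE -/(A s).
  case: (w \in A s); first by rewrite scale1r mul1r /err distrC.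
  by rewrite scale0r mul0r subrr normr0.
rewrite /cond_moment /expect -sumEFin.
apply: (@le_trans _ _ (\sum_(s : c.-tuple K) \int[P]_w (\1_(A s) w * err w `^ q)%:E)%E).
  by apply: lee_sum => s _; exact: step.
rewrite -ge0_integral_sum//; last 2 first.
- move=> s; apply/measurable_EFinP; apply: measurable_funM.
    exact: measurable_indic.
  exact: (measurableT_comp (measurable_powR q) merr).
- by move=> s w _; rewrite lee_fin mulr_ge0 ?powR_ge0.
apply: ge0_le_integral_nomeas => w.
  by apply: sume_ge0 => s _; rewrite lee_fin mulr_ge0 ?powR_ge0.
have szw : size (take c (map pi (xi_first xi m w))) == c.
  by rewrite size_takel// size_map size_tuple.
rewrite sumEFin lee_fin (bigD1 (Tuple szw))//= big1 ?addr0 => [|s sw].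
  by rewrite ler_piMl ?powR_ge0// indicE; case: (_ \in _).
rewrite indicE -(cell_first_rv _ _ cm) (_ : (_ == _) = false) ?mul0r//.
by apply: contraNF sw => /eqP sE; apply/eqP/val_inj; rewrite /= sE.
Qed.

End fixed_partition.

End degenerate_bound.

Lemma is_norm_normr (R : realType) (B : completeNormedModType R) :
  is_norm (Num.norm : B -> R).
Proof.
split; [exact: ler_normD|exact: normrZ|].
by move=> x /eqP; rewrite normr_eq0 => /eqP.
Qed.

(** Each [y i] is at most [(\sum_i y i ^ q)^(1/q)]. The crude constant does no harm, since it will
    multiply an approximation error only. *)
Lemma sum_powR_le (R : realType) (I : finType) (y : I -> R) q : 0 < q ->
  (forall i, 0 <= y i) -> (\sum_i y i) `^ q <= #|I|%:R `^ q * \sum_i y i `^ q.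
Proof.
move=> q0 y0; set Y := \sum_i y i `^ q.
have Y0 : 0 <= Y by apply: sumr_ge0 => i _; exact: powR_ge0.
have yY i : y i <= Y `^ q^-1.
  have -> : y i = (y i `^ q) `^ q^-1 by rewrite -powRrM mulfV ?gt_eqF// powRr1.
  apply: ler_powR2r; rewrite ?invr_ge0 ?powR_ge0 ?(ltW q0)//.
  by rewrite /Y (bigD1 i)//= lerDl sumr_ge0// => j _; exact: powR_ge0.
have -> : Y = (Y `^ q^-1) `^ q by rewrite -powRrM mulVf ?gt_eqF// powRr1.
rewrite -powRM ?powR_ge0//.
apply: ler_powR2r; [exact: ltW|exact: sumr_ge0|].
rewrite mulr_natl -sumr_const; exact: ler_sum.
Qed.

Lemma weighted_sum_map {R : realType} {B : lmodType R} (I : Type) (f : bool -> R)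
    (b : I -> bool) (x : I -> B) (es : seq I) :
  weighted_sum f (map b es) (map x es) = \sum_(i <- es) f (b i) *: x i.
Proof.
rewrite /weighted_sum; elim: es => [|i es IH]; first by rewrite !big_nil.
by rewrite /= !big_cons IH.
Qed.

(** * Symmetric approximants *)

Section symmetrization.
Context {R : realType} {B : completeNormedModType R}.
Context {dT : measure_display} {T : measurableType dT} {P : probability T R}.
Context {dS : measure_display} {S : measurableType dS}.
Variable xi : int -> {RV P >-> S}.
Hypothesis iid_xi : iid xi.
Variables (m : nat) (q : R).
Hypothesis q_ge1 : 1 <= q.

Let q_gt0 : 0 < q. Proof. exact: lt_le_trans q_ge1. Qed.

(** The value 0 on lists of the wrong length makes the invariance hold for all lists, since permuted
    lists have equal length. *)
Definition symmetrize (K : finType) (H : seq K -> B) (s : seq K) : B :=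
  if insub s is Some t then
    \sum_(sigma : 'S_m) m`!%:R^-1 *: H [tuple tnth (t : m.-tuple K) (sigma k) | k < m]
  else 0.

Lemma symmetrize_tuple (K : finType) (H : seq K -> B) (t : m.-tuple K) :
  symmetrize H t =
  \sum_(sigma : 'S_m) m`!%:R^-1 *: H [tuple tnth t (sigma k) | k < m].
Proof. by rewrite /symmetrize valK. Qed.

Lemma symmetrize_invariant (K : finType) (H : seq K -> B) :
  perm_invariant (symmetrize H).
Proof.
move=> s t st; have szst := perm_size st.
have [sm|sm] := eqVneq (size s) m; last first.
  by rewrite /symmetrize !insubN// -?szst.
have tm : size t == m by rewrite -szst sm.
move/eqP in sm; rewrite -[s]/(val (Tuple sm)) -[t]/(val (Tuple tm)) in st *.
have /tuple_permP[rho sE] := st.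
have {}sE : Tuple sm = [tuple tnth (Tuple tm) (rho k) | k < m] by exact: val_inj.
rewrite !symmetrize_tuple sE [RHS](reindex_inj (mulIg rho)) /=.
apply: eq_bigr => sigma _; congr (_ *: H _).
by apply: eq_map => k; rewrite tnth_mktuple permM.
Qed.

Lemma weights_perm : weights (fun _ : 'S_m => m`!%:R^-1 : R).
Proof.
split=> [_|]; first by rewrite invr_ge0.
by rewrite sumr_const card_Sn -[LHS]mulr_natr mulVf// pnatr_eq0 -lt0n fact_gt0.
Qed.

(** As h is symmetric, its distance to the average of the permuted [H] is at most the average of the
    distances; each has the same q-th moment, because a permuted i.i.d. sample has the same law. *)
Lemma approx_symmetric (h : m.-tuple S -> B) (eps : R) : separable B ->
  measurable_fun setT (h : m.-tuple S -> borel B) -> symmetric_kernel h ->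
  (\int[P]_w (`|h (xi_first xi m w)| `^ q)%:E < +oo)%E -> 0 < eps ->
  exists (K : finType) (pi : S -> K) (H : seq K -> B),
    [/\ finite_rv pi, perm_invariant H &
     (\int[P]_w (`|h (xi_first xi m w) - H (map pi (xi_first xi m w))| `^ q)%:E
       <= eps%:E)%E].
Proof.
move=> sepB mh symh hfin e0.
pose Q : probability (m.-tuple S) R := distribution P (tupleRV xi (first_tuple m)).
have QE (f : m.-tuple S -> \bar R) : measurable_fun setT f -> (forall x, 0 <= f x)%E ->
    (\int[Q]_x f x = \int[P]_w f (xi_first xi m w))%E.
  move=> mf f0; rewrite /Q ge0_integral_distribution//.
  by apply: eq_integral => w _; rewrite xi_first_tupleX.
have mhq : measurable_fun setT (fun x => (`|h x| `^ q)%:E).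
  apply: (@measurable_powR_norm _ _ _ q (fun x => `|h x|)).
  have := @measurable_normB _ _ _ _ h 0 mh.
  by under eq_fun do rewrite subr0.
have hfinQ : (\int[Q]_x (`|h x| `^ q)%:E < +oo)%E.
  by rewrite QE// => x; rewrite lee_fin powR_ge0.
have [K [pi [H [mpi HH]]]] := approx_fun_integrable sepB q_gt0 mh hfinQ e0.
exists K, pi, (symmetrize H); split => //; first exact: symmetrize_invariant.
pose phi x := (`|h x - H (map pi x)| `^ q)%:E.
have mphi : measurable_fun setT phi by exact: measurable_approx_error.
have phi0 x : (0 <= phi x)%E by rewrite lee_fin powR_ge0.
have HHP : (\int[P]_w phi (xi_first xi m w) <= eps%:E)%E.
  by rewrite -(QE phi mphi phi0); exact: HH.
pose u (sigma : 'S_m) := [tuple tnth (first_tuple m) (sigma k) | k < m].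
have uu sigma : uniq (u sigma).
  rewrite map_inj_uniq ?enum_uniq// => i j.
  by rewrite !tnth_mktuple => -[/val_inj/perm_inj].
have uniq1 : uniq (first_tuple m) by rewrite val_first_tuple first_ints_uniq.
have uE sigma w : tupleX xi (u sigma) w =
    [tuple tnth (xi_first xi m w) (sigma k) | k < m].
  by apply: eq_from_tnth => k; rewrite !tnth_mktuple.
apply: (@le_trans _ _ (\sum_(sigma : 'S_m) (m`!%:R^-1)%:E *
    \int[P]_w phi (tupleX xi (u sigma) w))%E).
  have mphiu sigma : measurable_fun setT (fun w => phi (tupleX xi (u sigma) w)).
    exact: (measurableT_comp mphi (measurable_tupleX xi (u sigma))).
  have -> : (\sum_(sigma : 'S_m) (m`!%:R^-1)%:E *
      \int[P]_w phi (tupleX xi (u sigma) w) =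
      \int[P]_w (\sum_(sigma : 'S_m) (m`!%:R^-1)%:E * phi (tupleX xi (u sigma) w)))%E.
    rewrite ge0_integral_sum//.
    - by apply: eq_bigr => sigma _; rewrite ge0_integralZl_EFin// invr_ge0.
    - by move=> sigma; apply: emeasurable_funM.
    - by move=> sigma w _; rewrite mule_ge0// lee_fin invr_ge0.
  apply: ge0_le_integral_nomeas => w; first by rewrite lee_fin powR_ge0.
  under eq_bigr do rewrite uE /phi -EFinM.
  rewrite sumEFin lee_fin.
  set x := xi_first xi m w.
  have -> : h x - symmetrize H (map pi x) = \sum_(sigma : 'S_m) m`!%:R^-1 *:
      (h [tuple tnth x (sigma k) | k < m] -
       H (map pi [tuple tnth x (sigma k) | k < m])).
    rewrite -[map pi x]/(val (map_tuple pi x)) symmetrize_tuple.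
    rewrite [RHS](eq_bigr (fun sigma : 'S_m => m`!%:R^-1 *: h x -
       m`!%:R^-1 *: H [tuple tnth (map_tuple pi x) (sigma k) | k < m])).
      by rewrite sumrB -scaler_suml (proj2 weights_perm) scale1r.
    move=> sigma _; rewrite symh scalerBr; congr (_ - _ *: H _).
    rewrite /= -map_comp; apply: eq_map => k /=; by rewrite [RHS]tnth_map.
  exact: (norm_mean_powR (is_norm_normr B) _ q_ge1 weights_perm).
apply: (@le_trans _ _ (\sum_(sigma : 'S_m) (m`!%:R^-1)%:E * eps%:E)%E).
  apply: lee_sum => sigma _; apply: lee_wpmul2l; first by rewrite lee_fin invr_ge0.
  rewrite (integral_tupleX iid_xi (uu sigma) uniq1 mphi phi0).
  apply: le_trans HHP.
  by under [leLHS]eq_integral do rewrite -xi_first_tupleX.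
under eq_bigr do rewrite -EFinM.
by rewrite sumEFin -mulr_suml (proj2 weights_perm) mul1r.
Qed.

End symmetrization.

(** * Incomplete U-statistics *)

Section bernoulli_expectation.
Context {R : realType}.
Context {dT : measure_display} {T : measurableType dT} {P : probability T R}.
Context {dS : measure_display} {S : measurableType dS}.
Context {I : choiceType}.
Variables (xi : int -> {RV P >-> S}) (a : I -> {RV P >-> R}) (pn : R).
Hypotheses (iid_xi : iid xi) (iid_a : iid a) (indep : independent_families a xi).
Hypothesis bern_a : forall i, bernoulli_rv pn (a i).

Lemma finite_rv_eq1 : finite_rv (fun x : R => x == 1).
Proof.
case.
  rewrite (_ : _ @^-1` _ = [set 1]); first exact: measurable_set1.
  by apply/seteqP; split=> x; rewrite /preimage /= => /eqP.
rewrite (_ : _ @^-1` _ = ~` [set 1]); first exact: (measurableC (measurable_set1 _)).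
apply/seteqP; split=> x; rewrite /preimage /=; first by move=> /negbT/eqP.
by move=> /eqP/negbTE.
Qed.

Lemma law_weight_bern i : law_weight a (fun x : R => x == 1) i = bern pn.
Proof.
have E1 : law_weight a (fun x : R => x == 1) i true = pn.
  rewrite /law_weight (_ : (fun x : R => x == 1) @^-1` [set true] = [set 1]).
    by have [H _] := bern_a i; rewrite -[P _]/(distribution P (a i) [set 1]) H.
  by apply/seteqP; split=> x; rewrite /preimage /= => /eqP.
apply/funext => -[] //=; rewrite /bern.
have [_] := weights_law a finite_rv_eq1 i.
by rewrite big_bool /= E1 => H; lra.
Qed.

(** Independence of the two families is tested on the events that fix a word of selectors and a word
    of labels; such events determine the whole integrand. *)
Lemma integral_bernoulli_sample (K : finType) (pi : S -> K) (n : nat) (es : seq I)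
    (F : seq bool -> seq K -> R) : finite_rv pi -> uniq es ->
  (0 < size es)%N -> (forall b s, 0 <= F b s) ->
  (\int[P]_w (F [seq a i w == 1 | i <- es] (map pi (xi_first xi n w)))%:E =
   (expect (law_weight xi pi 0) n (fun s =>
      expect (bern pn) (size es) (fun b => F b s)))%:E)%E.
Proof.
move=> mpi ues es0 F0.
have [i0 _] : exists i0, i0 \in es by case: (es) es0 => // i l _; exists i; exact: mem_head.
pose bT w := map_tuple (fun i => a i w == 1) (in_tuple es).
pose sT w := @first_rv _ _ _ P _ _ xi n K pi w.
have bTE tb : bT @^-1` [set tb] = [set w | [seq a i w == 1 | i <- es] = tb].
  apply/seteqP; split=> w; rewrite /preimage /=; first by move=> <-.
  by move=> e; apply: val_inj.
have sTE ts : sT @^-1` [set ts] = [set w | [seq pi (xi j w) | j <- first_ints n] = ts].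
  apply/seteqP; split=> w; rewrite /preimage /= -map_xi_first; first by move=> <-.
  by move=> e; apply: val_inj.
have mb : finite_rv bT.
  by move=> tb; rewrite bTE; exact: (measurable_joint a finite_rv_eq1).
have ms : finite_rv sT by exact: finite_first_rv.
have mX := finite_rv_pair mb ms.
rewrite (integral_finite_rv P mX 
  (F := fun k : (size es).-tuple bool * n.-tuple K => F k.1 k.2))//.
congr EFin.
transitivity (\sum_tb \sum_ts
    fine (P ((fun w => (bT w, sT w)) @^-1` [set (tb, ts)])) * F tb ts).
  by rewrite pair_bigA; apply: eq_bigr => -[].
rewrite exchange_big /expect; apply: eq_bigr => ts _; rewrite mulr_sumr.
apply: eq_bigr => tb _; rewrite mulrA; congr (_ * _).
rewrite (_ : _ @^-1` [set (tb, ts)] = bT @^-1` [set tb] `&` sT @^-1` [set ts]); last first.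
  by apply/seteqP; split=> w; rewrite /preimage /= => -[-> ->].
rewrite indep; [|rewrite bTE|rewrite sTE]; last 2 first.
- exact: (sigma_family_joint finite_rv_eq1).
- exact: sigma_family_joint.
rewrite fineM; [|exact: fin_num_measure|exact: fin_num_measure].
rewrite mulrC; congr (_ * _); first by rewrite law_first_rv.
rewrite bTE (joint_law iid_a finite_rv_eq1 i0 ues) ?size_tuple//=.
by rewrite law_weight_bern.
Qed.

(** Only the law of [a i] is prescribed, so other values may occur on a null set; off this set [a i]
    coincides with the indicator of [a i = 1]. *)
Lemma negligible_not_bernoulli (es : seq I) :
  P.-negligible (\big[setU/set0]_(i <- es) (a i @^-1` (~` [set 0; 1]))).
Proof.
elim: es => [|i es IH]; first by rewrite big_nil; exact: negligible_set0.
rewrite big_cons; apply: negligibleU => // {es IH}.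
have m01 : measurable [set 0; 1 : R] by apply: measurableU; exact: measurable_set1.
have mA : measurable (a i @^-1` [set 0; 1]).
  by rewrite -[X in measurable X]setTI; exact: measurable_funPT.
exists (a i @^-1` (~` [set 0; 1])); split => //.
  by rewrite -preimage_setC; exact: measurableC.
rewrite -preimage_setC; apply: etrans (probability_setC P mA) _.
have [H1 H0] := bern_a i.
have mpre r : measurable (a i @^-1` [set r]).
  rewrite -[X in measurable X]setTI; exact: (measurable_funPT (a i) measurableT _ (measurable_set1 r)).
have disj : a i @^-1` [set 0] `&` a i @^-1` [set 1] = set0.
  apply/seteqP; split=> // w /= [-> /eqP]; by rewrite eq_sym oner_eq0.
have -> : P (a i @^-1` [set 0; 1]) = 1%E.
  rewrite preimage_setU; apply: etrans (measureU P (mpre 0) (mpre 1) disj) _.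
  by apply: etrans (f_equal2 (fun x y => x + y)%E H0 H1) _; rewrite -EFinD subrK.
by rewrite subee.
Qed.

End bernoulli_expectation.

Section incomplete_ustatistic.
Context {R : realType} {B : completeNormedModType R}.
Context {dT : measure_display} {T : measurableType dT} {P : probability T R}.
Context {dS : measure_display} {S : measurableType dS}.
Variables (xi : int -> {RV P >-> S}) (m n : nat) (a : Inc m n -> {RV P >-> R}).
Variables (pn q : R).
Hypotheses (iid_xi : iid xi) (iid_a : iid a) (indep : independent_families a xi).
Hypothesis bern_a : forall i, bernoulli_rv pn (a i).
Hypothesis q_ge1 : 1 <= q.

Let q_gt0 : 0 < q. Proof. exact: lt_le_trans q_ge1. Qed.

Lemma first_ints_iota : first_ints n = [seq j%:Z | j <- iota 1 n].
Proof. by rewrite /first_ints (iotaDl 1 0 n) -map_comp. Qed.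

Lemma map_xi_at (K : Type) (pi : S -> K) (i : Inc m n) w :
  map pi (xi_at xi i w) = [seq pi (xi j%:Z w) | j <- Inc_seq i].
Proof.
rewrite /xi_at /Inc_seq -map_comp.
rewrite -[in RHS](map_tnth_enum (val i)) /= -!map_comp.
by apply: eq_map => k.
Qed.

Definition at_tuple (i : Inc m n) : m.-tuple int :=
  [tuple (nat_of_ord (tnth (val i) k))%:Z | k < m].

Lemma xi_at_tupleX i w : xi_at xi i w = tupleX xi (at_tuple i) w.
Proof. by apply: eq_from_tnth => k; rewrite !tnth_mktuple. Qed.

Lemma at_tuple_uniq i : uniq (at_tuple i).
Proof.
have : uniq (Inc_seq i).
  exact: (sorted_uniq ltn_trans ltnn (path_sorted (valP i))).
rewrite -(@map_inj_uniq _ _ Posz); last by move=> j k [].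
congr uniq; rewrite /Inc_seq /= -map_comp.
rewrite -[in LHS](map_tnth_enum (val i)) -map_comp.
by apply: eq_map.
Qed.

Lemma integral_xi_at (f : m.-tuple S -> \bar R) (i : Inc m n) : measurable_fun setT f ->
  (forall x, 0 <= f x)%E ->
  (\int[P]_w f (xi_at xi i w) = \int[P]_w f (xi_first xi m w))%E.
Proof.
move=> mf f0; under eq_integral do rewrite xi_at_tupleX.
under [RHS]eq_integral do rewrite xi_first_tupleX.
apply: (integral_tupleX iid_xi) => //; first exact: at_tuple_uniq.
by rewrite val_first_tuple first_ints_uniq.
Qed.

Lemma discrete_Uinc (es : seq (Inc m n)) (K : finType) (pi : S -> K)
    (H : seq K -> B) w :
  map (@Inc_seq m n) es = combs m (iota 1 n) -> uniq es -> (forall i, i \in es) ->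
  \sum_(i : Inc m n) (a i w == 1)%:R *: H (map pi (xi_at xi i w)) =
  weighted_sum (fun b : bool => b%:R) [seq a i w == 1 | i <- es]
    [seq H t | t <- combs m (map pi (xi_first xi n w))].
Proof.
move=> esE ues es_all.
rewrite map_xi_first first_ints_iota -map_comp combs_map -esE -!map_comp.
rewrite weighted_sum_map (sum_Inc _ ues es_all).
by apply: eq_bigr => i _; rewrite map_xi_at.
Qed.

Lemma Uinc_approx_error (h : m.-tuple S -> B) (es : seq (Inc m n)) (K : finType)
    (pi : S -> K) (H : seq K -> B) w :
  map (@Inc_seq m n) es = combs m (iota 1 n) -> uniq es -> (forall i, i \in es) ->
  (forall i, a i w = 0 \/ a i w = 1) ->
  `|Uinc xi a h w| `^ q <=
  2 `^ q * (`|weighted_sum (fun b : bool => b%:R) [seq a i w == 1 | i <- es]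
               [seq H t | t <- combs m (map pi (xi_first xi n w))]| `^ q +
    #|{: Inc m n}|%:R `^ q *
      \sum_(i : Inc m n) `|h (xi_at xi i w) - H (map pi (xi_at xi i w))| `^ q).
Proof.
move=> esE ues es_all a01.
rewrite -discrete_Uinc//; set D := \sum_i _ *: _.
pose y (i : Inc m n) := `|h (xi_at xi i w) - H (map pi (xi_at xi i w))|.
apply: (@le_trans _ _ ((`|D| + \sum_i y i) `^ q)).
  apply: ler_powR2r => //; first exact: ltW.
  rewrite -lerBlDl (le_trans (lerB_dist _ _))// /Uinc /D -sumrB.
  apply: (le_trans (ler_norm_sum _ _ _)); apply: ler_sum => i _.
  have [->|->] := a01 i; last by rewrite eqxx !scale1r.
  by rewrite eq_sym oner_eq0 !scale0r subr0 normr0 /y normr_ge0.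
apply: (le_trans (powR_addr_le (ltW q_gt0) (normr_ge0 _) (sumr_ge0 _ _))).
  by move=> i _; exact: normr_ge0.
rewrite ler_wpM2l ?powR_ge0// lerD2l.
exact: (sum_powR_le (y := y) q_gt0 (fun i => normr_ge0 _)).
Qed.

Lemma Uinc_eq0 (h : m.-tuple S -> B) w : (forall i, a i w = 0) -> Uinc xi a h w = 0.
Proof. by move=> a0; rewrite /Uinc big1// => i _; rewrite a0 scale0r. Qed.

Lemma integral_Uinc_approx (h : m.-tuple S -> B) (K : finType)
    (pi : S -> K) (H : seq K -> B) (eps : R) :
  (0 < m <= n)%N ->
  measurable_fun setT (h : m.-tuple S -> borel B) -> finite_rv pi ->
  (\int[P]_w (`|h (xi_first xi m w) - H (map pi (xi_first xi m w))| `^ q)%:E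
    <= eps%:E)%E ->
  (\int[P]_w (`|Uinc xi a h w| `^ q)%:E <=
   (2 `^ q * (expect (law_weight xi pi 0) n (fun s =>
      expect (bern pn) 'C(n, m) (fun bs =>
       `|weighted_sum (fun b => b%:R) bs [seq H t | t <- combs m s]| `^ q)) +
      #|{: Inc m n}|%:R `^ q * (#|{: Inc m n}|%:R * eps)))%:E)%E.
Proof.
move=> /andP[m0 mn] mh mpi Heps.
have [es [esE ues es_all]] := Inc_enum m n.
have szes := size_Inc_enum esE.
have [Z [mZ PZ subZ]] := negligible_not_bernoulli bern_a es.
have a01 w : ~ Z w -> forall i, a i w = 0 \/ a i w = 1.
  move=> nZ i; apply: contrapT => a01; apply: nZ; apply: subZ.
  by rewrite -bigcup_seq; exists i => //=; exact: es_all.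
pose L : R := #|{: Inc m n}|%:R.
have L0 : 0 <= L by [].
pose f1 w := (`|weighted_sum (fun b : bool => b%:R) [seq a i w == 1 | i <- es]
               [seq H t | t <- combs m (map pi (xi_first xi n w))]| `^ q)%:E.
pose y (i : Inc m n) w := (`|h (xi_at xi i w) - H (map pi (xi_at xi i w))| `^ q)%:E.
have mphi : measurable_fun setT (fun x => (`|h x - H (map pi x)| `^ q)%:E).
  exact: measurable_approx_error.
have my i : measurable_fun setT (y i).
  have := measurableT_comp mphi (measurable_tupleX xi (at_tuple i)).
  by congr measurable_fun; apply/funext => w; rewrite /y xi_at_tupleX.
have y0 i w : (0 <= y i w)%E by rewrite lee_fin powR_ge0.
have f10 w : (0 <= f1 w)%E by rewrite lee_fin powR_ge0.
have mf1 : measurable_fun setT f1.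
  pose X w := (map_tuple (fun i => a i w == 1) (in_tuple es), first_rv xi n pi w).
  have mX : finite_rv X.
    apply: finite_rv_pair; last exact: finite_first_rv.
    move=> tb; rewrite (_ : _ @^-1` _ = [set w | [seq a i w == 1 | i <- es] = tb]).
      exact: (measurable_joint a finite_rv_eq1).
    apply/seteqP; split=> w; rewrite /preimage /=; first by move=> <-.
    by move=> e; apply: val_inj.
  apply/measurable_EFinP.
  apply: (measurable_finite_rv (X := X) (F := fun k _ =>
    `|weighted_sum (fun b : bool => b%:R) k.1
               [seq H t | t <- combs m k.2]| `^ q) mX) => k.
  exact: measurable_cst.
have msum : measurable_fun setT (fun w => \sum_i y i w)%E.
  exact: emeasurable_sum.
apply: (@le_trans _ _ (\int[P]_w ((2 `^ q)%:E *
    (f1 w + (L `^ q)%:E * \sum_i y i w)))%E).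
  apply: (ge0_le_integral_off mZ PZ) => [|w|w|w nZ].
  - apply: emeasurable_funM => //; apply: emeasurable_funD => //.
    exact: emeasurable_funM.
  - by rewrite lee_fin powR_ge0.
  - rewrite mule_ge0 ?lee_fin ?powR_ge0// adde_ge0// mule_ge0 ?lee_fin ?powR_ge0//.
    by apply: sume_ge0.
  rewrite /f1 /y sumEFin -EFinM lee_fin.
  exact: Uinc_approx_error (a01 w nZ).
rewrite ge0_integralZl_EFin ?powR_ge0//; last 2 first.
- move=> w _; rewrite adde_ge0// mule_ge0 ?lee_fin ?powR_ge0//.
  exact: sume_ge0.
- by apply: emeasurable_funD => //; exact: emeasurable_funM.
rewrite EFinM; apply: lee_wpmul2l; first by rewrite lee_fin powR_ge0.
rewrite ge0_integralD//; last 2 first.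
- by move=> w _; rewrite mule_ge0 ?lee_fin ?powR_ge0//; exact: sume_ge0.
- exact: emeasurable_funM.
rewrite EFinD; apply: leeD.
  pose F (bs : seq bool) (s : seq K) :=
    `|weighted_sum (fun b => b%:R) bs [seq H t | t <- combs m s]| `^ q.
  have es0 : (0 < size es)%N by rewrite szes bin_gt0.
  have F0 bs s : 0 <= F bs s by exact: powR_ge0.
  rewrite -szes; have := @integral_bernoulli_sample _ _ _ P _ _ _ xi a pn
    iid_xi iid_a indep bern_a K pi n es F mpi ues es0 F0.
  by move=> <-.
rewrite ge0_integralZl_EFin ?powR_ge0//; last by move=> w _; exact: sume_ge0.
rewrite EFinM; apply: lee_wpmul2l; first by rewrite lee_fin powR_ge0.
rewrite ge0_integral_sum//.
apply: (@le_trans _ _ (\sum_(i : Inc m n) eps%:E)%E).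
  apply: lee_sum => i _; apply: le_trans Heps.
  rewrite /y (integral_xi_at (f := fun x => (`|h x - H (map pi x)| `^ q)%:E) i mphi)//.
by rewrite sumEFin lee_fin sumr_const mulr_natl.
Qed.

End incomplete_ustatistic.

(** * Passage to the limit and the cases left out by it *)

Lemma Uinc_moment_finite (R : realType) (B : completeNormedModType R)
    (r p q : R) (m : nat) : separable B -> (0 < m)%N ->
  1 < p -> p <= r -> r <= 2 -> p <= q -> r_smooth B r ->
  exists2 C : R, 0 <= C &
  forall (dT : measure_display) (T : measurableType dT) (P : probability T R)
    (dS : measure_display) (S : measurableType dS)
    (xi : int -> {RV P >-> S}) (h : m.-tuple S -> B) (d n : nat) (pn : R)
    (a : Inc m n -> {RV P >-> R}),
  iid xi -> measurable_fun setT (h : m.-tuple S -> borel B) ->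
  symmetric_kernel h -> (d <= m)%N -> degenerate_of_order xi h d ->
  (m <= n)%N -> 0 <= pn <= 1 -> iid a -> (forall i, bernoulli_rv pn (a i)) ->
  independent_families a xi ->
  (\int[P]_w (`|h (xi_first xi m w)| `^ q)%:E < +oo)%E ->
  (\int[P]_w (`|Uinc xi a h w| `^ q)%:E <=
   (C * (n%:R `^ (q * (m%:R - d%:R) + d%:R * q / p) * pn `^ q
         + n%:R `^ (m%:R * q / p) * pn `^ (q / p)
         + n%:R ^+ m * pn))%:E *
   \int[P]_w (`|h (xi_first xi m w)| `^ q)%:E)%E.
Proof.
move=> sepB m0 p1 pr r2 pq smooth.
have q1 : 1 <= q by exact/ltW/(lt_le_trans p1).
have q0 : 0 < q by exact: lt_le_trans q1.
have [C0 C00 HC] := r_smooth_finite_moment m p1 pr r2 pq smooth.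
have t0 : 0 <= 2 `^ q :> R by exact: powR_ge0.
exists (2 `^ q * C0 * 2 `^ q); first by rewrite !mulr_ge0.
move=> dT T P dS S xi h d n pn a iid_xi mh symh dm degh mn pn01 iid_a bern_a indep hfin.
have [pn0 pn1] := andP pn01.
set cf : R := _ + _ + n%:R ^+ m * pn.
have cf0 : 0 <= cf by rewrite !addr_ge0 ?mulr_ge0 ?powR_ge0 ?exprn_ge0.
set I0 := (\int[P]_w (`|h (xi_first xi m w)| `^ q)%:E)%E in hfin *.
have I00 : (0 <= I0)%E by apply: integral_ge0 => w _; rewrite lee_fin powR_ge0.
have I0fin : I0 \is a fin_num by rewrite ge0_fin_numE.
set X := (\int[P]_w _)%E.
pose L : R := #|{: Inc m n}|%:R.
(* [D] collects every coefficient of [eps]: the excess of the moment of [H] over that of h, the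
   defect of degeneracy, and the error of discretizing the statistic. *)
pose D : R := 2 `^ q * C0 * (cf * 2 `^ q + n%:R `^ (q * m%:R)) + 2 `^ q * (L `^ q * L).
have D0 : 0 <= D.
  by rewrite addr_ge0 ?mulr_ge0 ?powR_ge0// addr_ge0 ?mulr_ge0 ?powR_ge0.
have key (eps : R) : 0 < eps ->
    (X <= (2 `^ q * C0 * 2 `^ q * cf * fine I0 + D * eps)%:E)%E.
  move=> e0.
  have [K [pi [H [mpi Hs Heps]]]] := approx_symmetric iid_xi q1 sepB mh symh hfin e0.
  have m0n : (0 < m <= n)%N by rewrite m0.
  apply: (le_trans (integral_Uinc_approx iid_xi iid_a indep bern_a q1 m0n mh mpi Heps)).
  set wt := law_weight xi pi 0.
  have wwt : weights wt by exact: weights_law.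
  have Hc c : (c < d)%N -> cond_moment Num.norm q wt m c H <= eps.
    move=> cd; rewrite -lee_fin; apply: le_trans Heps.
    apply: (cond_moment_degenerate iid_xi q1 H mpi mh degh cd).
    exact: leq_trans (ltnW cd) dm.
  have := HC K wt H n d pn eps wwt Hs m0n dm pn01 (ltW e0) Hc.
  set E1 := expect wt n _; set E2 := expect wt m _ => HE1.
  have HE2 : E2 <= 2 `^ q * (fine I0 + eps).
    rewrite -lee_fin /E2 -(expect_first_rv iid_xi m mpi (F := fun s => `|H s| `^ q)); last first.
      by move=> t; exact: powR_ge0.
    have mhx := measurable_h_xi_first xi mh.
    have mf1 : measurable_fun setT (fun w => (`|h (xi_first xi m w)| `^ q)%:E).
      apply: (@measurable_powR_norm _ _ _ q (fun w => `|h (xi_first xi m w)|)).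
      have := @measurable_normB _ _ _ _ _ 0 mhx.
      by under eq_fun do rewrite subr0.
    have mf2 : measurable_fun setT
        (fun w => (`|h (xi_first xi m w) - H (map pi (xi_first xi m w))| `^ q)%:E).
      apply: (@measurable_powR_norm _ _ _ q
        (fun w => `|h (xi_first xi m w) - H (map pi (xi_first xi m w))|)).
      exact: (measurable_err xi H mpi mh).
    apply: (@le_trans _ _ (\int[P]_w ((2 `^ q)%:E * ((`|h (xi_first xi m w)| `^ q)%:E +
       (`|h (xi_first xi m w) - H (map pi (xi_first xi m w))| `^ q)%:E)))%E).
      apply: ge0_le_integral_nomeas => w; first by rewrite lee_fin powR_ge0.
      rewrite -EFinD -EFinM lee_fin.
      apply: le_trans (powR_addr_le (ltW q0) (normr_ge0 _) (normr_ge0 _)).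
      apply: ler_powR2r => //; first exact: ltW.
      by rewrite -{1}(subKr (h (xi_first xi m w)) (H _)) ler_normB.
    rewrite ge0_integralZl_EFin//; last 2 first.
    - by move=> w _; rewrite adde_ge0// lee_fin powR_ge0.
    - exact: emeasurable_funD.
    rewrite ge0_integralD// EFinM; apply: lee_wpmul2l; first by rewrite lee_fin.
    by rewrite EFinD fineK// -/I0; apply: (leeD (lexx _) Heps).
  rewrite lee_fin.
  have H1 := ler_wpM2l cf0 HE2.
  have H2 := ler_wpM2l C00 (lerD H1 (lexx (n%:R `^ (q * m%:R) * eps))).
  have H3 := ler_wpM2l t0 (le_trans HE1 H2).
  rewrite mulrDr; apply: (le_trans (lerD H3 (lexx _))).
  by rewrite /D -/L le_eqVlt; apply/orP; left; apply/eqP; ring.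
rewrite -(fineK I0fin) -EFinM.
apply/lee_addgt0Pr => e e0.
(* [D] may be 0, hence the division by [D + 1]. *)
have D10 : 0 < D + 1 by rewrite ltr_wpDl.
apply: (le_trans (key (e / (D + 1)) (divr_gt0 e0 D10))).
rewrite -EFinD lee_fin lerD2l mulrCA ger_pMr//.
by rewrite ler_pdivrMr// mul1r lerDl.
Qed.

(** This covers [pn = 0] with an infinite moment of h, where approximation is impossible and the
    right side of the theorem is the product of 0 and [+oo], that is 0. The condition on q is due to
    [0 ^ 0 = 1]. *)
Lemma Uinc_null (R : realType) (B : completeNormedModType R) (m n : nat)
    (dT : measure_display) (T : measurableType dT) (P : probability T R)
    (dS : measure_display) (S : measurableType dS)
    (xi : int -> {RV P >-> S}) (h : m.-tuple S -> B) (a : Inc m n -> {RV P >-> R})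
    (q : R) : q != 0 -> (forall i, bernoulli_rv 0 (a i)) ->
  (\int[P]_w (`|Uinc xi a h w| `^ q)%:E = 0)%E.
Proof.
move=> q0 bern_a.
have [es [_ _ es_all]] := Inc_enum m n.
have [Z [mZ PZ subZ]] : P.-negligible
    (\big[setU/set0]_(i <- es) (a i @^-1` (~` [set 0]))).
  elim: es {es_all} => [|i es IH]; first by rewrite big_nil; exact: negligible_set0.
  rewrite big_cons; apply: negligibleU => // {es IH}.
  have mA : measurable (a i @^-1` [set 0]).
    rewrite -[X in measurable X]setTI.
    exact: (measurable_funPT (a i) measurableT _ (measurable_set1 0)).
  exists (a i @^-1` (~` [set 0])); split => //.
    by rewrite -preimage_setC; exact: measurableC.
  rewrite -preimage_setC; apply: etrans (probability_setC P mA) _.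
  have [_ H0] := bern_a i.
  have -> : P (a i @^-1` [set 0]) = 1%E by rewrite subr0 in H0; exact: H0.
  by rewrite subee.
apply/eqP; rewrite eq_le; apply/andP; split; last first.
  by apply: integral_ge0 => w _; rewrite lee_fin powR_ge0.
rewrite -[leRHS](integral0 P setT).
apply: (ge0_le_integral_off mZ PZ) => // w nZ.
rewrite Uinc_eq0 ?normr0 ?powR0// => i.
apply: contrapT => ai; apply: nZ; apply: subZ.
by rewrite -bigcup_seq; exists i => //=; exact: es_all.
Qed.

Theorem theorem2p4 (R : realType) (B : completeNormedModType R)
    (B_separable : separable B) (m : nat) (m_ge2 : (2 <= m)%N)
    (p q : R) (p_gt1 : 1 < p) (le_pq : p <= q) :
  exists C : R,
  forall (r : R), 1 < r <= 2 -> r_smooth B r -> p <= r ->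
  forall (dT : measure_display) (T : measurableType dT) (P : probability T R)
    (dS : measure_display) (S : measurableType dS)
    (xi : int -> {RV P >-> S}) (h : m.-tuple S -> B) (d n : nat) (pn : R)
    (a : Inc m n -> {RV P >-> R}),
  iid xi ->
  measurable_fun setT (h : m.-tuple S -> borel B) ->
  symmetric_kernel h ->
  (1 <= d <= m)%N ->
  degenerate_of_order xi h d ->
  (m <= n)%N ->
  0 <= pn <= 1 ->
  iid a ->
  (forall i, bernoulli_rv pn (a i)) ->
  independent_families a xi ->
  ('E_P[fun w => (`|Uinc xi a h w| `^ q)%R] <=
   (C * (n%:R `^ (q * (m%:R - d%:R) + d%:R * q / p) * pn `^ q
         + n%:R `^ (m%:R * q / p) * pn `^ (q / p)
         + n%:R ^+ m * pn))%:E
   * 'E_P[fun w => (`|h (xi_first xi m w)| `^ q)%R])%E.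
Proof.
have q0 : 0 < q by rewrite (lt_le_trans _ le_pq)// (lt_trans _ p_gt1).
have m0 : (0 < m)%N by exact: leq_trans m_ge2.
(* The constant may not depend on r. One admissible exponent [r0], if there is any, provides it for
   all r, since the final bound involves p only; if there is none, nothing is claimed. *)
have [smooth|no_smooth] := pselect (exists r : R, [/\ 1 < r <= 2, r_smooth B r & p <= r]);
    last first.
  by exists 0 => r r12 sr pr; exfalso; apply: no_smooth; exists r.
have [r0 [/andP[_ r2] sr pr]] := smooth.
have [C C0 HC] := Uinc_moment_finite B_separable m0 p_gt1 pr r2 le_pq sr.
(* A positive constant makes the right side [+oo] when the moment of h is infinite and [pn > 0]. *)
exists (C + 1) => _ _ _ _ dT T P dS S xi h d n pn a iid_xi mh symh /andP[_ dm] degh mn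
  pn01 iid_a bern_a indep.
rewrite unlock.
set I0 := (\int[P]_w (`|h (xi_first xi m w)| `^ q)%:E)%E.
have [pn0 pn1] := andP pn01.
set cf : R := _ + _ + n%:R ^+ m * pn.
have cf0 : 0 <= cf by rewrite !addr_ge0 ?mulr_ge0 ?powR_ge0 ?exprn_ge0.
have I00 : (0 <= I0)%E by apply: integral_ge0 => w _; rewrite lee_fin powR_ge0.
have C10 : 0 < C + 1 by rewrite ltr_wpDl.
have [hfin|] := ltP I0 +oo%E.
  apply: (le_trans (HC _ _ P _ _ xi h d n pn a iid_xi mh symh dm degh mn pn01 iid_a
    bern_a indep hfin)).
  by rewrite -/I0 -/cf; apply: lee_wpmul2r => //; rewrite lee_fin ler_wpM2r// lerDl.
rewrite leye_eq => /eqP ->.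
move: pn0; rewrite le_eqVlt => /predU1P[pn_eq0|pn_gt0].
  rewrite Uinc_null ?gt_eqF//; first by rewrite mule_ge0// lee_fin mulr_ge0// ltW.
  by move=> i; rewrite pn_eq0; exact: bern_a.
rewrite gt0_muley ?leey// lte_fin mulr_gt0// /cf ltr_wpDl//.
  by rewrite addr_ge0 ?mulr_ge0 ?powR_ge0.
by rewrite mulr_gt0// exprn_gt0// ltr0n (leq_trans m0).
Qed.
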